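(* Let $b=\rho\,\Phi\in C^1_\sharp(Y_2)^2$ be a vector field, where $\rho\in C^1_\sharp(Y_2)$ is a non negative function with a positive finite number of roots in $Y_2$, and where $\Phi\in C^1_\sharp(Y_2)^2$ is a non vanishing vector field. Also assume that there exists a function $u\in C^1(\mathbb{R}^2)$ with $\nabla u\in C^0_\sharp(Y_2)^2$, such that $\int_{Y_2}\nabla u(y)\,dy$ has incommensurable coordinates and $\Phi\cdot\nabla u=0$ in $Y_2$. Then there exists a vector $\zeta\in\mathbb{R}^2$ such that $\mathsf{C}_b=[0,\zeta]$ (the closed segment with endpoints $0$ and $\zeta$), together with $\mathsf{D}_b=\emptyset$ or $\mathsf{D}_b=\{\zeta\}$.
   Context: $Y_2=\mathbb{R}^2/\mathbb{Z}^2$ is the two-dimensional torus, identified with $[0,1)^2$. $C^k_\sharp(Y_2)$ denotes the $\mathbb{Z}^2$-periodic real-valued functions in $C^k(\mathbb{R}^2)$, and $L^1_\sharp(Y_2)$ the functions in $L^1_{\rm loc}(\mathbb{R}^2)$ that are $\mathbb{Z}^2$-periodic a.e. A vector $\xi\in\mathbb{R}^2$ has incommensurable coordinates if $k\cdot\xi\neq0$ for every $k\in\mathbb{Z}^2\setminus\{0\}$. The flow $X$ associated with $b\in C^1_\sharp(Y_2)^2$ is the unique solution to $\partial_tX(t,x)=b(X(t,x))$, $t\in\mathbb{R}$, $X(0,x)=x$; it satisfies $X(t,x+k)=X(t,x)+k$ for $k\in\mathbb{Z}^2$. A Borel measure $\mu$ on $Y_2$ is invariant for $X$ if $\int_{Y_2}\psi(X(t,y))\,d\mu(y)=\int_{Y_2}\psi(y)\,d\mu(y)$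 for all $t\in\mathbb{R}$, $\psi\in C^0_\sharp(Y_2)$; $\mathscr{I}_b$ is the set of invariant probability measures on $Y_2$. Define $$\mathsf{C}_b:=\Big\{\int_{Y_2}b\,d\mu:\mu\in\mathscr{I}_b\Big\},\qquad \mathsf{D}_b:=\Big\{\int_{Y_2}b(y)\sigma(y)\,dy:\sigma\in L^1_\sharp(Y_2),\ \sigma(y)\,dy\in\mathscr{I}_b\Big\}.$$ *)

(* Defs.v *)
From HB Require Import structures.
From mathcomp Require Import all_boot all_order all_algebra.
From mathcomp Require Import all_classical all_reals all_analysis.
Set Implicit Arguments.
Unset Strict Implicit.
Unset Printing Implicit Defensive.
Import Order.TTheory GRing.Theory Num.Theory.
Import numFieldNormedType.Exports.
Local Open Scope classical_set_scope.
Local Open Scope ring_scope.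

(* [plane] carries the topological and normed structures, [mplane] the Borel
   sigma-algebra (here the product of the two Borel sigma-algebras); the two
   types are convertible. *)
Notation plane R := (Real.sort R * Real.sort R)%type.
Notation mplane R := (measurableTypeR R * measurableTypeR R)%type.

(* The torus R^2/Z^2 is identified with its fundamental domain [0,1)^2.
   Functions on the torus are Z^2-periodic functions on the plane, and Borel
   measures on the torus are Borel measures on the plane carried by [Y2]. *)
Definition Y2 (R : realType) : set (plane R) := `[0, 1[ `*` `[0, 1[.
Arguments Y2 {R}.

Definition leb2 (R : realType) : {measure set (mplane R) -> \bar R} :=
  (lebesgue_measure \x lebesgue_measure)%E.
Arguments leb2 {R}.

Definition dot (R : realType) (x y : plane R) : R := x.1 * y.1 + x.2 * y.2.

Definition zvec (R : realType) (k : int * int) : plane R :=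
  (k.1%:~R, k.2%:~R).

Definition incommensurable (R : realType) (xi : plane R) : Prop :=
  forall k : int * int, k <> (0, 0) -> dot (zvec R k) xi <> 0.

Definition periodic (R : realType) (V : Type) (f : plane R -> V) : Prop :=
  forall (k : int * int) x, f (x + zvec R k) = f x.

Definition C1 (R : realType) (V : normedModType R) (f : plane R -> V) : Prop :=
  (forall x, differentiable f x) /\
  (forall v : plane R, continuous (fun x => 'D_v f x)).

Definition C0_per (R : realType) (V : normedModType R) (f : plane R -> V) :=
  continuous f /\ periodic f.

Definition C1_per (R : realType) (V : normedModType R) (f : plane R -> V) :=
  C1 f /\ periodic f.

Definition grad (R : realType) (u : plane R -> R) (x : plane R) : plane R :=
  ('D_((1, 0) : plane R) u x, 'D_((0, 1) : plane R) u x).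

Definition int_Y2 (R : realType) (mu : {measure set (mplane R) -> \bar R})
    (f : plane R -> plane R) : plane R :=
  (\int[mu]_(y in Y2) (f y).1, \int[mu]_(y in Y2) (f y).2).

Definition L1_per (R : realType) (s : plane R -> R) : Prop :=
  [/\ measurable_fun [set: mplane R] (s : mplane R -> R),
      (forall K : set (plane R), compact K ->
         leb2.-integrable (K : set (mplane R)) (EFin \o s)) &
      (forall k : int * int,
         {ae leb2, forall x : mplane R, s ((x : plane R) + zvec R k) = s x})].

Definition is_flow (R : realType) (b : plane R -> plane R)
    (X : R -> plane R -> plane R) : Prop :=
  forall x, X 0 x = x /\
    forall t : R, is_derive t 1 (fun r => X r x) (b (X t x)).

Definition invariant (R : realType) (X : R -> plane R -> plane R)
    (mu : {measure set (mplane R) -> \bar R}) : Prop :=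
  forall (t : R) (psi : plane R -> R), C0_per psi ->
    \int[mu]_(y in Y2) psi (X t y) = \int[mu]_(y in Y2) psi y.

(* For C^1 periodic [b] the flow exists and is unique, so the existential
   quantifier over [X] denotes "the" flow of [b]. *)
Definition inv_prob (R : realType) (b : plane R -> plane R)
    (mu : probability (mplane R) R) : Prop :=
  mu (Y2 : set (mplane R)) = 1%E /\
  exists X, is_flow b X /\ invariant X mu.

Definition C_set (R : realType) (b : plane R -> plane R) : set (plane R) :=
  [set v | exists mu : probability (mplane R) R,
     inv_prob b mu /\ v = int_Y2 mu b].

Definition has_density (R : realType) (mu : probability (mplane R) R)
    (s : plane R -> R) : Prop :=
  forall A : set (mplane R), measurable A -> A `<=` Y2 ->
    mu A = (\int[leb2]_(y in A) (s y)%:E)%E.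

Definition D_set (R : realType) (b : plane R -> plane R) : set (plane R) :=
  [set v | exists s : plane R -> R,
     [/\ L1_per s,
         exists mu : probability (mplane R) R,
           has_density mu s /\ inv_prob b mu &
         v = int_Y2 leb2 (fun y => s y *: b y)]].

Definition segment (R : realType) (a c : plane R) : set (plane R) :=
  [set (1 - t) *: a + t *: c | t in `[0, 1]].

(* Main.v *)
Require Import Defs.
From HB Require Import structures.
From mathcomp Require Import all_boot all_order all_algebra.
From mathcomp Require Import all_classical all_reals all_analysis.
From mathcomp Require Import measurable_realfun ring lra.
Set Implicit Arguments.
Unset Strict Implicit.
Unset Printing Implicit Defensive.
Import Order.TTheory GRing.Theory Num.Theory.
Import numFieldNormedType.Exports.
Local Open Scope classical_set_scope.
Local Open Scope ring_scope.

(* An invariant probability has mean velocity orthogonal to [xi], the mean of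
   [grad u]: the function [u x - xi . x] is periodic and its derivative along the
   flow is [- xi . b]. So all mean velocities lie on one line, and two invariant
   probabilities have a combination [lam = c mu1 - mu2], restricted to the
   non-zeros of [b], with zero flux.

   The field [b lam] is divergence free with zero mean, hence has a periodic
   stream function, which is considered after mollification at scale [e]. It is
   almost constant along orbits. No orbit closes up modulo Z^2: a nonzero period
   is excluded by the incommensurability of [xi], and a contractible closed orbit
   because the direction of [Phi] lifts to an angle function on the plane. As a
   consequence orbits rarely visit a square of side [e], whose mass is therefore
   [o(e)], and the stream function oscillates little on arcs transverse to the
   flow. In the limit [b lam = 0], so [c mu1] and [mu2] give the same mass to the
   non-zeros of [b]: the mean velocity is this mass times a fixed vector [zeta].

   Unless all mean velocities vanish, this mass takes every value in [0, 1]: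
   restrict an invariant measure to the non-zeros, rescale it and add a Dirac
   mass at a root. It is 1 for a measure with a density, since there are finitely
   many roots. *)

(** * Real calculus: derivatives, mean values and primitives *)

Section RealCalculus.
Variable R : realType.
Implicit Types (f g : R -> R) (a b s t x : R).

(** An invariant measure may be singular, so [b lam] is only a vector measure; the gradient of its
    stream function at scale [e] is of order [e^-2] times the mass of a square of side about [e]. An
    orbit crosses such a square in time [O(e)], and a mass [O(e)] would merely bound the increments
    over distances [O(e)]. The gain to [o(e)] comes from a long time window: without returns before
    time [L], the fraction of time spent in the square is [O(e / L)], with [L] arbitrary. All this
    takes place where [|b| >= c], since return times degenerate at the roots; [c] tends to 0 only at
    the end.

    On a transversal arc the increments of the stream function are fluxes. The arc is cut into
    pieces with separated values: an orbit carries nearly the same value, so it can only return to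
    the same short piece, hence near its starting point, which is excluded. Each orbit thus meets
    the pieces during a time [O(e)] out of [L], and the flux is [O(1 / L)].

    These estimates use only linearity, positivity and invariance on continuous periodic functions;
    measures enter as functionals, time averages as finite sums. *)

Lemma deriveR_eq f s (a c : R) : is_derive s 1 f a -> a = c -> is_derive s 1 f c.
Proof. by move=> df <-. Qed.

Lemma deriveR_add f g s (a c : R) : is_derive s 1 f a -> is_derive s 1 g c ->
  is_derive s 1 (fun r => f r + g r) (a + c).
Proof. by move=> df dg; apply: is_deriveD. Qed.

Lemma deriveR_opp f s (a : R) : is_derive s 1 f a -> is_derive s 1 (fun r => - f r) (- a).
Proof. by move=> df; apply: is_deriveN. Qed.

Lemma deriveR_sub f g s (a c : R) : is_derive s 1 f a -> is_derive s 1 g c ->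
  is_derive s 1 (fun r => f r - g r) (a - c).
Proof. by move=> df dg; apply: is_deriveB. Qed.

Lemma deriveR_mul f g s (a c : R) : is_derive s 1 f a -> is_derive s 1 g c ->
  is_derive s 1 (fun r => f r * g r) (a * g s + f s * c).
Proof.
move=> df dg; have := is_deriveM df dg.
by rewrite /GRing.scale/= (addrC (f s * c)) (mulrC (g s)).
Qed.

Lemma deriveR_cst (c s : R) : is_derive s 1 (fun _ : R => c) (0 : R).
Proof. exact: is_derive_cst. Qed.

Lemma deriveR_id s : is_derive s 1 (fun r : R => r) (1 : R).
Proof. exact: is_derive_id. Qed.

Lemma deriveR_scale f (c s a : R) : is_derive s 1 f a ->
  is_derive s 1 (fun r => c * f r) (c * a).
Proof.
by move=> df; have := deriveR_mul (deriveR_cst c s) df; rewrite mul0r add0r.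
Qed.

Lemma deriveR_comp f g s (a c : R) : is_derive (g s) 1 f a -> is_derive s 1 g c ->
  is_derive s 1 (fun r => f (g r)) (a * c).
Proof. by move=> df dg; apply: (@is_derive1_comp _ f g). Qed.

Lemma deriveR_affine (a c s : R) : is_derive s 1 (fun r => a + r * c) c.
Proof.
have := deriveR_add (deriveR_cst a s) (deriveR_mul (deriveR_id s) (deriveR_cst c s)).
by rewrite mul1r mulr0 addr0 add0r.
Qed.

Lemma deriveR_sqr f s (a : R) : is_derive s 1 f a ->
  is_derive s 1 (fun r => f r ^+ 2) (2 * (f s * a)).
Proof.
by move=> df; apply: deriveR_eq (deriveR_mul df df) _; rewrite mulrC; lra.
Qed.

Lemma is_derive_continuous f (f' : R -> R) :
  (forall s, is_derive s 1 f (f' s)) -> continuous f.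
Proof.
move=> df s; apply: differentiable_continuous; apply/derivable1_diffP.
by case: (df s).
Qed.

Lemma mean_value f (f' : R -> R) a b : a <= b ->
  (forall s, is_derive s 1 f (f' s)) ->
  exists2 c, a <= c <= b & f b - f a = f' c * (b - a).
Proof.
move=> ab df.
have [c cab E] := @MVT_segment R f f' a b ab (fun x _ => df x)
  (continuous_subspaceT (is_derive_continuous df)).
by exists c => //; move: cab; rewrite in_itv.
Qed.

Lemma mean_value_near f (f' : R -> R) a b :
  (forall s, is_derive s 1 f (f' s)) ->
  exists2 c, `|c - a| <= `|b - a| & f b - f a = f' c * (b - a).
Proof.
move=> df; have [ab|/ltW ba] := leP a b.
  have [c /andP[ac cb] E] := mean_value ab df; exists c => //.
  by rewrite !ger0_norm ?subr_ge0// lerB.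
have [c /andP[bc ca] E] := mean_value ba df; exists c.
  by rewrite distrC (distrC b) !ger0_norm ?subr_ge0// lerB.
by rewrite -(opprB (f a)) E -mulrN opprB.
Qed.

Lemma is_derive_nondecreasing g (g' : R -> R) a b : a <= b ->
  (forall s, is_derive s 1 g (g' s)) -> (forall s, a <= s <= b -> 0 <= g' s) ->
  g a <= g b.
Proof.
move=> ab dg g0; have [c cab E] := mean_value ab dg.
by rewrite -subr_ge0 E mulr_ge0 ?g0 ?subr_ge0.
Qed.

Lemma derive_le_norm f g (f' g' : R -> R) a b : a <= b ->
  (forall s, is_derive s 1 f (f' s)) -> (forall s, is_derive s 1 g (g' s)) ->
  (forall s, a <= s <= b -> `|f' s| <= g' s) -> `|f b - f a| <= g b - g a.
Proof.
move=> ab df dg fg; rewrite ler_norml; apply/andP; split.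
- have h s : is_derive s 1 (fun s => g s + f s) (g' s + f' s) by exact: is_deriveD.
  have H : g a + f a <= g b + f b.
    apply: (is_derive_nondecreasing ab h) => s /fg.
    by rewrite ler_norml => /andP[H _]; rewrite -lerBlDl sub0r.
  lra.
- have h s : is_derive s 1 (fun s => g s - f s) (g' s - f' s) by exact: is_deriveB.
  have H : g a - f a <= g b - f b.
    apply: (is_derive_nondecreasing ab h) => s /fg.
    by rewrite ler_norml subr_ge0 => /andP[_].
  lra.
Qed.

Lemma derive_bound f (f' : R -> R) C a b : a <= b ->
  (forall s, is_derive s 1 f (f' s)) ->
  (forall s, a <= s <= b -> `|f' s| <= C) -> `|f b - f a| <= C * (b - a).
Proof.
move=> ab df fC; have [c cab ->] := mean_value ab df.
by rewrite normrM (ger0_norm (_ : 0 <= b - a)) ?subr_ge0// ler_wpM2r ?subr_ge0// fC.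
Qed.

Lemma derive_bound_norm f (f' : R -> R) C a b :
  (forall s, is_derive s 1 f (f' s)) ->
  (forall s, `|f' s| <= C) -> `|f b - f a| <= C * `|b - a|.
Proof.
move=> df fC; have [c _ ->] := mean_value_near a b df.
by rewrite normrM ler_wpM2r.
Qed.

Lemma is_derive_opp_arg f (f' : R -> R) s :
  is_derive (- s) 1 f (f' (- s)) -> is_derive s 1 (fun r => f (- r)) (- f' (- s)).
Proof.
move=> df; rewrite -mulrN1; apply: (@is_derive1_comp _ f -%R).
Qed.

Lemma is_derive_shift_arg f (f' : R -> R) c s :
  is_derive (s + c) 1 f (f' (s + c)) -> is_derive s 1 (fun r => f (r + c)) (f' (s + c)).
Proof.
move=> df; rewrite -[X in is_derive _ _ _ X]mulr1.
apply: (@is_derive1_comp _ f (fun r => r + c)).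
rewrite -[X in is_derive _ _ _ X]addr0.
by apply: is_deriveD.
Qed.

Lemma local_primitive f (m : R) : continuous f ->
  exists F : R -> R, forall t, m < t -> is_derive t 1 F (f t).
Proof.
move=> cf.
exists (fun x => \int[lebesgue_measure]_(t in `[m, x]) f t)%R => t mt.
have int u : lebesgue_measure.-integrable `[m, u] (EFin \o f).
  apply: continuous_compact_integrable; first exact: segment_compact.
  exact: continuous_subspaceT.
have t1 : t < t + 1 by rewrite ltrDl.
have [dF E] := continuous_FTC1_closed t1 (int _) mt (cf t).
split; first exact: dF.
by rewrite -E derive1E.
Qed.

Lemma primitive f : continuous f ->
  exists2 F : R -> R, F 0 = 0 & forall t, is_derive t 1 F (f t).
Proof.
move=> cf.
have /choice[G dG] : forall n : nat, exists F : R -> R,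
    forall t, - n%:R < t -> is_derive t 1 F (f t).
  by move=> n; exact: local_primitive.
(* Two of these primitives differ by a constant to the right of both base points. Normalised at 0
   they agree there, so the base point may depend on [t]. *)
have Gn n m t : - n%:R < t -> - m%:R < t -> - n%:R < 0 :> R -> - m%:R < 0 :> R ->
    G n t - G n 0 = G m t - G m 0.
  move=> nt mt n0 m0.
  have [c Hc] : exists2 c : R, (- n%:R < c /\ - m%:R < c) & (c < t /\ c < 0).
    have H : Num.max (- n%:R) (- m%:R) < Num.min t 0 :> R.
      by rewrite gt_max !lt_min nt mt n0 m0.
    exists ((Num.max (- n%:R) (- m%:R) + Num.min t 0) / 2).
      by apply/andP; rewrite -gt_max midf_lt.
    by apply/andP; rewrite -lt_min midf_lt.
  move=> [ct c0].
  have D s : c < s -> is_derive s 1 (fun s => G n s - G m s) 0.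
    move=> cs; rewrite -(subrr (f s)).
    by apply: is_deriveB; apply: dG; [case: Hc => H _|case: Hc => _ H];
      exact: lt_trans H cs.
  suff H x y : c < x -> x <= y -> G n x - G m x = G n y - G m y.
    have : G n t - G m t = G n 0 - G m 0.
      have [t0|/ltW t0] := leP t 0; first exact: H.
      by apply/esym; exact: H.
    by move=> E; lra.
  move=> cx xy; apply/eqP; rewrite eq_sym -subr_eq0; apply/eqP.
  have [| |z zxy ->] := @MVT_segment R (fun s => G n s - G m s) (fun=> 0) x y xy.
  - move=> z; rewrite in_itv/= => /andP[xz _]; apply: D; exact: lt_trans xz.
  - apply: derivable_within_continuous => z; rewrite in_itv/= => /andP[xz _].
    by case: (D z (lt_le_trans cx xz)).
  - by rewrite mul0r.
pose N t := (Num.truncn `|t|).+1.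
have NP t : - (N t)%:R < t.
  rewrite ltrNl; apply: le_lt_trans (truncnS_gt _); first by rewrite -normrN ler_norm.
have N0 t : - (N t)%:R < 0 :> R by rewrite oppr_lt0.
exists (fun t => G (N t) t - G (N t) 0); first by rewrite subrr.
move=> t; have := dG _ _ (NP t) => H.
have {}H : is_derive t 1 (fun s => G (N t) s - G (N t) 0) (f t).
  by rewrite -[f t]subr0; apply: is_deriveB.
apply: near_eq_is_derive H.
near=> s; apply: Gn => //; near: s.
exact: lt_nbhsr.
Unshelve. all: by end_near. Qed.

End RealCalculus.

(** * Distance to the nearest integer *)
Section PeriodicDistance.
Variable R : realType.
Implicit Types (s t : R) (k : int).

(* Comparable to the distance from [t] to the integers, but smooth off them. *)
Definition pdist t : R := `|sin (pi * t)|.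

Lemma sin_cos_pin (n : nat) : sin (pi * n%:R) = 0 :> R /\ `|cos (pi * n%:R)| = 1 :> R.
Proof.
elim: n => [|n [sn cn]]; first by rewrite mulr0 sin0 cos0 normr1.
by rewrite -natr1 mulrDr mulr1 sinDpi cosDpi sn oppr0 normrN cn.
Qed.

Lemma sin_cos_piz k : sin (pi * k%:~R) = 0 :> R /\ `|cos (pi * k%:~R)| = 1 :> R.
Proof.
case: k => n; first exact: sin_cos_pin.
have [sn cn] := sin_cos_pin n.+1.
by rewrite NegzE mulrNz mulrN sinN cosN sn oppr0.
Qed.

Lemma pdist_ge0 t : 0 <= pdist t. Proof. exact: normr_ge0. Qed.

Lemma pdistN t : pdist (- t) = pdist t.
Proof. by rewrite /pdist mulrN sinN normrN. Qed.

Lemma pdist_sym s t : pdist (s - t) = pdist (t - s).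
Proof. by rewrite -opprB pdistN. Qed.

Lemma pdist0 : pdist 0 = 0. Proof. by rewrite /pdist mulr0 sin0 normr0. Qed.

Lemma pdistD s t : pdist (s + t) <= pdist s + pdist t.
Proof.
rewrite /pdist mulrDr sinD; apply: le_trans (ler_normD _ _) _.
by rewrite !normrM lerD// ?ler_piMr ?ler_piMl// cos_max.
Qed.

Lemma pdistDz t k : pdist (t + k%:~R) = pdist t.
Proof.
have [sk ck] := sin_cos_piz k.
by rewrite /pdist mulrDr sinD sk mulr0 addr0 normrM ck mulr1.
Qed.

Lemma cts_pdist : continuous pdist.
Proof.
move=> t; apply: (@continuous_comp _ _ _ (fun t => sin (pi * t)) Num.norm).
  apply: (@continuous_comp _ _ _ (fun t => pi * t) sin); last exact: continuous_sin.
  by apply: (@continuousM _ _ (cst pi) id); [exact: cvg_cst|exact: cvg_id].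
exact: norm_continuous.
Qed.

Lemma sin_le_norm s : `|sin s| <= `|s|.
Proof.
have := @derive_bound_norm R sin cos 1 0 s (fun s => is_derive_sin s) (@cos_max R).
by rewrite sin0 !subr0 mul1r.
Qed.

Lemma pdist_le t : pdist t <= 4 * `|t|.
Proof.
rewrite /pdist; apply: le_trans (sin_le_norm _) _.
rewrite normrM ler_wpM2r// ger0_norm ?pi_ge0//.
by have := @pihalf_lt2 R; lra.
Qed.

(** Halving the angle leads to [[0, pi / 4]], where [cos >= 1/2]. This bounds both factors of
    [2 sin (pi t / 2) cos (pi t / 2)] from below and gives [sin (pi t) >= pi t / 4 >= t / 2]. *)
Lemma norm_le_pdist t : `|t| <= 2^-1 -> `|t| <= 2 * pdist t.
Proof.
wlog t0 : t / 0 <= t => [H th|].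
  have [/H/(_ th)//|t0] := leP 0 t.
  by rewrite -normrN -pdistN; apply: H; rewrite ?normrN// oppr_ge0 ltW.
rewrite ger0_norm// => th.
have p2 := @pi_ge2 R.
have pt : pi * t <= pi * 2^-1 by rewrite ler_pM2l ?pi_gt0.
have cy s : 0 <= s <= pi * t / 2 -> 2^-1 <= cos s.
  move=> /andP[s0 st].
  have : 0 <= cos (s *+ 2).
    apply: cos_ge0_pihalf; apply/andP; split; first by lra.
    by lra.
  rewrite cos_mulr2n => H.
  have c0 : 0 <= cos s.
    apply: cos_ge0_pihalf; apply/andP; split; first by lra.
    by lra.
  by rewrite leNgt; apply/negP => c1; nra.
have y0 : 0 <= pi * t / 2 by have := mulr_ge0 (@pi_ge0 R) t0; lra.
have sy : pi * t / 4 <= sin (pi * t / 2).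
  have [c cyy] := @mean_value R sin cos 0 (pi * t / 2) y0 (fun s => is_derive_sin s).
  rewrite sin0 !subr0 => ->; have := cy _ cyy; nra.
have -> : pdist t = sin (pi * t).
  rewrite /pdist ger0_norm//; apply: sin_ge0_pi; nra.
have -> : pi * t = (pi * t / 2) *+ 2 by rewrite -mulr_natr; lra.
rewrite sin_mulr2n.
have := cy (pi * t / 2); rewrite lexx y0 => /(_ isT) c1.
have : t <= pi * t / 2 by nra.
nra.
Qed.

Lemma nearest_int t : exists k, `|t - k%:~R| <= 2^-1.
Proof.
exists (Num.floor (t + 2^-1)).
have := floor_le (t + 2^-1); have := floorD1_gt (t + 2^-1).
rewrite intrD ler_norml => ? ?; apply/andP; split; lra.
Qed.

Lemma pdist_near_int t : exists k, `|t - k%:~R| <= 2 * pdist t /\ `|t - k%:~R| <= 2^-1.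
Proof.
have [k tk] := nearest_int t; exists k; split=> //.
by rewrite -(pdistDz t (- k)) intrN norm_le_pdist.
Qed.

Lemma pdist_eq0 t : pdist t = 0 -> exists k, t = k%:~R.
Proof.
have [k [+ _]] := pdist_near_int t => /[swap] ->.
by rewrite mulr0 normr_le0 subr_eq0 => /eqP ->; exists k.
Qed.

End PeriodicDistance.

(** * Periodic functions on the plane *)
Section Plane.
Variable R : realType.
Implicit Types (x y z : plane R) (k : int * int) (f g : plane R -> R).

Lemma cts_fst : continuous (fun x => x.1).
Proof. by move=> x; exact: cvg_fst. Qed.

Lemma cts_snd : continuous (fun x => x.2).
Proof. by move=> x; exact: cvg_snd. Qed.

Lemma cts_pair (T U V : topologicalType) (f : T -> U) (g : T -> V) :
  continuous f -> continuous g -> continuous (fun t => (f t, g t)).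
Proof.
by move=> cf cg t; apply: (@cvg_pair _ _ _ _ (nbhs (f t)) (nbhs (g t)));
  [exact: cf|exact: cg].
Qed.

Lemma cts_compT (T U V : topologicalType) (h : U -> V) (f : T -> U) :
  continuous h -> continuous f -> continuous (fun t => h (f t)).
Proof. by move=> ch cf t; apply: continuous_comp; [exact: cf|exact: ch]. Qed.

Section Continuity.
Variable T : topologicalType.
Implicit Types (p q : T -> R).

Lemma ctsD p q : continuous p -> continuous q -> continuous (fun t => p t + q t).
Proof. by move=> cp cq t; apply: continuousD; [exact: cp|exact: cq]. Qed.

Lemma ctsN p : continuous p -> continuous (fun t => - p t).
Proof. by move=> cp t; apply: continuousN; exact: cp. Qed.

Lemma ctsB p q : continuous p -> continuous q -> continuous (fun t => p t - q t).
Proof. by move=> cp cq; apply: ctsD => //; exact: ctsN. Qed.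

Lemma ctsM p q : continuous p -> continuous q -> continuous (fun t => p t * q t).
Proof. by move=> cp cq t; apply: continuousM; [exact: cp|exact: cq]. Qed.

Lemma cts_cst (c : R) : continuous (fun _ : T => c).
Proof. by move=> t; exact: cvg_cst. Qed.

Lemma cts_norm p : continuous p -> continuous (fun t => `|p t|).
Proof. by move=> cp t; apply: continuous_comp; [exact: cp|exact: norm_continuous]. Qed.

Lemma cts_comp (h : R -> R) p : continuous h -> continuous p ->
  continuous (fun t => h (p t)).
Proof. by move=> ch cp t; apply: continuous_comp; [exact: cp|exact: ch]. Qed.

Lemma cts_max p q : continuous p -> continuous q ->
  continuous (fun t => Num.max (p t) (q t)).
Proof.
move=> cp cq t; exact: (continuous_max (cp t) (cq t)).
Qed.

Lemma cts_min p q : continuous p -> continuous q ->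
  continuous (fun t => Num.min (p t) (q t)).
Proof.
move=> cp cq t; exact: (continuous_min (cp t) (cq t)).
Qed.

Lemma cts_inv p : (forall t, p t != 0) -> continuous p -> continuous (fun t => (p t)^-1).
Proof. by move=> p0 cp t; apply: continuousV => //; exact: cp. Qed.

Lemma cts_sum (I : Type) (r : seq I) (p : I -> T -> R) :
  (forall i, continuous (p i)) -> continuous (fun t => \sum_(i <- r) p i t).
Proof.
move=> cp; elim: r => [|i r IH].
  by under [X in continuous X]eq_fun do rewrite big_nil; exact: cts_cst.
by under [X in continuous X]eq_fun do rewrite big_cons; exact: ctsD.
Qed.

Lemma compact_positive (A : set T) p : compact A -> continuous p ->
  (forall t, A t -> 0 < p t) -> exists2 m : R, 0 < m & forall t, A t -> m <= p t.
Proof.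
move=> cA cp p0; have [->|A0] := eqVneq A set0; first by exists 1.
have [c cinA mp] := compact_EVT_min (proj1 (set0P A) A0) cA (continuous_subspaceT cp).
exists (p c); first by apply: p0; rewrite inE in cinA.
by move=> t At; apply: mp; rewrite inE.
Qed.

End Continuity.

Definition unit_square : set (plane R) := `[0, 1] `*` `[0, 1].

Lemma compact_unit_square : compact unit_square.
Proof. by apply: compact_setX; exact: segment_compact. Qed.

Lemma reduce_unit_square x : exists k, unit_square (x + zvec R k).
Proof.
have P (t : R) : 0 <= t + (- Num.floor t)%:~R < 1.
  rewrite intrN; have := floor_le t; have := floorD1_gt t.
  rewrite intrD => ? ?; apply/andP; split; lra.
exists (- Num.floor x.1, - Num.floor x.2).
by split; rewrite /= in_itv/=; [have /andP[-> /ltW ->] := P x.1|have /andP[-> /ltW ->] := P x.2].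
Qed.

Lemma reduce_Y2 x : exists k, Y2 (x + zvec R k).
Proof.
have P (t : R) : 0 <= t + (- Num.floor t)%:~R < 1.
  rewrite intrN; have := floor_le t; have := floorD1_gt t.
  rewrite intrD => ? ?; apply/andP; split; lra.
exists (- Num.floor x.1, - Num.floor x.2).
by split; rewrite /= in_itv/= P.
Qed.

Lemma zvecN k : zvec R (- k.1, - k.2) = - zvec R k.
Proof. by rewrite /zvec /= !intrN. Qed.

Lemma zvecD k l : zvec R (k.1 + l.1, k.2 + l.2) = zvec R k + zvec R l.
Proof. by rewrite /zvec /= !intrD. Qed.

Lemma periodic_bounded f : C0_per f -> exists2 M : R, 0 < M & forall x, `|f x| <= M.
Proof.
move=> [cf pf].
have sq0 : unit_square !=set0.
  by exists (0, 0); split => /=; rewrite in_itv/= lexx ler01.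
have [c _ mf] := compact_EVT_max sq0 compact_unit_square
  (continuous_subspaceT (cts_norm cf)).
exists (`|f c| + 1); first by rewrite ltr_wpDl.
move=> x; have [k sqk] := reduce_unit_square x.
by rewrite -(pf k x); have := mf (x + zvec R k); rewrite inE => /(_ sqk) H; lra.
Qed.

(** Compactness of the unit square makes the locally uniform property uniform there, and invariance
    under integer translations spreads it over the plane. *)
Lemma near_uniform_periodic (I : Type) (F : set_system I) (FF : Filter F)
    (P : I -> plane R -> Prop) :
  (forall i x k, P i (x + zvec R k) -> P i x) ->
  (forall x, \forall x' \near x & i \near F, P i x') ->
  \forall i \near F, forall x, P i x.
Proof.
move=> pP nP.
have /compact_near_coveringP/(_ I F P FF) := compact_unit_square.
have /[swap]/[apply] : forall x, unit_square x ->
    \forall x' \near x & i \near F, P i x' by [].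
apply: filterS => i H x.
have [k sqk] := reduce_unit_square x; apply: (pP i x k).
exact: H.
Qed.

Lemma uniform_param (g : R -> plane R -> R) (s0 : R) :
  continuous (fun p : R * plane R => g p.1 p.2) -> (forall s, Defs.periodic (g s)) ->
  forall e : R, 0 < e -> \forall s \near s0, forall z, `|g s z - g s0 z| <= e.
Proof.
move=> cg pg e e0.
apply: (@near_uniform_periodic R (nbhs s0) _ (fun s z => `|g s z - g s0 z| <= e)).
  by move=> s x k; rewrite !pg.
move=> x.
have c2 : continuous (fun p : plane R * R => g p.2 p.1 - g s0 p.1).
  apply: ctsB.
  - apply: (@cts_compT _ _ _ (fun p : R * plane R => g p.1 p.2)
      (fun p : plane R * R => (p.2, p.1))) cg _.
    by apply: cts_pair => p; [exact: cvg_snd|exact: cvg_fst].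
  - apply: (@cts_compT _ _ _ (fun p : R * plane R => g p.1 p.2)
      (fun p : plane R * R => (s0, p.1))) cg _.
    by apply: cts_pair => p; [exact: cvg_cst|exact: cvg_fst].
have := c2 (x, s0); rewrite /continuous_at/= subrr => /cvgrPdist_le/(_ _ e0).
apply: filterS => -[y s] /=; by rewrite sub0r normrN.
Qed.

Lemma periodic_uniform f (e : R) : C0_per f -> 0 < e ->
  exists2 d : R, 0 < d & forall x y, `|x - y| <= d -> `|f x - f y| <= e.
Proof.
move=> [cf pf] e0.
have H : \forall d \near 0^'+, forall x, forall y, `|x - y| <= d -> `|f x - f y| <= e.
  apply: (@near_uniform_periodic R (0^'+) _
    (fun d x => forall y, `|x - y| <= d -> `|f x - f y| <= e)).
    move=> d x k H y xy; rewrite -(pf k x) -(pf k y); apply: H.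
    by rewrite opprD addrACA subrr addr0.
  move=> x; have e2 : 0 < e / 2 by rewrite divr_gt0.
  have /cvgrPdist_le/(_ _ e2)/nbhs_ballP[/= r r0 Hr] := cf x.
  exists (ball x (r / 2), [set d | d < r / 2]) => /=.
    split; first by apply: nbhsx_ballx; rewrite divr_gt0.
    by apply: nbhs_right_lt; rewrite divr_gt0.
  move=> [x' d] /= [xx' dr] y x'y.
  have H1 : `|f x - f x'| <= e / 2.
    by apply: Hr; apply: le_ball xx'; rewrite ler_pdivrMr//; lra.
  have H2 : `|f x - f y| <= e / 2.
    apply: Hr; rewrite -ball_normE/=.
    have -> : x - y = (x - x') + (x' - y) by rewrite addrA subrK.
    apply: le_lt_trans (ler_normD _ _) _.
    move: xx'; rewrite -ball_normE/= => xx'.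
    by apply: (@lt_le_trans _ _ (r / 2 + r / 2)); [apply: ltrD => //; exact: le_lt_trans dr|lra].
  have -> : f x' - f y = (f x - f y) - (f x - f x') by lra.
  by apply: le_trans (ler_normB _ _) _; lra.
near (0 : R)^'+ => d; exists d; first by [].
by near: d.
Unshelve. all: by end_near. Qed.

Lemma is_derive_pair (c1 c2 : R -> R) (s d1 d2 : R) :
  is_derive s 1 c1 d1 -> is_derive s 1 c2 d2 ->
  is_derive s 1 (fun r => (c1 r, c2 r) : plane R) (d1, d2).
Proof.
move=> [D1 E1] [D2 E2].
have F1 : differentiable c1 s by apply/derivable1_diffP.
have F2 : differentiable c2 s by apply/derivable1_diffP.
have F : differentiable (fun r => (c1 r, c2 r) : plane R) s.
  exact: differentiable_pair.
split; first exact/derivable1_diffP.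
by rewrite deriveE// diff_pair//= -!deriveE// E1 E2.
Qed.

Lemma chain_rule f (c : R -> plane R) (s : R) (d : plane R) :
  differentiable f (c s) -> is_derive s 1 c d ->
  is_derive s 1 (fun r => f (c r)) (dot d (grad f (c s))).
Proof.
move=> df [Dc Ec].
have Fc : differentiable c s by apply/derivable1_diffP.
have F : differentiable (fun r => f (c r)) s by exact: differentiable_comp.
split; first exact/derivable1_diffP.
have {}Ec : 'd c s 1 = d by rewrite -deriveE.
rewrite deriveE// (_ : (fun r => f (c r)) = f \o c)// diff_comp//= Ec /dot /grad !deriveE//.
have E : d = d.1 *: ((1, 0) : plane R) + d.2 *: ((0, 1) : plane R).
  case: d {Ec} => d1 d2; transitivity (d1 * 1 + d2 * 0, d1 * 0 + d2 * 1) => //.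
  by rewrite !mulr1 !mulr0 addr0 add0r.
by rewrite {1}E linearD !linearZ.
Qed.

End Plane.

Arguments unit_square {R}.

(** * The flow of a periodic C^1 vector field *)
Section Lipschitz.
Variable R : realType.
Implicit Types (x y z : plane R) (k : int * int).

Lemma plane_norm x : `|x| = Num.max `|x.1| `|x.2|.
Proof. exact: prod_normE. Qed.

Lemma norm_fst x : `|x.1| <= `|x|.
Proof. by rewrite plane_norm le_max lexx. Qed.

Lemma norm_snd x : `|x.2| <= `|x|.
Proof. by rewrite plane_norm le_max lexx orbT. Qed.

Lemma norm_fstB x y : `|x.1 - y.1| <= `|x - y|.
Proof. exact: norm_fst (x - y). Qed.

Lemma norm_sndB x y : `|x.2 - y.2| <= `|x - y|.
Proof. exact: norm_snd (x - y). Qed.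

Lemma norm_plane_le x (e : R) : `|x.1| <= e -> `|x.2| <= e -> `|x| <= e.
Proof. by move=> h1 h2; rewrite plane_norm ge_max h1 h2. Qed.

Lemma derive_periodic (V : normedModType R) (f : plane R -> V) (v : plane R) :
  Defs.periodic f -> Defs.periodic (fun x => 'D_v f x).
Proof.
move=> pf k x; rewrite /derive.
set F := (X in X @ _); set G := (X in _ = lim (X @ _)).
suff -> : F = G by [].
by apply/funext => h; rewrite /F /G /= !addrA !pf.
Qed.

Lemma differentiable_fst (V : normedModType R) (f : V -> plane R) (x : V) :
  differentiable f x -> differentiable (fun y : V => (f y).1) x.
Proof.
move=> df; apply: (@differentiable_comp _ _ _ _ f fst) => //.
by apply: (linear_differentiable (f := (fst : {linear plane R -> R}))); exact: cts_fst.
Qed.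

Lemma differentiable_snd (V : normedModType R) (f : V -> plane R) (x : V) :
  differentiable f x -> differentiable (fun y : V => (f y).2) x.
Proof.
move=> df; apply: (@differentiable_comp _ _ _ _ f snd) => //.
by apply: (linear_differentiable (f := (snd : {linear plane R -> R}))); exact: cts_snd.
Qed.

Lemma derive_fst (V : normedModType R) (f : V -> plane R) (x v : V) :
  differentiable f x -> 'D_v (fun y : V => (f y).1) x = ('D_v f x).1.
Proof.
move=> df.
have d1 : differentiable (fst : plane R -> R) (f x).
  by apply: (linear_differentiable (f := (fst : {linear plane R -> R}))); exact: cts_fst.
rewrite !deriveE//; last exact: differentiable_fst.
rewrite (_ : (fun y : V => (f y).1) = fst \o f)// diff_comp//=.
by rewrite (diff_lin (f := (fst : {linear plane R -> R})))//; exact: cts_fst.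
Qed.

Lemma derive_snd (V : normedModType R) (f : V -> plane R) (x v : V) :
  differentiable f x -> 'D_v (fun y : V => (f y).2) x = ('D_v f x).2.
Proof.
move=> df.
have d1 : differentiable (snd : plane R -> R) (f x).
  by apply: (linear_differentiable (f := (snd : {linear plane R -> R}))); exact: cts_snd.
rewrite !deriveE//; last exact: differentiable_snd.
rewrite (_ : (fun y : V => (f y).2) = snd \o f)// diff_comp//=.
by rewrite (diff_lin (f := (snd : {linear plane R -> R})))//; exact: cts_snd.
Qed.

Lemma is_derive_fst (c : R -> plane R) (s : R) d :
  is_derive s 1 c d -> is_derive s 1 (fun r => (c r).1) d.1.
Proof.
move=> [Dc <-]; have F : differentiable c s by apply/derivable1_diffP.
split; first by apply/derivable1_diffP; exact: differentiable_fst.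
exact: derive_fst.
Qed.

Lemma is_derive_snd (c : R -> plane R) (s : R) d :
  is_derive s 1 c d -> is_derive s 1 (fun r => (c r).2) d.2.
Proof.
move=> [Dc <-]; have F : differentiable c s by apply/derivable1_diffP.
split; first by apply/derivable1_diffP; exact: differentiable_snd.
exact: derive_snd.
Qed.

Lemma C1_per_fst (f : plane R -> plane R) : C1_per f -> C1_per (fun x => (f x).1).
Proof.
move=> [[df cf] pf]; split; last by move=> k x /=; rewrite pf.
split=> [x|v]; first exact: differentiable_fst.
under [X in continuous X]eq_fun do rewrite derive_fst//.
apply: cts_compT (@cts_fst R) _; exact: cf.
Qed.

Lemma C1_per_snd (f : plane R -> plane R) : C1_per f -> C1_per (fun x => (f x).2).
Proof.
move=> [[df cf] pf]; split; last by move=> k x /=; rewrite pf.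
split=> [x|v]; first exact: differentiable_snd.
under [X in continuous X]eq_fun do rewrite derive_snd//.
apply: cts_compT (@cts_snd R) _; exact: cf.
Qed.

Lemma C1_continuous (V : normedModType R) (f : plane R -> V) : C1 f -> continuous f.
Proof. by move=> [df _] x; apply: differentiable_continuous. Qed.

Lemma C1_per_C0_per (V : normedModType R) (f : plane R -> V) : C1_per f -> C0_per f.
Proof. by move=> [/C1_continuous cf pf]. Qed.

Lemma line_chain_rule (f : plane R -> R) x v (s : R) :
  (forall y, differentiable f y) ->
  is_derive s 1 (fun r => f (x.1 + r * v.1, x.2 + r * v.2))
    (dot v (grad f (x.1 + s * v.1, x.2 + s * v.2))).
Proof.
move=> df.
have := @chain_rule R f (fun r => (x.1 + r * v.1, x.2 + r * v.2)) s v (df _).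
by case: v => v1 v2 /= H; apply: H; apply: is_derive_pair; exact: deriveR_affine.
Qed.

Lemma C1_per_lipschitz_real (f : plane R -> R) : C1_per f ->
  exists2 K : R, 0 < K & forall x y, `|f x - f y| <= K * `|x - y|.
Proof.
move=> [[df cf] pf].
have [M1 M1p H1] := periodic_bounded (conj (cf (1, 0)) (derive_periodic (1, 0) pf)).
have [M2 M2p H2] := periodic_bounded (conj (cf (0, 1)) (derive_periodic (0, 1) pf)).
exists (M1 + M2) => [|x y]; first exact: addr_gt0.
have := @derive_bound R _ _ ((M1 + M2) * `|x - y|) 0 1 ler01
  (fun s => @line_chain_rule f y (x - y) s df).
rewrite !mul0r !mul1r !addr0 subr0 mulr1.
have -> : (y.1 + (x - y).1, y.2 + (x - y).2) = x.
  by case: x y => [x1 x2] [y1 y2] /=; rewrite !(addrC y1, addrC y2) !subrK.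
rewrite -surjective_pairing; apply=> s _; rewrite /dot [X in _ <= X]mulrDl.
apply: le_trans (ler_normD _ _) _; rewrite !normrM.
apply: lerD; rewrite mulrC; apply: ler_pM => //.
- exact: H1.
- exact: norm_fst.
- exact: H2.
- exact: norm_snd.
Qed.

Lemma C1_per_lipschitz (f : plane R -> plane R) : C1_per f ->
  exists2 K : R, 0 < K & forall x y, `|f x - f y| <= K * `|x - y|.
Proof.
move=> hf.
have [K1 K1p H1] := C1_per_lipschitz_real (C1_per_fst hf).
have [K2 K2p H2] := C1_per_lipschitz_real (C1_per_snd hf).
exists (K1 + K2) => [|x y]; first exact: addr_gt0.
apply: norm_plane_le; [apply: le_trans (H1 x y) _|apply: le_trans (H2 x y) _];
  by rewrite ler_wpM2r// ?lerDl ?lerDr ltW.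
Qed.

Lemma C0_per_bounded_plane (f : plane R -> plane R) : C0_per f ->
  exists2 B : R, 0 < B & forall x, `|f x| <= B.
Proof.
move=> [cf pf].
have [M1 M1p H1] := @periodic_bounded R (fun x => (f x).1)
  (conj (cts_compT (@cts_fst R) cf) (fun k x => congr1 fst (pf k x))).
have [M2 M2p H2] := @periodic_bounded R (fun x => (f x).2)
  (conj (cts_compT (@cts_snd R) cf) (fun k x => congr1 snd (pf k x))).
exists (M1 + M2) => [|x]; first exact: addr_gt0.
apply: norm_plane_le; [apply: le_trans (H1 x) _|apply: le_trans (H2 x) _];
  by rewrite ?lerDl ?lerDr ltW.
Qed.

End Lipschitz.

(** * Exponential growth estimates and geometric limits *)

Section Growth.
Variable R : realType.
Implicit Types (f g : R -> R) (s t : R).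

Lemma is_derive_expRM (a s : R) : is_derive s 1 (fun r => expR (a * r)) (expR (a * s) * a).
Proof.
apply: deriveR_comp; rewrite -[X in is_derive _ _ _ X]mulr1.
by apply: deriveR_scale; exact: deriveR_id.
Qed.

(** The weight [exp (2 K |t|)] is that of a Bielecki norm: integrating it gains [1 / (2 K)], so a
    factor [K] from the Lipschitz bound leaves 1/2. Picard iteration therefore contracts on the
    whole time line at once. *)
Lemma expR_growth f (f' : R -> R) (K C : R) : 0 < K -> 0 <= C -> f 0 = 0 ->
  (forall s : R, is_derive s 1 f (f' s)) ->
  (forall s, `|f' s| <= K * C * expR (2 * K * `|s|)) ->
  forall t, `|f t| <= C / 2 * expR (2 * K * `|t|).
Proof.
move=> K0 C0.
have pos g (g' : R -> R) t : 0 <= t -> g 0 = 0 -> (forall s : R, is_derive s 1 g (g' s)) ->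
    (forall s, `|g' s| <= K * C * expR (2 * K * `|s|)) ->
    `|g t| <= C / 2 * expR (2 * K * `|t|).
  move=> t0 g0 dg gb.
  have dG s : is_derive s 1 (fun s => C / 2 * expR (2 * K * s)) (C / 2 * (expR (2 * K * s) * (2 * K))).
    by apply: deriveR_scale; exact: is_derive_expRM.
  have := derive_le_norm t0 dg dG.
  rewrite g0 subr0 mulr0 expR0 mulr1 (ger0_norm t0) => H.
  apply: le_trans (H _) _; last by rewrite gerBl divr_ge0.
  move=> s /andP[s0 _]; apply: le_trans (gb s) _.
  by rewrite (ger0_norm s0) /GRing.scale/= le_eqVlt; apply/orP; left; apply/eqP; field.
move=> f0 df fb t; have [t0|/ltW t0] := leP 0 t; first exact: pos.
have := pos (fun r => f (- r)) (fun r => - f' (- r)) (- t).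
rewrite oppr_ge0 oppr0 opprK normrN; apply=> // [s|s].
  by apply: is_derive_opp_arg.
by rewrite normrN -(normrN s).
Qed.

(** The maximum [m] of absolute values is not differentiable, so the argument runs on the sum of
    squares [e], with [m^2 <= e <= 2 m^2] and [e' <= 4 K e]. The loss in this comparison is absorbed
    by the factor 2 in front. *)
Lemma gronwall (f1 f2 g1 g2 : R -> R) (K : R) : 0 < K ->
  (forall s : R, is_derive s 1 f1 (g1 s)) -> (forall s : R, is_derive s 1 f2 (g2 s)) ->
  (forall s, `|g1 s| <= K * Num.max `|f1 s| `|f2 s|) ->
  (forall s, `|g2 s| <= K * Num.max `|f1 s| `|f2 s|) ->
  forall t, Num.max `|f1 t| `|f2 t| <= 2 * expR (2 * K * `|t|) * Num.max `|f1 0| `|f2 0|.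
Proof.
move=> K0.
have pos (h1 h2 k1 k2 : R -> R) t : 0 <= t ->
    (forall s : R, is_derive s 1 h1 (k1 s)) -> (forall s : R, is_derive s 1 h2 (k2 s)) ->
    (forall s, `|k1 s| <= K * Num.max `|h1 s| `|h2 s|) ->
    (forall s, `|k2 s| <= K * Num.max `|h1 s| `|h2 s|) ->
    Num.max `|h1 t| `|h2 t| <= 2 * expR (2 * K * `|t|) * Num.max `|h1 0| `|h2 0|.
  move=> t0 d1 d2 b1 b2.
  pose m s := Num.max `|h1 s| `|h2 s|.
  have m0 s : 0 <= m s by rewrite le_max normr_ge0.
  have m1 s : `|h1 s| <= m s by rewrite le_max lexx.
  have m2 s : `|h2 s| <= m s by rewrite le_max lexx orbT.
  pose e s := (h1 s) ^+ 2 + (h2 s) ^+ 2.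
  have me s : m s ^+ 2 <= e s.
    rewrite /m /e -(real_normK (num_real (h1 s))) -(real_normK (num_real (h2 s))).
    by rewrite /Num.max; case: ifPn => _; rewrite ?lerDl ?lerDr sqr_ge0.
  have em s : e s <= 2 * m s ^+ 2.
    rewrite /e -(real_normK (num_real (h1 s))) -(real_normK (num_real (h2 s))) mulr_natl mulr2n.
    by apply: lerD; rewrite ler_sqr ?nnegrE.
  pose e' s := 2 * (h1 s * k1 s + h2 s * k2 s).
  have de s : is_derive s 1 e (e' s).
    by rewrite /e' mulrDr; apply: deriveR_add; apply: deriveR_sqr.
  have e'b s : e' s <= 4 * K * e s.
    apply: le_trans (ler_norm _) _; rewrite /e' normrM ger0_norm//.
    have : `|h1 s * k1 s + h2 s * k2 s| <= 2 * (K * m s ^+ 2).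
      apply: le_trans (ler_normD _ _) _; rewrite !normrM.
      have P (a c : R) : 0 <= a -> 0 <= c -> a <= m s -> c <= K * m s -> a * c <= K * m s ^+ 2.
        move=> a0 c0 am cm; rewrite expr2 mulrCA; exact: ler_pM.
      have := P `|h1 s| `|k1 s| (normr_ge0 _) (normr_ge0 _) (m1 s) (b1 s).
      have := P `|h2 s| `|k2 s| (normr_ge0 _) (normr_ge0 _) (m2 s) (b2 s).
      lra.
    have := me s; have := K0; nra.
  have dE s : is_derive s 1 (fun s => - (expR (- (4 * K) * s) * e s))
      (- (expR (- (4 * K) * s) * - (4 * K) * e s + expR (- (4 * K) * s) * e' s)).
    by apply: deriveR_opp; apply: deriveR_mul => //; exact: is_derive_expRM.
  have := is_derive_nondecreasing t0 dE.
  rewrite mulr0 expR0 mul1r lerN2 => H.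
  have {H} : expR (- (4 * K) * t) * e t <= e 0.
    apply: H => s _; rewrite oppr_ge0.
    have -> : expR (- (4 * K) * s) * - (4 * K) * e s + expR (- (4 * K) * s) * e' s =
      expR (- (4 * K) * s) * (e' s - 4 * K * e s) by ring.
    by apply: mulr_ge0_le0; [exact: expR_ge0|rewrite subr_le0].
  rewrite mulNr expRN mulrC ler_pdivrMr ?expR_gt0// => et.
  rewrite -/(m t) -/(m 0) (ger0_norm t0) -ler_sqr ?nnegrE ?mulr_ge0 ?expR_ge0//.
  have -> : (2 * expR (2 * K * t) * m 0) ^+ 2 = 4 * (expR (4 * K * t) * m 0 ^+ 2).
    have -> : 4 * K * t = 2 * K * t + 2 * K * t by ring.
    by rewrite expRD; ring.
  apply: le_trans (me t) _; apply: le_trans et _.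
  rewrite mulrC mulrCA ler_pM2l ?expR_gt0//.
  by have := em 0; have := sqr_ge0 (m 0); lra.
move=> d1 d2 b1 b2 t; have [t0|/ltW t0] := leP 0 t; first exact: (pos f1 f2 g1 g2).
have := pos (fun r => f1 (- r)) (fun r => f2 (- r)) (fun r => - g1 (- r)) (fun r => - g2 (- r)) (- t).
rewrite oppr_ge0 oppr0 opprK (normrN t); apply=> // s; rewrite ?normrN//.
  exact: is_derive_opp_arg.
exact: is_derive_opp_arg.
Qed.

(** The sequences [u n - 2 A 2^-n] and [u n + 2 A 2^-n] are monotone in opposite directions and
    every term of the first lies below every term of the second; the supremum of the first is the
    limit. *)
Lemma geometric_limit (u : nat -> R) (A : R) : 0 <= A ->
  (forall n, `|u n.+1 - u n| <= A * 2^-1 ^+ n) ->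
  exists l, forall n, `|u n - l| <= 2 * A * 2^-1 ^+ n.
Proof.
move=> A0 uA.
pose v n := u n - 2 * A * 2^-1 ^+ n; pose w n := u n + 2 * A * 2^-1 ^+ n.
have vS n : v n <= v n.+1.
  rewrite /v exprS; have := uA n; rewrite ler_norml => /andP[+ _].
  by set q := 2^-1 ^+ n; lra.
have wS n : w n.+1 <= w n.
  rewrite /w exprS; have := uA n; rewrite ler_norml => /andP[_].
  by set q := 2^-1 ^+ n; lra.
have vw n : v n <= w n.
  by rewrite /v /w lerD2l ge0_cp// !mulr_ge0// exprn_ge0.
have vm n m : v n <= v (n + m)%N.
  by elim: m => [|m IH]; rewrite ?addn0// addnS; apply: le_trans IH _.
have wm n m : w (n + m)%N <= w n.
  by elim: m => [|m IH]; rewrite ?addn0// addnS; apply: le_trans IH.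
have vwnm n m : v n <= w m.
  apply: le_trans (vm n m) _; apply: le_trans (vw _) _.
  by rewrite addnC; exact: wm.
have hs : has_sup (range v).
  by split; [exists (v 0%N), 0%N|exists (w 0%N) => _ [n _ <-]].
exists (sup (range v)) => n; rewrite ler_distlC.
apply/andP; split.
  by have := sup_upper_bound hs (ex_intro2 _ _ n I erefl); exact.
by apply: ge_sup; [case: hs|move=> _ [m _ <-]; exact: vwnm].
Qed.

Lemma le_of_le_geometric (a c d : R) :
  (forall n, a <= c + d * 2^-1 ^+ n) -> a <= c.
Proof.
move=> H; rewrite leNgt; apply/negP => ca.
have e0 : 0 < (a - c) / 2 by rewrite divr_gt0 ?subr_gt0.
have : (fun n => d * 2^-1 ^+ n : R) @ \oo --> d * 0.
  apply: cvgM; first exact: cvg_cst.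
  by apply: cvg_expr; rewrite ger0_norm// invf_lt1// ltr1n.
rewrite mulr0 => /cvgrPdist_lt/(_ _ e0)[N _ /(_ N (leqnn N))].
rewrite sub0r normrN ltr_norml => /andP[_ h]; have := H N; lra.
Qed.

End Growth.

Section PlaneCurves.
Variable R : realType.

Lemma cts_plane (T : topologicalType) (f : T -> plane R) :
  continuous (fun t : T => (f t).1) -> continuous (fun t : T => (f t).2) -> continuous f.
Proof.
move=> c1 c2; have := cts_pair c1 c2.
by under [X in continuous X]eq_fun do rewrite -surjective_pairing.
Qed.

Lemma is_derive_plane (c : R -> plane R) (t : R) (d : plane R) :
  is_derive t 1 (fun r => (c r).1) d.1 -> is_derive t 1 (fun r => (c r).2) d.2 ->
  is_derive t 1 c d.
Proof.
move=> d1 d2; have := is_derive_pair d1 d2.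
rewrite -surjective_pairing.
by rewrite (_ : (fun r => _) = c)//; apply/funext => r; rewrite -surjective_pairing.
Qed.

Lemma half_exprn_le n : 2^-1 ^+ n.+1 <= 2^-1 ^+ n :> R.
Proof. by rewrite exprS ler_piMl ?exprn_ge0// invf_le1// ler1n. Qed.

End PlaneCurves.

(** * Picard iteration and the properties of the flow *)

Section Picard.
Variables (R : realType) (b : plane R -> plane R) (K B : R).
Hypothesis K0 : 0 < K.
Hypothesis b_lip : forall x y, `|b x - b y| <= K * `|x - y|.
Hypothesis B0 : 0 < B.
Hypothesis b_bnd : forall x, `|b x| <= B.
Implicit Types (x y z : plane R) (s t : R) (c : R -> plane R).

Lemma lipschitz_continuous (V : normedModType R) (f : plane R -> V) (L : R) : 0 < L ->
  (forall x y, `|f x - f y| <= L * `|x - y|) -> continuous f.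
Proof.
move=> L0 fL x; apply/cvgrPdist_le => e e0.
near=> y; apply: le_trans (fL x y) _.
rewrite mulrC -ler_pdivlMr//; near: y.
apply: cvgr_dist_le; [exact: cvg_id|exact: divr_gt0].
Unshelve. all: by end_near. Qed.

Lemma b_continuous : continuous b.
Proof. exact: lipschitz_continuous b_lip. Qed.

(** A total choice of primitive vanishing at 0; the default is returned only when there is none,
    which continuity excludes. *)
Definition antiderivative (f : R -> R) : R -> R :=
  xget (fun=> 0) [set F | F 0 = 0 /\ forall t, is_derive t 1 F (f t)].

Lemma antiderivativeP (f : R -> R) : continuous f ->
  antiderivative f 0 = 0 /\ forall t, is_derive t 1 (antiderivative f) (f t).
Proof.
move=> cf; rewrite /antiderivative; case: xgetP => [//|].
by have [F F0 dF] := primitive cf => /(_ F)[].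
Qed.

Definition picard_step x c : R -> plane R := fun t =>
  (x.1 + antiderivative (fun s => (b (c s)).1) t,
   x.2 + antiderivative (fun s => (b (c s)).2) t).

Lemma picard_stepP x c : continuous c ->
  [/\ picard_step x c 0 = x,
      forall t, is_derive t 1 (fun r => (picard_step x c r).1) (b (c t)).1 &
      forall t, is_derive t 1 (fun r => (picard_step x c r).2) (b (c t)).2].
Proof.
move=> cc.
have cb := cts_compT b_continuous cc.
have [p10 p1] := antiderivativeP (cts_compT (@cts_fst R) cb).
have [p20 p2] := antiderivativeP (cts_compT (@cts_snd R) cb).
rewrite /picard_step; split=> [|t|t] /=.
- by rewrite p10 p20 !addr0 -surjective_pairing.
- by apply: deriveR_eq (deriveR_add (deriveR_cst x.1 t) (p1 t)) _; rewrite add0r.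
- by apply: deriveR_eq (deriveR_add (deriveR_cst x.2 t) (p2 t)) _; rewrite add0r.
Qed.

Lemma picard_step_cts x c : continuous c -> continuous (picard_step x c).
Proof.
move=> /(picard_stepP x)[_ d1 d2].
by apply: cts_plane; [exact: is_derive_continuous d1|exact: is_derive_continuous d2].
Qed.

Lemma picard_step_contract x (c d : R -> plane R) (P t : R) : continuous c -> continuous d -> 0 <= P ->
  (forall s, `|c s - d s| <= P * expR (2 * K * `|s|)) ->
  `|picard_step x c t - picard_step x d t| <= P / 2 * expR (2 * K * `|t|).
Proof.
move=> cc cd P0 cdP.
have [p0 p1 p2] := picard_stepP x cc; have [q0 q1 q2] := picard_stepP x cd.
have bound s : `|b (c s) - b (d s)| <= K * P * expR (2 * K * `|s|).
  by apply: le_trans (b_lip _ _) _; rewrite -mulrA ler_pM2l.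
apply: norm_plane_le.
  apply: (expR_growth K0 P0 _ (fun s => deriveR_sub (p1 s) (q1 s))).
    by rewrite p0 q0 subrr.
  by move=> s; apply: le_trans (bound s); exact: norm_fstB.
apply: (expR_growth K0 P0 _ (fun s => deriveR_sub (p2 s) (q2 s))).
  by rewrite p0 q0 subrr.
by move=> s; apply: le_trans (bound s); exact: norm_sndB.
Qed.

Fixpoint picard x n : R -> plane R :=
  if n is m.+1 then picard_step x (picard x m) else fun=> x.

Lemma picard_cts x n : continuous (picard x n).
Proof.
elim: n => [|n IH] /=; first by move=> t; exact: cvg_cst.
exact: picard_step_cts.
Qed.

(** The first Picard step moves by at most [B |t|], and [K |t| <= exp (2 K |t|)]; this constant
    turns the bound into a multiple of the weight. *)
Let C := B / K.

Let C0 : 0 <= C. Proof. by rewrite divr_ge0 ?ltW. Qed.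

Lemma picard_diff x n t :
  `|picard x n.+1 t - picard x n t| <= C * 2^-1 ^+ n * expR (2 * K * `|t|).
Proof.
elim: n t => [|n IH] t.
  have [p0 d1 d2] := picard_stepP x (picard_cts (x := x) (n := 0)).
  rewrite expr0 mulr1.
  have E : B * `|t| <= C * expR (2 * K * `|t|).
    have -> : B = C * K by rewrite /C divfK// gt_eqF.
    rewrite -mulrA; apply: ler_wpM2l C0 _ _ _.
    have := expR_ge1Dx (2 * K * `|t|); have := mulr_ge0 (ltW K0) (normr_ge0 t).
    by rewrite -(mulrA 2 K); lra.
  apply: norm_plane_le; apply: le_trans E.
    have := @derive_bound_norm R _ _ B 0 t d1 _; rewrite p0 subr0; apply=> s.
    exact: le_trans (norm_fst _) (b_bnd _).
  have := @derive_bound_norm R _ _ B 0 t d2 _; rewrite p0 subr0; apply=> s.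
  exact: le_trans (norm_snd _) (b_bnd _).
have -> : C * 2^-1 ^+ n.+1 = C * 2^-1 ^+ n / 2 by rewrite exprS mulrCA mulrC.
apply: picard_step_contract (IH); try exact: picard_cts.
by rewrite mulr_ge0// exprn_ge0.
Qed.

Lemma picard_limit x : exists c, forall n t,
  `|picard x n t - c t| <= 2 * (C * expR (2 * K * `|t|)) * 2^-1 ^+ n.
Proof.
have H1 t : exists l, forall n, `|(picard x n t).1 - l| <= 2 * (C * expR (2 * K * `|t|)) * 2^-1 ^+ n.
  apply: geometric_limit => [|n]; first by rewrite mulr_ge0 ?expR_ge0.
  rewrite -mulrA (mulrC (expR _)) mulrA.
  exact: le_trans (norm_fst (picard x n.+1 t - picard x n t)) (picard_diff x n t).
have H2 t : exists l, forall n, `|(picard x n t).2 - l| <= 2 * (C * expR (2 * K * `|t|)) * 2^-1 ^+ n.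
  apply: geometric_limit => [|n]; first by rewrite mulr_ge0 ?expR_ge0.
  rewrite -mulrA (mulrC (expR _)) mulrA.
  exact: le_trans (norm_snd (picard x n.+1 t - picard x n t)) (picard_diff x n t).
have [c1 Hc1] := choice H1; have [c2 Hc2] := choice H2.
exists (fun t => (c1 t, c2 t)) => n t.
by apply: norm_plane_le; [exact: Hc1|exact: Hc2].
Qed.

(** The limit curve inherits the Lipschitz bound [B], so it is continuous and one more Picard step
    can be applied to it. By contraction that step fixes it, whence the equation. *)
Lemma integral_curve x : exists c, c 0 = x /\ forall t, is_derive t 1 c (b (c t)).
Proof.
have [c Hc] := picard_limit x.
have h m r : `|picard x m.+1 r - c r| <= 2 * (C * expR (2 * K * `|r|)) * 2^-1 ^+ m.
  apply: le_trans (Hc m.+1 r) _; apply: ler_wpM2l (half_exprn_le _ _).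
  by apply: mulr_ge0 => //; apply: mulr_ge0 C0 (expR_ge0 _).
have clip s t : `|c s - c t| <= B * `|s - t|.
  apply: (@le_of_le_geometric R _ _ (2 * (C * expR (2 * K * `|s|)) + 2 * (C * expR (2 * K * `|t|)))) => n.
  have [p0 d1 d2] := picard_stepP x (picard_cts (x := x) (n := n)).
  have plip : `|picard x n.+1 s - picard x n.+1 t| <= B * `|s - t|.
    apply: norm_plane_le.
      apply: (derive_bound_norm t s d1) => r; exact: le_trans (norm_fst _) (b_bnd _).
    apply: (derive_bound_norm t s d2) => r; exact: le_trans (norm_snd _) (b_bnd _).
  have -> : c s - c t = (picard x n.+1 s - picard x n.+1 t) +
      ((picard x n.+1 t - c t) - (picard x n.+1 s - c s)).
    by rewrite opprB addrA addrCA; apply/esym; rewrite -addrA; do ?[rewrite addrA]; ring.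
  apply: le_trans (ler_normD _ _) _; apply: lerD => //.
  apply: le_trans (ler_normB _ _) _; rewrite addrC mulrDl; apply: lerD; exact: h.
have cc : continuous c.
  move=> t; apply/cvgrPdist_le => e e0.
  near=> s; apply: le_trans (clip _ _) _.
  rewrite mulrC -ler_pdivlMr//; near: s.
  by apply: cvgr_dist_le; [exact: cvg_id|exact: divr_gt0].
have [z0 e1 e2] := picard_stepP x cc.
have cz t : picard_step x c t = c t.
  apply/eqP; rewrite -subr_eq0 -normr_le0.
  apply: (@le_of_le_geometric R _ _ (3 * (C * expR (2 * K * `|t|)))) => n; rewrite add0r.
  have D : `|picard_step x c t - picard x n.+1 t| <= 2 * (C * 2^-1 ^+ n) / 2 * expR (2 * K * `|t|).
    apply: picard_step_contract; [exact: cc|exact: picard_cts| |move=> s].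
      by rewrite mulr_ge0//; apply: mulr_ge0 C0 (exprn_ge0 _ _).
    by rewrite distrC; apply: le_trans (Hc n s) _; rewrite le_eqVlt; apply/orP; left; apply/eqP; ring.
  have -> : picard_step x c t - c t = (picard_step x c t - picard x n.+1 t) + (picard x n.+1 t - c t).
    by rewrite addrA subrK.
  apply: le_trans (ler_normD _ _) _; apply: le_trans (lerD D (h n t)) _.
  by rewrite le_eqVlt; apply/orP; left; apply/eqP; field.
exists c; split; first by rewrite -cz.
move=> t; apply: is_derive_plane.
  by under eq_fun do rewrite -cz; exact: e1.
by under eq_fun do rewrite -cz; exact: e2.
Unshelve. all: by end_near. Qed.

Lemma flow_exists : exists X, is_flow b X.
Proof.
have [X HX] := choice integral_curve.
by exists (fun t x => X x t) => x; have [-> dX] := HX x.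
Qed.

Lemma curve_dist c d : (forall t, is_derive t 1 c (b (c t))) ->
  (forall t, is_derive t 1 d (b (d t))) ->
  forall t, `|c t - d t| <= 2 * expR (2 * K * `|t|) * `|c 0 - d 0|.
Proof.
move=> dc dd t.
have H s := b_lip (c s) (d s).
have := @gronwall R (fun s => (c s).1 - (d s).1) (fun s => (c s).2 - (d s).2) _ _ K K0
  (fun s => deriveR_sub (is_derive_fst (dc s)) (is_derive_fst (dd s)))
  (fun s => deriveR_sub (is_derive_snd (dc s)) (is_derive_snd (dd s))) _ _ t.
rewrite !plane_norm; apply=> s; rewrite -(plane_norm (c s - d s)).
  exact: le_trans (norm_fst _) (H s).
exact: le_trans (norm_snd _) (H s).
Qed.

Section Flow.
Variable X : R -> plane R -> plane R.
Hypothesis hX : is_flow b X.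
Hypothesis b_per : Defs.periodic b.

Lemma flow0 x : X 0 x = x. Proof. by have [] := hX x. Qed.

Lemma is_derive_flow x t : is_derive t 1 (fun r => X r x) (b (X t x)).
Proof. by have [_] := hX x; exact. Qed.

Lemma flow_unique c : (forall t, is_derive t 1 c (b (c t))) ->
  forall t, c t = X t (c 0).
Proof.
move=> dc t; apply/eqP; rewrite -subr_eq0 -normr_le0.
apply: le_trans (curve_dist dc (is_derive_flow (c 0)) t) _.
by rewrite flow0 subrr normr0 mulr0.
Qed.

Lemma flow_add s t x : X (s + t) x = X s (X t x).
Proof.
have H (r : R) : is_derive r 1 (fun s => X (s + t) x) (b (X (r + t) x)).
  apply: is_derive_plane.
    exact: (is_derive_shift_arg (f' := fun r => (b (X r x)).1) (is_derive_fst (is_derive_flow x (r + t)))).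
  exact: (is_derive_shift_arg (f' := fun r => (b (X r x)).2) (is_derive_snd (is_derive_flow x (r + t)))).
by rewrite (flow_unique H s) add0r.
Qed.

Lemma flowK t x : X (- t) (X t x) = x.
Proof. by rewrite -flow_add addNr flow0. Qed.

Lemma flow_periodic t k x : X t (x + zvec R k) = X t x + zvec R k.
Proof.
have H (r : R) : is_derive r 1 (fun s => X s x + zvec R k) (b (X r x + zvec R k)).
  rewrite b_per; have [d1 d2] := (is_derive_fst (is_derive_flow x r), is_derive_snd (is_derive_flow x r)).
  apply: is_derive_plane => /=.
    by apply: deriveR_eq (deriveR_add d1 (deriveR_cst (zvec R k).1 r)) _; rewrite addr0.
  by apply: deriveR_eq (deriveR_add d2 (deriveR_cst (zvec R k).2 r)) _; rewrite addr0.
by have := flow_unique H t; rewrite flow0.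
Qed.

Lemma flow_fixed x : b x = 0 -> forall t, X t x = x.
Proof.
move=> bx0 t; apply/esym.
have H (r : R) : is_derive r 1 (fun _ : R => x) (b x) by rewrite bx0; exact: is_derive_cst.
exact: (flow_unique H t).
Qed.

Lemma flow_root t x : b (X t x) = 0 -> b x = 0.
Proof. by move=> H; have := flow_fixed H (- t); rewrite flowK => E; rewrite {1}E. Qed.

Lemma flow_time_lip s t x : `|X s x - X t x| <= B * `|s - t|.
Proof.
apply: norm_plane_le.
  apply: (derive_bound_norm t s (fun r => is_derive_fst (is_derive_flow x r))) => r.
  exact: le_trans (norm_fst _) (b_bnd _).
apply: (derive_bound_norm t s (fun r => is_derive_snd (is_derive_flow x r))) => r.
exact: le_trans (norm_snd _) (b_bnd _).
Qed.

Lemma flow_space_lip t x y : `|X t x - X t y| <= 2 * expR (2 * K * `|t|) * `|x - y|.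
Proof.
by have := curve_dist (is_derive_flow x) (is_derive_flow y) t; rewrite !flow0.
Qed.

Lemma flow_continuous : continuous (fun p : R * plane R => X p.1 p.2).
Proof.
move=> [t x] /=; apply/cvgrPdist_le => e e0.
have E0 : 0 < 2 * expR (2 * K * `|t|) by rewrite mulr_gt0 ?expR_gt0.
near=> p.
have -> : X t x - X p.1 p.2 = (X t x - X t p.2) + (X t p.2 - X p.1 p.2).
  by rewrite addrA subrK.
apply: le_trans (ler_normD _ _) _; rewrite (splitr e); apply: lerD.
  apply: le_trans (flow_space_lip _ _ _) _.
  rewrite mulrC -ler_pdivlMr//; near: p.
  apply: (@cvgr_dist_le _ _ _ _ _ (fun p : R * plane R => p.2) x); first exact: cvg_snd.
  by rewrite !divr_gt0.
apply: le_trans (flow_time_lip _ _ _) _.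
rewrite mulrC -ler_pdivlMr//; near: p.
apply: (@cvgr_dist_le _ _ _ _ _ (fun p : R * plane R => p.1) t); first exact: cvg_fst.
by rewrite !divr_gt0.
Unshelve. all: by end_near. Qed.

Lemma flow_cts_space t : continuous (X t).
Proof.
apply: (@lipschitz_continuous _ _ (2 * expR (2 * K * `|t|))).
  by rewrite mulr_gt0 ?expR_gt0.
exact: flow_space_lip.
Qed.

Lemma flow_cts_time x : continuous (fun t => X t x).
Proof.
apply: (cts_compT (f := fun t : R => (t, x)) flow_continuous).
by apply: cts_pair => t; [exact: cvg_id|exact: cvg_cst].
Qed.

End Flow.
End Picard.

(** * Periodic mollifiers *)
Section Kernel.
Variable R : realType.
Implicit Types (s t e : R) (k : int).

Definition int_periodic (h : R -> R) := forall t k, h (t + k%:~R) = h t.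

(* [d] is a smooth approximation at scale [e] of the periodic Dirac comb,
   with derivative [d'] and primitive [D]. *)
Definition mollifier (e : R) (D d d' : R -> R) : Prop :=
  [/\ forall t : R, is_derive t 1 D (d t),
      forall t : R, is_derive t 1 d (d' t) /\ 0 <= d t <= 16 / e,
      continuous d',
      forall t k, [/\ D (t + k%:~R) = D t + k%:~R, d (t + k%:~R) = d t
                    & d' (t + k%:~R) = d' t] &
      forall t, e <= pdist t -> d t = 0].

Lemma is_derive_max0_sqr t :
  is_derive t 1 (fun r => Num.max 0 r ^+ 2) (2 * Num.max 0 t).
Proof.
have [t0|t0|<-] := ltgtP 0 t.
- apply: (@near_eq_is_derive _ _ _ (fun r : R => r ^+ 2)).
    near=> r; rewrite max_r//; apply: ltW; near: r; exact: lt_nbhsr.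
  by rewrite -[X in 2 * X]mulr1; apply: deriveR_sqr; exact: deriveR_id.
- apply: (@near_eq_is_derive _ _ _ (fun r : R => 0)).
    near=> r; rewrite max_l ?expr0n//; apply: ltW; near: r; exact: lt_nbhsl.
  by rewrite mulr0; exact: deriveR_cst.
- rewrite mulr0; apply/is_derive1_caratheodory; exists (fun r => Num.max 0 r); split.
  + move=> r; rewrite subr0 maxxx expr0n subr0 expr2.
    by have [_|r0] := leP 0 r => //; rewrite !mul0r.
  + by apply: (@cts_max _ _ (fun=> 0) id); [exact: cts_cst|move=> x; exact: cvg_id].
  + exact: maxxx.
Unshelve. all: by end_near. Qed.

Lemma sqr_sin_pi_periodic t k : sin (pi * (t + k%:~R)) ^+ 2 = sin (pi * t) ^+ 2.
Proof.
have := pdistDz t k; rewrite /pdist => E.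
by rewrite -(real_normK (num_real (sin _))) E real_normK// num_real.
Qed.

(** The profile is the square of the positive part of [e^2 - sin^2 (pi t)]; squaring makes the
    positive part continuously differentiable. It is at most [e^4], and at least [e^4 / 2] for
    [0 <= t <= e / 8], where [|sin (pi t)| <= e / 2]. Its integral over a period is thus at least
    [e^5 / 16], hence the bound [16 / e] after normalisation. *)
Lemma mollifier_exists e : 0 < e -> e <= 1 -> exists D d d', mollifier e D d d'.
Proof.
move=> e0 e1.
pose q t := e ^+ 2 - sin (pi * t) ^+ 2.
pose f t := Num.max 0 (q t) ^+ 2.
pose f' t := 2 * Num.max 0 (q t) * (- (2 * (sin (pi * t) * (cos (pi * t) * pi)))).
have df t : is_derive t 1 f (f' t).
  apply: (deriveR_comp (is_derive_max0_sqr _)).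
  apply: deriveR_eq (deriveR_sub (deriveR_cst (e ^+ 2) t) (deriveR_sqr (deriveR_comp (is_derive_sin _)
    (deriveR_scale pi (deriveR_id t))))) _.
  by rewrite mulr1 sub0r.
have cq : continuous q.
  apply: ctsB; first exact: cts_cst.
  have cs : continuous (fun t : R => sin (pi * t)).
    apply: cts_comp; first exact: continuous_sin.
    by apply: ctsM; [exact: cts_cst|move=> t; exact: cvg_id].
  exact: ctsM.
have qper t k : q (t + k%:~R) = q t by rewrite /q sqr_sin_pi_periodic.
have fper t k : f (t + k%:~R) = f t by rewrite /f qper.
have f'per t k : f' (t + k%:~R) = f' t.
  rewrite /f' qper; congr (_ * _); congr (- _); congr (2 * _).
  have [sk ck] := sin_cos_piz R k.
  have ck2 : cos (pi * k%:~R) * cos (pi * k%:~R) = 1 :> R.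
    by rewrite -expr2 -(real_normK (num_real (cos _))) ck expr1n.
  rewrite mulrDr sinD cosD sk !mulr0 addr0 subr0.
  transitivity (sin (pi * t) * (cos (pi * t) * pi) * (cos (pi * k%:~R) * cos (pi * k%:~R))).
    by ring.
  by rewrite ck2 mulr1.
have [G G0 dG] := primitive (is_derive_continuous df).
have f0 t : 0 <= f t by exact: sqr_ge0.
have fle t : f t <= e ^+ 4.
  rewrite /f (_ : e ^+ 4 = (e ^+ 2) ^+ 2); last by rewrite -exprM.
  rewrite ler_sqr ?nnegrE ?le_max ?lexx ?sqr_ge0//.
  by rewrite ge_max sqr_ge0 /q gerBl sqr_ge0.
have Gmono s t : s <= t -> G s <= G t.
  by move=> st; apply: (is_derive_nondecreasing st dG).
have I0 : e ^+ 5 / 16 <= G 1.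
  have e8 : 0 <= e / 8 by rewrite divr_ge0// ltW.
  apply: (@le_trans _ _ (G (e / 8))); last by apply: Gmono; lra.
  have [c /andP[c0 c8]] := mean_value e8 dG; rewrite G0 !subr0 => ->.
  have fc : e ^+ 4 / 2 <= f c.
    have sc : sin (pi * c) ^+ 2 <= e ^+ 2 / 4.
      have := pdist_le c; rewrite (ger0_norm c0) => pc.
      have {}pc : pdist c <= e / 2 by lra.
      rewrite -(real_normK (num_real (sin _))) -/(pdist c).
      have -> : e ^+ 2 / 4 = (e / 2) ^+ 2 by field.
      by rewrite ler_sqr ?nnegrE ?pdist_ge0// divr_ge0// ltW.
    have qc : 3 / 4 * e ^+ 2 <= Num.max 0 (q c).
      by rewrite le_max; apply/orP; right; rewrite /q; lra.
    have e2 := sqr_ge0 e.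
    have -> : e ^+ 4 = (e ^+ 2) ^+ 2 by rewrite -exprM.
    by rewrite /f; nra.
  have -> : e ^+ 5 / 16 = e ^+ 4 / 2 * (e / 8) by field.
  by rewrite ler_wpM2r.
have I0' : 0 < G 1 by apply: lt_le_trans I0; rewrite divr_gt0// exprn_gt0.
have GD1 t : G (t + 1) - G t = G 1.
  have H (s : R) : is_derive s 1 (fun s => G (s + 1) - G s) 0.
    apply: deriveR_eq (deriveR_sub (is_derive_shift_arg (f' := f) (dG (s + 1))) (dG s)) _.
    by have := fper s 1; rewrite mulr1z => ->; rewrite subrr.
  by rewrite (is_derive_0_is_cst t 0 H) add0r G0 subr0.
have GDn (n : nat) t : G (t + n%:R) = G t + n%:R * G 1.
  elim: n => [|n IH]; first by rewrite addr0 mul0r addr0.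
  rewrite -natr1 addrA; have := GD1 (t + n%:R); rewrite IH; lra.
exists (fun t => G t / G 1), (fun t => f t / G 1), (fun t => f' t / G 1); split.
- by move=> t; rewrite mulrC; under eq_fun do rewrite mulrC; apply: deriveR_scale.
- move=> t; split.
    by rewrite mulrC; under eq_fun do rewrite mulrC; apply: deriveR_scale.
  apply/andP; split; first by rewrite divr_ge0// ltW.
  rewrite ler_pdivrMr//.
  apply: le_trans (fle t) _; rewrite mulrC -ler_pdivrMr ?divr_gt0//.
  apply: le_trans I0; rewrite le_eqVlt; apply/orP; left; apply/eqP; field.
  by rewrite gt_eqF.
- apply: ctsM; last exact: cts_cst.
  apply: ctsM.
    by apply: ctsM; [exact: cts_cst|apply: cts_max => //; exact: cts_cst].
  apply: ctsN; apply: ctsM; first exact: cts_cst.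
  have cid : continuous (fun t : R => pi * t).
    by apply: ctsM; [exact: cts_cst|move=> t; exact: cvg_id].
  apply: ctsM; first by apply: cts_comp cid; exact: continuous_sin.
  apply: ctsM; last exact: cts_cst.
  by apply: cts_comp cid; exact: continuous_cos.
- move=> t k; rewrite fper f'per; split=> //.
  suff -> : G (t + k%:~R) = G t + k%:~R * G 1 by rewrite mulrDl mulfK// gt_eqF.
  case: k => n; first exact: GDn.
  rewrite NegzE mulrNz.
  have := GDn n.+1 (t - n.+1%:R); rewrite subrK => ->.
  by rewrite mulNr addrK.
- move=> t et; rewrite /f max_l ?expr0n ?mul0r//.
  rewrite /q subr_le0 -(real_normK (num_real (sin _))) -/(pdist t).
  by rewrite ler_sqr ?nnegrE ?pdist_ge0// ltW.
Qed.

End Kernel.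

(** * Invariant functionals and their stream functions *)
Section PeriodicAlgebra.
Variable R : realType.
Implicit Types (f g : plane R -> R).

Lemma C0_per_cst (c : R) : C0_per (fun _ : plane R => c).
Proof. by split; [exact: cts_cst|]. Qed.

Lemma C0_perD f g : C0_per f -> C0_per g -> C0_per (fun z => f z + g z).
Proof. by move=> [cf pf] [cg pg]; split; [exact: ctsD|move=> k x; rewrite pf pg]. Qed.

Lemma C0_perN f : C0_per f -> C0_per (fun z => - f z).
Proof. by move=> [cf pf]; split; [exact: ctsN|move=> k x; rewrite pf]. Qed.

Lemma C0_perB f g : C0_per f -> C0_per g -> C0_per (fun z => f z - g z).
Proof. by move=> [cf pf] [cg pg]; split; [exact: ctsB|move=> k x; rewrite pf pg]. Qed.

Lemma C0_perM f g : C0_per f -> C0_per g -> C0_per (fun z => f z * g z).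
Proof. by move=> [cf pf] [cg pg]; split; [exact: ctsM|move=> k x; rewrite pf pg]. Qed.

Lemma C0_perZ (c : R) f : C0_per f -> C0_per (fun z => c * f z).
Proof. by move=> ?; apply: C0_perM => //; exact: C0_per_cst. Qed.

Lemma C0_per_norm f : C0_per f -> C0_per (fun z => `|f z|).
Proof. by move=> [cf pf]; split; [exact: cts_norm|move=> k x; rewrite pf]. Qed.

Lemma C0_per_comp (h : R -> R) f : continuous h -> C0_per f -> C0_per (fun z => h (f z)).
Proof. by move=> ch [cf pf]; split; [exact: cts_comp|move=> k x; rewrite pf]. Qed.

Lemma C0_per_sum (I : Type) (r : seq I) (F : I -> plane R -> R) :
  (forall i, C0_per (F i)) -> C0_per (fun z => \sum_(i <- r) F i z).
Proof.
move=> pF; split; first by apply: cts_sum => i; have [] := pF i.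
by move=> k x; apply: eq_bigr => i _; have [_ ->] := pF i.
Qed.

Lemma C0_per_slice1 (h : R -> R) (a : R) : continuous h -> int_periodic h ->
  C0_per (fun z : plane R => h (a - z.1)).
Proof.
move=> ch ph; split; last by move=> k z /=; rewrite opprD addrA -intrN ph.
by apply: cts_comp => //; apply: ctsB; [exact: cts_cst|exact: cts_fst].
Qed.

Lemma C0_per_slice2 (h : R -> R) (a : R) : continuous h -> int_periodic h ->
  C0_per (fun z : plane R => h (a - z.2)).
Proof.
move=> ch ph; split; last by move=> k z /=; rewrite opprD addrA -intrN ph.
by apply: cts_comp => //; apply: ctsB; [exact: cts_cst|exact: cts_snd].
Qed.

(** Restricted to continuous periodic functions because an integral need not be additive on
    functions that are not integrable. *)
Definition linear_functional (A : (plane R -> R) -> R) : Prop :=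
  (forall f g, C0_per f -> C0_per g -> A (fun z => f z + g z) = A f + A g) /\
  (forall c f, C0_per f -> A (fun z => c * f z) = c * A f).

Definition positive_functional (A : (plane R -> R) -> R) : Prop :=
  forall f, C0_per f -> (forall z, 0 <= f z) -> 0 <= A f.

Definition invariant_functional (X : R -> plane R -> plane R)
    (A : (plane R -> R) -> R) : Prop :=
  forall t f, C0_per f -> A (fun z => f (X t z)) = A f.

End PeriodicAlgebra.

Section Functional.
Variables (R : realType) (b : plane R -> plane R) (K B : R).
Hypothesis K0 : 0 < K.
Hypothesis b_lip : forall x y, `|b x - b y| <= K * `|x - y|.
Hypothesis B0 : 0 < B.
Hypothesis b_bnd : forall x, `|b x| <= B.
Hypothesis b_per : Defs.periodic b.
Variable X : R -> plane R -> plane R.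
Hypothesis hX : is_flow b X.
(* A signed functional [lam] dominated by a positive one [M]. *)
Variables lam M : (plane R -> R) -> R.
Hypothesis lam_lin : linear_functional lam.
Hypothesis lam_inv : invariant_functional X lam.
Hypothesis M_lin : linear_functional M.
Hypothesis M_pos : positive_functional M.
Hypothesis M_inv : invariant_functional X M.
Hypothesis lam_le : forall f, C0_per f -> `|lam f| <= M (fun z => `|f z|).
Implicit Types (x y z : plane R) (s t : R) (f g : plane R -> R).

Let m := M (fun=> 1).

Lemma C0_per_b1 : C0_per (fun z => (b z).1).
Proof.
split; last by move=> k x; rewrite b_per.
exact: cts_compT (@cts_fst R) (b_continuous K0 b_lip).
Qed.

Lemma C0_per_b2 : C0_per (fun z => (b z).2).
Proof.
split; last by move=> k x; rewrite b_per.
exact: cts_compT (@cts_snd R) (b_continuous K0 b_lip).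
Qed.

Lemma C0_per_flow t f : C0_per f -> C0_per (fun z => f (X t z)).
Proof.
move=> [cf pf]; split.
  exact: cts_compT cf (flow_cts_space K0 b_lip hX (t := t)).
by move=> k x; rewrite (flow_periodic K0 b_lip hX b_per) pf.
Qed.

Lemma functionalB (A : (plane R -> R) -> R) f g : linear_functional A -> C0_per f -> C0_per g ->
  A (fun z => f z - g z) = A f - A g.
Proof.
move=> [AD AZ] pf pg; have := AD f (fun z => -1 * g z) pf (C0_perZ _ pg).
rewrite AZ// mulN1r => <-; congr A; apply/funext => z; by rewrite mulN1r.
Qed.

Lemma functional0 (A : (plane R -> R) -> R) : linear_functional A -> A (fun=> 0) = 0.
Proof.
move=> [_ AZ]; have := AZ 0 (fun=> 0) (C0_per_cst _); by rewrite !mul0r.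
Qed.

Lemma functional_sum (A : (plane R -> R) -> R) (I : Type) (r : seq I) (F : I -> plane R -> R) :
  linear_functional A -> (forall i, C0_per (F i)) ->
  A (fun z => \sum_(i <- r) F i z) = \sum_(i <- r) A (F i).
Proof.
move=> Al pF; elim: r => [|i r IH].
  by under eq_fun do rewrite big_nil; rewrite big_nil functional0.
under eq_fun do rewrite big_cons; rewrite big_cons -IH.
by case: Al => AD _; rewrite AD//; exact: C0_per_sum.
Qed.

Lemma M_le f g : C0_per f -> C0_per g -> (forall z, f z <= g z) -> M f <= M g.
Proof.
move=> pf pg fg; rewrite -subr_ge0 -functionalB//.
by apply: M_pos; [exact: C0_perB|move=> z; rewrite subr_ge0].
Qed.

Lemma M_cst (c : R) : M (fun=> c) = c * m.
Proof.
have [_ MZ] := M_lin; rewrite -(MZ c (fun=> 1) (C0_per_cst _)).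
by congr M; apply/funext => z; rewrite mulr1.
Qed.

Lemma m_ge0 : 0 <= m.
Proof. by apply: M_pos => //; exact: C0_per_cst. Qed.

Lemma lam_le_M f g : C0_per f -> C0_per g -> (forall z, `|f z| <= g z) ->
  `|lam f| <= M g.
Proof.
move=> pf pg fg; apply: le_trans (lam_le pf) _.
by apply: M_le => //; exact: C0_per_norm.
Qed.

(** The mean value theorem and the compactness behind periodicity make the difference quotients
    converge uniformly; the domination of [lam] by [M] carries this limit through [lam]. *)
Lemma lam_derive (g g' : R -> plane R -> R) s0 :
  (forall s z, is_derive s 1 (fun r => g r z) (g' s z)) ->
  (forall s, C0_per (g s)) ->
  continuous (fun p : R * plane R => g' p.1 p.2) -> (forall s, Defs.periodic (g' s)) ->
  is_derive s0 1 (fun s => lam (g s)) (lam (g' s0)).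
Proof.
move=> dg pg cg' pg'.
have pg's s : C0_per (g' s).
  split=> //; apply: (@cts_compT _ _ _ (fun p : R * plane R => g' p.1 p.2) (fun z => (s, z)) cg').
  by apply: cts_pair => z; [exact: cvg_cst|exact: cvg_id].
have H : h^-1 *: (lam (g (h *: (1 : R) + s0)) - lam (g s0)) @[h --> 0^'] --> lam (g' s0).
  apply/cvgrPdist_le => e e0.
  (* The denominator is [m + 1] because the total mass [m] may be zero. *)
  have e1 : 0 < e / (m + 1) by rewrite divr_gt0// ltr_wpDl ?m_ge0.
  have := @uniform_param R g' s0 cg' pg' _ e1.
  move=> /nbhs_ballP[r /= r0 Hr].
  near=> h.
  have h0 : h != 0 by near: h; exact: nbhs_dnbhs_neq.
  have hr : `|h| < r.
    near: h; apply: nbhs_dnbhs; apply/nbhs_ballP; exists r => //= h.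
    by rewrite /ball/= sub0r normrN.
  rewrite /GRing.scale/= mulr1.
  have -> : h^-1 * (lam (g (h + s0)) - lam (g s0)) =
      lam (fun z => h^-1 * (g (h + s0) z - g s0 z)).
    rewrite -(functionalB lam_lin (pg (h + s0)) (pg s0)).
    by case: lam_lin => _ ->//; apply: C0_perB.
  rewrite -functionalB//; last by apply: C0_perZ; exact: C0_perB.
  apply: (@le_trans _ _ (M (fun=> e / (m + 1)))).
    apply: lam_le_M; [|exact: C0_per_cst|].
      by apply: C0_perB => //; apply: C0_perZ; exact: C0_perB.
    move=> z; have [c ch E] := mean_value_near s0 (h + s0) (dg^~ z).
    rewrite E addrK mulrCA mulVf// mulr1 distrC; apply: Hr.
    rewrite /ball/= distrC; apply: le_lt_trans ch _.
    by rewrite addrK.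
  have m1 : 0 < m + 1 by rewrite ltr_wpDl ?m_ge0.
  by rewrite M_cst mulrAC ler_pdivrMr// ler_pM2l// lerDl.
split; first by apply/cvg_ex; exists (lam (g' s0)).
by apply/cvg_lim.
Unshelve. all: by end_near. Qed.

(** This is the weak form of [div (b lam) = 0]: by invariance [lam] of [f] composed with [X s] does
    not depend on [s], and its derivative at 0 is [lam f']. *)
Lemma lam_flow_derivative f f' : C0_per f -> C0_per f' ->
  (forall s z, is_derive s 1 (fun r => f (X r z)) (f' (X s z))) -> lam f' = 0.
Proof.
move=> pf pf' df.
have D : is_derive (0 : R) 1 (fun s => lam (fun z => f (X s z))) (lam (fun z => f' (X 0 z))).
  apply: lam_derive => // [s|s|s].
  - exact: C0_per_flow.
  - have [cf' _] := pf'.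
    exact: (@cts_compT _ _ _ f' (fun p : R * plane R => X p.1 p.2) cf' (flow_continuous K0 b_lip B0 b_bnd hX)).
  - by have [] := C0_per_flow s pf'.
have -> : f' = fun z => f' (X 0 z) by apply/funext => z; rewrite (flow0 hX).
have D0 : is_derive (0 : R) 1 (fun s => lam (fun z => f (X s z))) 0.
  have -> : (fun s => lam (fun z => f (X s z))) = fun=> lam f.
    by apply/funext => s; rewrite lam_inv.
  exact: deriveR_cst.
by case: D => _ <-; case: D0.
Qed.

Lemma is_derive_flow1 z s : is_derive s 1 (fun r => (X r z).1) (b (X s z)).1.
Proof. exact: is_derive_fst (is_derive_flow hX z s). Qed.

Lemma is_derive_flow2 z s : is_derive s 1 (fun r => (X r z).2) (b (X s z)).2.
Proof. exact: is_derive_snd (is_derive_flow hX z s). Qed.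

Hypothesis flux1 : lam (fun z => (b z).1) = 0.
Hypothesis flux2 : lam (fun z => (b z).2) = 0.

Section Stream.
Variables (e : R) (D d d' : R -> R).
Hypothesis mol : mollifier e D d d'.

(** [D] gains 1 per period, so [S] is periodic: a primitive of the smoothed Dirac comb minus its
    mean. *)
Let S t := D t - t.

Let dD t : is_derive t 1 D (d t). Proof. by have [+ _ _ _ _] := mol; exact. Qed.

Let dd t : is_derive t 1 d (d' t). Proof. by have [_ /(_ t)[]] := mol. Qed.

Let dS t : is_derive t 1 S (d t - 1).
Proof. by apply: deriveR_sub => //; exact: deriveR_id. Qed.

Let cd : continuous d. Proof. exact: is_derive_continuous dd. Qed.

Let cd' : continuous d'. Proof. by have [] := mol. Qed.

Let cS : continuous S. Proof. exact: is_derive_continuous dS. Qed.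

Let pd : int_periodic d. Proof. by move=> t k; have [_ _ _ /(_ t k)[]] := mol. Qed.

Let pd' : int_periodic d'. Proof. by move=> t k; have [_ _ _ /(_ t k)[]] := mol. Qed.

Let pS : int_periodic S.
Proof. by move=> t k; have [_ _ _ /(_ t k)[DE _ _] _] := mol; rewrite /S DE; lra. Qed.

(** After application of [lam], the first term is a primitive in [x.2] of the mollified first
    component of [b lam]. The second depends on [x.1] alone: it adjusts the constants of integration
    so that the derivative in [x.1] is minus the mollified second component. *)
Definition stream_kernel x z :=
  d (x.1 - z.1) * S (x.2 - z.2) * (b z).1 - S (x.1 - z.1) * (b z).2.

(* The mollified stream function: its derivatives recover the mollification
   of the vector-valued functional [b lam], see [stream_derive]. *)
Definition stream x := lam (stream_kernel x).

Lemma C0_per_stream_kernel x : C0_per (stream_kernel x).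
Proof.
apply: C0_perB; apply: C0_perM; [|exact: C0_per_b1| |exact: C0_per_b2].
  by apply: C0_perM; [exact: C0_per_slice1|exact: C0_per_slice2].
exact: C0_per_slice1.
Qed.

Lemma stream_periodic x k : stream (x + zvec R k) = stream x.
Proof.
congr lam; apply/funext => z; rewrite /stream_kernel /=.
by rewrite ![_ + _%:~R - _]addrAC pd !pS.
Qed.

Lemma derive_minus_arg (h h' c : R -> R) (c' a s : R) :
  (forall t : R, is_derive t 1 h (h' t)) -> is_derive s 1 c c' ->
  is_derive s 1 (fun r => h (a - c r)) (- (h' (a - c s) * c')).
Proof.
move=> dh dc; apply: deriveR_eq (deriveR_comp (dh _) (deriveR_sub (deriveR_cst a s) dc)) _.
by rewrite sub0r mulrN.
Qed.

(** Conservation of flux: invariance tested on [S (a - z.1)] shows that the smoothed flux through a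
    vertical line equals the total flux [lam (b.1)], which vanishes. *)
Lemma flux_slice1 a : lam (fun z => d (a - z.1) * (b z).1) = 0.
Proof.
have H : lam (fun z => - ((d (a - z.1) - 1) * (b z).1)) = 0.
  apply: (@lam_flow_derivative (fun z => S (a - z.1))).
  - exact: C0_per_slice1.
  - apply: C0_perN; apply: C0_perM; last exact: C0_per_b1.
    by apply: C0_perB; [exact: C0_per_slice1|exact: C0_per_cst].
  - move=> s z; exact: (derive_minus_arg a dS (is_derive_flow1 z s)).
have -> : (fun z => d (a - z.1) * (b z).1) =
    fun z => (b z).1 - (- ((d (a - z.1) - 1) * (b z).1)).
  by apply/funext => z; ring.
rewrite functionalB//; first by rewrite H flux1 subrr.
  exact: C0_per_b1.
apply: C0_perN; apply: C0_perM; last exact: C0_per_b1.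
by apply: C0_perB; [exact: C0_per_slice1|exact: C0_per_cst].
Qed.

Let curl a c z := d' (a - z.1) * S (c - z.2) * (b z).1 +
   d (a - z.1) * (d (c - z.2) - 1) * (b z).2.

Let C0_per_curl a c : C0_per (curl a c).
Proof.
apply: C0_perD; apply: C0_perM; [|exact: C0_per_b1| |exact: C0_per_b2].
  by apply: C0_perM; [exact: C0_per_slice1|exact: C0_per_slice2].
apply: C0_perM; first exact: C0_per_slice1.
by apply: C0_perB; [exact: C0_per_slice2|exact: C0_per_cst].
Qed.

(** Invariance tested on [d (a - z.1) * S (c - z.2)]. It trades the [d'] that appears in the
    [x.1]-derivative of the stream function for a term without derivatives of [d]. *)
Lemma curl_eq0 a c : lam (curl a c) = 0.
Proof.
have H : lam (fun z => -1 * curl a c z) = 0.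
  apply: (@lam_flow_derivative (fun z => d (a - z.1) * S (c - z.2))).
  - by apply: C0_perM; [exact: C0_per_slice1|exact: C0_per_slice2].
  - exact: C0_perZ.
  - move=> s z.
    apply: deriveR_eq (deriveR_mul (derive_minus_arg a dd (is_derive_flow1 z s))
      (derive_minus_arg c dS (is_derive_flow2 z s))) _.
    by rewrite /curl; ring.
by move: H; case: lam_lin => _ ->//; lra.
Qed.

Lemma stream_derive (c1 c2 c1' c2' : R -> R) s :
  (forall t, is_derive t 1 c1 (c1' t)) -> (forall t, is_derive t 1 c2 (c2' t)) ->
  continuous c1' -> continuous c2' ->
  is_derive s 1 (fun r => stream (c1 r, c2 r))
    (lam (fun z => d (c1 s - z.1) * d (c2 s - z.2) *
                   ((b z).1 * c2' s - (b z).2 * c1' s))).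
Proof.
move=> dc1 dc2 cc1' cc2'.
have cc1 := is_derive_continuous dc1; have cc2 := is_derive_continuous dc2.
pose g' s z := c1' s * (d' (c1 s - z.1) * S (c2 s - z.2) * (b z).1 - (d (c1 s - z.1) - 1) * (b z).2)
   + c2' s * (d (c1 s - z.1) * (d (c2 s - z.2) - 1) * (b z).1).
have H : is_derive s 1 (fun r => stream (c1 r, c2 r)) (lam (g' s)).
  apply: lam_derive => [r z|r||r].
  - have L (h h' : R -> R) (a : R) (c : R -> R) (c' : R) : (forall t : R, is_derive t 1 h (h' t)) ->
        is_derive r 1 c c' -> is_derive r 1 (fun r => h (c r - a)) (h' (c r - a) * c').
      move=> dh dc; apply: deriveR_comp (dh _) _.
      by apply: deriveR_eq (deriveR_sub dc (deriveR_cst a r)) _; rewrite subr0.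
    apply: deriveR_eq (deriveR_sub (deriveR_mul (deriveR_mul (L d d' z.1 c1 _ dd (dc1 r))
       (L S _ z.2 c2 _ dS (dc2 r))) (deriveR_cst (b z).1 r))
      (deriveR_mul (L S _ z.1 c1 _ dS (dc1 r)) (deriveR_cst (b z).2 r))) _.
    by rewrite /g'; ring.
  - exact: C0_per_stream_kernel.
  - have cp (h c : R -> R) (q : plane R -> R) : continuous h -> continuous c -> continuous q ->
        continuous (fun p : R * plane R => h (c p.1 - q p.2)).
      move=> ch cc cq; apply: cts_comp ch _; apply: ctsB.
        by apply: cts_compT cc _ => p; exact: cvg_fst.
      by apply: cts_compT cq _ => p; exact: cvg_snd.
    have cfst (h : R -> R) : continuous h -> continuous (fun p : R * plane R => h p.1).
      by move=> ch; apply: cts_compT ch _ => p; exact: cvg_fst.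
    have csnd (q : plane R -> R) : continuous q -> continuous (fun p : R * plane R => q p.2).
      by move=> cq; apply: cts_compT cq _ => p; exact: cvg_snd.
    have [cb1 _] := C0_per_b1; have [cb2 _] := C0_per_b2.
    apply: ctsD; (apply: ctsM; first exact: cfst).
      apply: ctsB.
        apply: ctsM; last exact: (csnd _ cb1).
        by apply: ctsM; [exact: (cp _ _ _ cd' cc1 (@cts_fst R))|exact: (cp _ _ _ cS cc2 (@cts_snd R))].
      apply: ctsM; last exact: (csnd _ cb2).
      by apply: ctsB; [exact: (cp _ _ _ cd cc1 (@cts_fst R))|exact: cts_cst].
    apply: ctsM; last exact: (csnd _ cb1).
    apply: ctsM; first exact: (cp _ _ _ cd cc1 (@cts_fst R)).
    by apply: ctsB; [exact: (cp _ _ _ cd cc2 (@cts_snd R))|exact: cts_cst].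
  - move=> k z; rewrite /g' /= b_per !opprD !addrA -!intrN.
    by rewrite pd' !pd pS.
apply: deriveR_eq H _.
have P1 : C0_per (fun z => d (c1 s - z.1) * (b z).1).
  by apply: C0_perM; [exact: C0_per_slice1|exact: C0_per_b1].
have P2 : C0_per (fun z => d (c1 s - z.1) * d (c2 s - z.2) * ((b z).1 * c2' s - (b z).2 * c1' s)).
  apply: C0_perM; first by apply: C0_perM; [exact: C0_per_slice1|exact: C0_per_slice2].
  by apply: C0_perB; apply: C0_perM; try exact: C0_per_cst; [exact: C0_per_b1|exact: C0_per_b2].
(* The derivative of the kernel is the smoothed cross product plus three terms annihilated by [lam]:
   a slice flux, [curl], and the total flux of [b.2]. *)
have -> : g' s = fun z => (d (c1 s - z.1) * d (c2 s - z.2) * ((b z).1 * c2' s - (b z).2 * c1' s)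
    - c2' s * (d (c1 s - z.1) * (b z).1)) + (c1' s * curl (c1 s) (c2 s) z + c1' s * (b z).2).
  by apply/funext => z; rewrite /g' /curl; ring.
have [LD LZ] := lam_lin.
rewrite LD; last 2 first.
- by apply: C0_perB => //; exact: C0_perZ.
- by apply: C0_perD; apply: C0_perZ => //; exact: C0_per_b2.
rewrite functionalB//; last exact: C0_perZ.
rewrite LD; last 2 first.
- exact: C0_perZ.
- by apply: C0_perZ; exact: C0_per_b2.
rewrite !LZ//; last exact: C0_per_b2.
by rewrite flux2 flux_slice1 curl_eq0 !mulr0 subr0 !addr0.
Qed.

(** Replacing [S] by [D] costs [v' - v] times a slice flux, which is zero. The gain is monotonicity:
    for [v <= v'] the increment is the flux of [b.1] weighted by a non-negative smoothed segment. *)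
Lemma stream_vertical a v v' : stream (a, v') - stream (a, v) =
  lam (fun z => (b z).1 * (d (a - z.1) * (D (v' - z.2) - D (v - z.2)))).
Proof.
rewrite /stream -functionalB//; try exact: C0_per_stream_kernel.
have P1 : C0_per (fun z => d (a - z.1) * (b z).1).
  by apply: C0_perM; [exact: C0_per_slice1|exact: C0_per_b1].
have P2 : C0_per (fun z => (b z).1 * (d (a - z.1) * (D (v' - z.2) - D (v - z.2)))).
  apply: C0_perM; first exact: C0_per_b1.
  apply: C0_perM; first exact: C0_per_slice1.
  have -> : (fun z : plane R => D (v' - z.2) - D (v - z.2)) =
      fun z => S (v' - z.2) - S (v - z.2) + (v' - v).
    by apply/funext => z; rewrite /S; ring.
  by apply: C0_perD; [apply: C0_perB; exact: C0_per_slice2|exact: C0_per_cst].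
transitivity (lam (fun z => (b z).1 * (d (a - z.1) * (D (v' - z.2) - D (v - z.2)))
    - (v' - v) * (d (a - z.1) * (b z).1))).
  by congr lam; apply/funext => z; rewrite /stream_kernel /S/=; ring.
rewrite functionalB//; last exact: C0_perZ.
by case: lam_lin => _ ->//; rewrite flux_slice1 mulr0 subr0.
Qed.

End Stream.
End Functional.

(** * Counting visits and timing passages *)

Section Counting.
Variable R : realType.

Lemma sum_window_le (F : nat -> R) (c : R) (q N : nat) :
  (forall j, 0 <= F j <= c) ->
  (forall i j, (i <= j)%N -> F i != 0 -> F j != 0 -> (j - i <= q)%N) ->
  \sum_(j < N) F j <= c * q.+1%:R.
Proof.
move=> Fc Fq.
have c0 : 0 <= c by have /andP[h1 h2] := Fc 0%N; exact: le_trans h2.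
have [[i0 Fi0]|noF] := pselect (exists i, F i != 0); last first.
  rewrite big1 ?mulr_ge0// => j _; apply/eqP/negPn/negP => Fj.
  by apply: noF; exists j.
have ex : exists i, F i != 0 by exists i0.
case: (ex_minnP ex) => i Fi imin {i0 Fi0 ex}.
have F0 j : 0 <= F j by have /andP[] := Fc j.
apply: (@le_trans _ _ (\sum_(0 <= j < i + q.+1 + N) F j)).
  rewrite -(big_mkord predT F) [X in _ <= X](@big_cat_nat _ _ _ N 0 (i + q.+1 + N))//=; last exact: leq_addl.
  by rewrite lerDl; apply: sumr_ge0.
rewrite (@big_cat_nat _ _ _ (i + q.+1) 0 (i + q.+1 + N))//=; last exact: leq_addr.
rewrite (@big_cat_nat _ _ _ i 0 (i + q.+1))//=; last exact: leq_addr.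
have Z1 : \sum_(0 <= j < i) F j = 0.
  rewrite big_nat_cond big1// => j /andP[/andP[_ ji] _]; apply/eqP/negPn/negP => /imin.
  by rewrite leqNgt ji.
have Z2 : \sum_(i + q.+1 <= j < i + q.+1 + N) F j = 0.
  rewrite big_nat_cond big1// => j /andP[/andP[ij _] _]; apply/eqP/negPn/negP => Fj.
  have lij : (i <= j)%N by apply: leq_trans ij; exact: leq_addr.
  have := Fq i j lij Fi Fj; rewrite leqNgt => /negP; apply.
  by rewrite ltn_subRL -addnS.
rewrite Z1 Z2 add0r.
rewrite addr0; apply: (@le_trans _ _ (\sum_(i <= j < i + q.+1) c)).
  by apply: ler_sum => j _; have /andP[] := Fc j.
by rewrite sumr_const_nat addKn mulr_natr.
Qed.

(** The time is so short that the speed stays above [c / 2] and the displacement below 1/2. Hence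
    nothing wraps around the circle, the two positions are within [4 e] of each other, and covering
    this distance takes at most [8 e / c]. *)
Lemma pass_time (x v : R -> R) (a c kap B e s s' : R) :
  (forall t : R, is_derive t 1 x (v t)) -> 0 < c -> (forall t, `|v t| <= B) ->
  (forall r t, `|v r - v t| <= kap * `|r - t|) -> c <= `|v s| -> s <= s' -> 0 <= kap ->
  kap * (s' - s) <= c / 2 -> B * (s' - s) <= 2^-1 ->
  pdist (x s - a) <= e -> pdist (x s' - a) <= e -> s' - s <= 8 * e / c.
Proof.
move=> dx c0 vB vlip cv ss' k0 ks Bs p1 p2.
have p : pdist (x s' - x s) <= 2 * e.
  have -> : x s' - x s = (x s' - a) - (x s - a) by lra.
  apply: le_trans (pdistD _ _) _; rewrite pdistN; lra.
have xs : `|x s' - x s| <= 2^-1.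
  by apply: le_trans Bs; apply: (derive_bound ss' dx).
have {p}p : `|x s' - x s| <= 4 * e by have := norm_le_pdist xs; lra.
have [r /andP[sr rs] E] := mean_value ss' dx.
have vr : c / 2 <= `|v r|.
  have h : `|v r - v s| <= c / 2.
    apply: le_trans (vlip r s) _; apply: le_trans ks; apply: ler_wpM2l => //.
    by rewrite ger0_norm ?subr_ge0// lerD2r.
  have := ler_normD (v s - v r) (v r); rewrite subrK distrC; lra.
move: p; rewrite E normrM (ger0_norm (_ : 0 <= s' - s)) ?subr_ge0// => p.
rewrite ler_pdivlMr//.
have := ler_wpM2r (_ : 0 <= s' - s) vr; rewrite subr_ge0 => /(_ ss'); lra.
Qed.

Lemma pdist_near (x z : plane R) (e : R) :
  pdist (z.1 - x.1) <= e -> pdist (z.2 - x.2) <= e ->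
  exists k, `|z - (x + zvec R k)| <= 2 * e.
Proof.
move=> p1 p2; have [k1 [h1 _]] := pdist_near_int (z.1 - x.1).
have [k2 [h2 _]] := pdist_near_int (z.2 - x.2).
exists (k1, k2); apply: norm_plane_le; rewrite /= opprD addrA.
  by apply: le_trans h1 _; lra.
by apply: le_trans h2 _; lra.
Qed.

End Counting.

(** * Rarity of visits to a small square *)

Section Recurrence.
Variables (R : realType) (b : plane R -> plane R) (K B : R).
Hypothesis K0 : 0 < K.
Hypothesis b_lip : forall x y, `|b x - b y| <= K * `|x - y|.
Hypothesis B0 : 0 < B.
Hypothesis b_bnd : forall x, `|b x| <= B.
Hypothesis b_per : Defs.periodic b.
Variable X : R -> plane R -> plane R.
Hypothesis hX : is_flow b X.
Hypothesis no_closed : forall y (T : R) k, 0 < T -> b y <> 0 -> X T y <> y + zvec R k.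
Variable M : (plane R -> R) -> R.
Hypothesis M_lin : linear_functional M.
Hypothesis M_pos : positive_functional M.
Hypothesis M_inv : invariant_functional X M.
Implicit Types (x y z : plane R) (s t e : R) (f g : plane R -> R).

Let m := M (fun=> 1).

(** By invariance [M f] is the average of [M] over [f] composed with the flow at [N] equally spaced
    times of [[0, L]]. At most [tau N / L + 1] of these times can meet the support along one orbit.
    Finite sums avoid exchanging [M] with a time integral; [N] runs through the powers of 2 so that
    the error is geometric. *)
Lemma average_bound f (c L tau : R) : C0_per f -> (forall z, 0 <= f z <= c) ->
  0 < L -> 0 <= tau ->
  (forall z s s', 0 <= s -> s <= s' -> s' <= L -> f (X s z) != 0 ->
     f (X s' z) != 0 -> s' - s <= tau) ->
  M f <= c * (tau / L) * m.
Proof.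
move=> pf fc L0 tau0 H.
have c0 : 0 <= c by have /andP[h1 h2] := fc 0; exact: le_trans h2.
apply: (@le_of_le_geometric R _ _ (c * m)) => n.
set N := (2 ^ n)%N; have N0 : 0 < N%:R :> R by rewrite ltr0n expn_gt0.
have -> : 2^-1 ^+ n = N%:R^-1 :> R by rewrite exprVn natrX.
pose q := Num.truncn (tau * N%:R / L).
have qle : q%:R <= tau * N%:R / L by rewrite truncn_le divr_ge0 ?mulr_ge0 ?(ltW L0).
pose F (j : nat) z := f (X (j%:R * (L / N%:R)) z).
have pF j : C0_per (F j) by exact: (C0_per_flow K0 b_lip b_per hX).
have sumF z : \sum_(j < N) F j z <= c * q.+1%:R.
  have -> : \sum_(j < N) F j z = \sum_(j < N) (if (j < N)%N then F j z else 0).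
    by apply: eq_bigr => j _; rewrite ltn_ord.
  apply: (@sum_window_le R (fun j => if (j < N)%N then F j z else 0)) => [j|i j ij].
    by case: ifPn; rewrite ?lexx// => _; exact: fc.
  case: ifPn => [iN Fi|]; last by rewrite eqxx.
  case: ifPn => [jN Fj|]; last by rewrite eqxx.
  have LN : 0 < L / N%:R by rewrite divr_gt0.
  have i0 : 0 <= i%:R * (L / N%:R) by rewrite mulr_ge0// ltW.
  have ij' : i%:R * (L / N%:R) <= j%:R * (L / N%:R) by rewrite ler_pM2r// ler_nat.
  have jL : j%:R * (L / N%:R) <= L.
    by rewrite mulrA ler_pdivrMr// mulrC ler_pM2l// ler_nat ltnW.
  have := H z _ _ i0 ij' jL Fi Fj; rewrite -mulrBl -natrB// => h.
  rewrite /q truncn_ge_nat; last by rewrite divr_ge0 ?mulr_ge0 ?(ltW L0).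
  by rewrite ler_pdivlMr// -ler_pdivrMr// -mulrA.
have Msum : N%:R * M f <= c * q.+1%:R * m.
  have -> : N%:R * M f = M (fun z => \sum_(j < N) F j z).
    rewrite (functional_sum (index_enum 'I_N) M_lin (F := fun j : 'I_N => F j))//.
    rewrite (eq_bigr (fun=> M f)); last by move=> j _; rewrite /F M_inv.
    by rewrite sumr_const card_ord mulr_natl.
  rewrite -(M_cst M_lin); apply: (M_le M_lin M_pos) => //.
    by apply: C0_per_sum => j; exact: pF.
  exact: C0_per_cst.
have m0 : 0 <= m by exact: (m_ge0 M_pos).
rewrite -(ler_pM2l N0); apply: le_trans Msum _.
have -> : N%:R * (c * (tau / L) * m + c * m / N%:R) = c * (tau * N%:R / L + 1) * m.
  by field; rewrite !gt_eqF.
apply: ler_wpM2r => //; apply: ler_wpM2l => //.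
by rewrite -natr1 lerD2r.
Qed.

Lemma pass_flow (c : R) : 0 < c -> exists2 tau : R, 0 < tau &
  forall z s s' a e, s <= s' -> s' - s <= tau ->
    (c <= `|(b (X s z)).1| -> pdist ((X s z).1 - a) <= e ->
      pdist ((X s' z).1 - a) <= e -> s' - s <= 8 * e / c) /\
    (c <= `|(b (X s z)).2| -> pdist ((X s z).2 - a) <= e ->
      pdist ((X s' z).2 - a) <= e -> s' - s <= 8 * e / c).
Proof.
move=> c0; have KB : 0 < K * B by rewrite mulr_gt0.
(* Along orbits the velocity is [K * B]-Lipschitz in time, so it changes by at most [c / 2], and the
   displacement is at most 1/2: the requirements of [pass_time]. *)
exists (Num.min (c / 2 / (K * B)) (2^-1 / B)).
  by rewrite lt_min !divr_gt0.
move=> z s s' a e ss'; rewrite le_min => /andP[].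
rewrite ler_pdivlMr// mulrC => h1; rewrite ler_pdivlMr// mulrC => h2.
have lip r t : `|b (X r z) - b (X t z)| <= K * B * `|r - t|.
  apply: le_trans (b_lip _ _) _; rewrite -mulrA ler_pM2l//.
  exact: (flow_time_lip b_bnd hX).
split=> cv p1 p2.
  apply: (@pass_time R (fun r => (X r z).1) (fun r => (b (X r z)).1) a c (K * B) B) => //.
  - by move=> t; exact: is_derive_flow1.
  - by move=> t; apply: le_trans (norm_fst _) (b_bnd _).
  - by move=> r t; apply: le_trans (norm_fstB _ _) (lip r t).
  - exact: ltW.
apply: (@pass_time R (fun r => (X r z).2) (fun r => (b (X r z)).2) a c (K * B) B) => //.
- by move=> t; exact: is_derive_flow2.
- by move=> t; apply: le_trans (norm_snd _) (b_bnd _).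
- by move=> r t; apply: le_trans (norm_sndB _ _) (lip r t).
- exact: ltW.
Qed.

Let fast (c : R) := [set x | unit_square x /\ c <= `|b x|].

Lemma cts_plane_norm (T : topologicalType) (h : T -> plane R) :
  continuous h -> continuous (fun t : T => `|h t|).
Proof. by move=> ch; apply: cts_compT ch => x; exact: norm_continuous. Qed.

Let compact_fast c : compact (fast c).
Proof.
have -> : fast c = unit_square `&` (fun x => `|b x|) @^-1` [set r | c <= r] by [].
apply: compact_closedI; first exact: compact_unit_square.
apply: closed_comp; last exact: closed_ge.
move=> x _; apply: cts_plane_norm; exact: (b_continuous K0 b_lip).
Qed.

(** An orbit reaches no root in finite time; compactness of [[0, L]] times the set of fast points
    makes this quantitative. *)
Lemma speed_lower (c L : R) : 0 < c -> exists2 c' : R, 0 < c' &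
  forall y t, c <= `|b y| -> 0 <= t <= L -> c' <= `|b (X t y)|.
Proof.
move=> c0.
have cF : continuous (fun p : R * plane R => `|b (X p.1 p.2)|).
  apply: cts_plane_norm; apply: (cts_compT (b_continuous K0 b_lip)).
  exact: (flow_continuous K0 b_lip B0 b_bnd hX).
have cK : compact ([set` `[0, L]] `*` fast c).
  by apply: compact_setX; [exact: segment_compact|exact: compact_fast].
have [|c' c'0 H] := compact_positive cK cF.
  move=> [t x] /= [_ [_ cx]]; rewrite normr_gt0; apply/eqP => bX.
  have := flow_root K0 b_lip hX bX => bx0.
  by move: cx; rewrite bx0 normr0 leNgt c0.
exists c' => // y t cy tL; have [k sqk] := reduce_unit_square y.
have := H (t, y + zvec R k); rewrite /= (flow_periodic K0 b_lip hX b_per) b_per; apply.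
by split; [rewrite /= in_itv|split; rewrite ?b_per].
Qed.

(** A zero of the sum of distances would be a solution of [X t x = x + k], excluded by [no_closed];
    a positive continuous function on a compact set has a positive lower bound. *)
Lemma no_return (c tau L : R) : 0 < c -> 0 < tau -> exists2 kap : R, 0 < kap &
  forall x t, c <= `|b x| -> tau <= t <= L ->
    kap <= pdist ((X t x).1 - x.1) + pdist ((X t x).2 - x.2).
Proof.
move=> c0 tau0.
have cXF := flow_continuous K0 b_lip B0 b_bnd hX.
have csnd : continuous (fun p : R * plane R => p.2) by move=> p; exact: cvg_snd.
have cF : continuous (fun p : R * plane R =>
    pdist ((X p.1 p.2).1 - p.2.1) + pdist ((X p.1 p.2).2 - p.2.2)).
  apply: ctsD; (apply: cts_comp; first exact: cts_pdist); apply: ctsB.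
  - exact: cts_compT (@cts_fst R) cXF.
  - exact: cts_compT (@cts_fst R) csnd.
  - exact: cts_compT (@cts_snd R) cXF.
  - exact: cts_compT (@cts_snd R) csnd.
have cK : compact ([set` `[tau, L]] `*` fast c).
  by apply: compact_setX; [exact: segment_compact|exact: compact_fast].
have [|c' c'0 H] := compact_positive cK cF.
  move=> [t x] /= []; rewrite in_itv/= => /andP[taut _] [_ cx].
  rewrite lt_neqAle addr_ge0 ?pdist_ge0// andbT eq_sym; apply/eqP => E.
  have [E1 E2] : pdist ((X t x).1 - x.1) = 0 /\ pdist ((X t x).2 - x.2) = 0.
    by have := pdist_ge0 ((X t x).1 - x.1); have := pdist_ge0 ((X t x).2 - x.2); lra.
  have [k1 F1] := pdist_eq0 E1; have [k2 F2] := pdist_eq0 E2.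
  apply: (no_closed (k := (k1, k2)) (lt_le_trans tau0 taut)) => [bx0|].
    by move: cx; rewrite bx0 normr0 leNgt c0.
  rewrite [LHS]surjective_pairing [RHS]surjective_pairing; congr pair => /=; lra.
exists c' => // y t cy tL; have [k sqk] := reduce_unit_square y.
have := H (t, y + zvec R k); rewrite /= (flow_periodic K0 b_lip hX b_per)/=.
have E (p q r : R) : p + r - (q + r) = p - q by ring.
rewrite !E; apply.
by split; [rewrite /= in_itv|split; rewrite ?b_per].
Qed.

(** Both visits are compared with the orbit of the centre [x]: the Lipschitz constant
    [2 exp (2 K L)] of the flow acts on an error [2 e] at the first visit, and the second visit adds
    [2 e]. *)
Lemma visit_dist x x' z e L s s' : 0 <= s -> s <= s' -> s' <= L ->
  pdist ((X s z).1 - x.1) <= e -> pdist ((X s z).2 - x.2) <= e ->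
  pdist ((X s' z).1 - x'.1) <= e -> pdist ((X s' z).2 - x'.2) <= e ->
  exists k, `|X (s' - s) x - (x' + zvec R k)| <= (4 * expR (2 * K * L) + 2) * e.
Proof.
move=> s0 ss' sL p1 p2 q1 q2.
have [k h] := pdist_near p1 p2; have [l h'] := pdist_near q1 q2.
have e0 : 0 <= e by apply: le_trans p1; exact: pdist_ge0.
exists (l.1 - k.1, l.2 - k.2).
have -> : X (s' - s) x - (x' + zvec R (l.1 - k.1, l.2 - k.2)) =
    (X s' z - (x' + zvec R l)) - (X (s' - s) (X s z) - X (s' - s) (x + zvec R k)).
  rewrite -(flow_add K0 b_lip hX) subrK (flow_periodic K0 b_lip hX b_per).
  rewrite (zvecD R l (- k.1, - k.2)) zvecN.
  case: (X (s' - s) x) (X s' z) => [a1 a2] [c1 c2]; case: x' {q1 q2 h'} => d1 d2.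
  by congr pair => /=; ring.
apply: le_trans (ler_normB _ _) _; rewrite mulrDl addrC; apply: lerD => //.
apply: le_trans (flow_space_lip K0 b_lip hX _ _ _) _.
rewrite (ger0_norm (_ : 0 <= s' - s)) ?subr_ge0//.
have E : expR (2 * K * (s' - s)) <= expR (2 * K * L).
  rewrite ler_expR ler_pM2l ?mulr_gt0//; lra.
have := ler_pM (ltW (expR_gt0 (2 * K * (s' - s)))) (normr_ge0 _) E h.
lra.
Qed.

Definition small_support (e : R) x f := forall z, f z != 0 ->
  pdist (z.1 - x.1) <= e /\ pdist (z.2 - x.2) <= e.

(** During [[0, L]] an orbit meets the square in a single passage of length at most [16 e / c]: a
    visit later than [tau] after another would bring the orbit of the centre back within [O(e)] of
    itself. The average is then at most [16 e / (c L)] times the total mass, and [L] is chosen large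
    compared with [1 / eta]. *)
Lemma ball_small (c eta : R) : 0 < c -> 0 < eta -> exists2 e0 : R, 0 < e0 &
  forall e x f, 0 < e -> e < e0 -> c <= `|b x| -> C0_per f ->
    (forall z, 0 <= f z <= 1) -> small_support e x f -> M f <= eta * e.
Proof.
move=> c0 eta0.
have c2 : 0 < c / 2 by rewrite divr_gt0.
have [tau tau0 Hpass] := pass_flow c2.
have m0 : 0 <= m := m_ge0 M_pos.
pose L := 16 / c * (m + 1) / eta + 1.
have L0 : 0 < L.
  rewrite ltr_wpDl// divr_ge0 ?(ltW eta0)// mulr_ge0 ?addr_ge0//.
  by rewrite divr_ge0 ?(ltW c0).
have [kap kap0 Hret] := no_return L c0 tau0.
pose Q := 4 * expR (2 * K * L) + 2.
have Q0 : 0 < Q by rewrite ltr_wpDl// mulr_ge0// expR_ge0.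
(* The first bound keeps [b] within [c / 2] of [b x] on the square; the second makes the distance
   given by [visit_dist] smaller than [no_return] allows. *)
exists (Num.min (c / 2 / (2 * K)) (kap / (16 * Q))).
  by rewrite lt_min !divr_gt0 ?mulr_gt0.
move=> e x f e0; rewrite lt_min => /andP[]; rewrite ltr_pdivlMr ?mulr_gt0// => ec.
rewrite ltr_pdivlMr ?mulr_gt0// => ekap cx pf f01 fsup.
have H z s s' : 0 <= s -> s <= s' -> s' <= L -> f (X s z) != 0 ->
    f (X s' z) != 0 -> s' - s <= 16 * e / c.
  move=> s0 ss' sL /fsup[p1 p2] /fsup[q1 q2].
  have [st|st] := leP (s' - s) tau.
    have [k hk] := pdist_near p1 p2.
    have bb : `|b (X s z) - b x| <= c / 2.
      rewrite -(b_per k x); apply: le_trans (b_lip _ _) _.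
      apply: (@le_trans _ _ (K * (2 * e))); first by rewrite ler_pM2l.
      by have := ec; lra.
    have [H1 H2] : `|(b x).1| - `|(b (X s z)).1| <= c / 2 /\ `|(b x).2| - `|(b (X s z)).2| <= c / 2.
      rewrite distrC in bb; split; apply: le_trans (lerB_dist _ _) _; apply: le_trans bb.
        exact: norm_fstB.
      exact: norm_sndB.
    have -> : 16 * e / c = 8 * e / (c / 2) by field; rewrite gt_eqF.
    move: cx; rewrite plane_norm le_max => /orP[cx|cx].
      by have [h _] := Hpass z s s' x.1 e ss' st; apply: h => //; lra.
    by have [_ h] := Hpass z s s' x.2 e ss' st; apply: h => //; lra.
  exfalso.
  have [k hk] := visit_dist s0 ss' sL p1 p2 q1 q2.
  have := Hret x (s' - s) cx; rewrite (ltW st) => /(_ _)/wrap[]; first by lra.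
  have P1 : pdist ((X (s' - s) x).1 - x.1) <= 4 * (Q * e).
    rewrite -(pdistDz _ (- k.1)) intrN; apply: le_trans (pdist_le _) _.
    rewrite ler_pM2l//; apply: le_trans hk; have := norm_fst (X (s' - s) x - (x + zvec R k)).
    by rewrite /= opprD addrA.
  have P2 : pdist ((X (s' - s) x).2 - x.2) <= 4 * (Q * e).
    rewrite -(pdistDz _ (- k.2)) intrN; apply: le_trans (pdist_le _) _.
    rewrite ler_pM2l//; apply: le_trans hk; have := norm_snd (X (s' - s) x - (x + zvec R k)).
    by rewrite /= opprD addrA.
  by rewrite leNgt => /negP; apply; lra.
have e16 : 0 <= 16 * e / c by rewrite divr_ge0 ?mulr_ge0 ?ltW.
have := average_bound pf f01 L0 e16 H; rewrite mul1r => h; apply: le_trans h _.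
rewrite mulrAC ler_pdivrMr// /L.
have -> : eta * e * (16 / c * (m + 1) / eta + 1) = 16 * e / c * m + (16 * e / c + eta * e).
  by field; rewrite !gt_eqF.
by rewrite lerDl addr_ge0// mulr_ge0// ltW.
Qed.

End Recurrence.

(** * Oscillation of the stream function along orbits and transversals *)

Section Oscillation.
Variables (R : realType) (b : plane R -> plane R) (K B : R).
Hypothesis K0 : 0 < K.
Hypothesis b_lip : forall x y, `|b x - b y| <= K * `|x - y|.
Hypothesis B0 : 0 < B.
Hypothesis b_bnd : forall x, `|b x| <= B.
Hypothesis b_per : Defs.periodic b.
Variable X : R -> plane R -> plane R.
Hypothesis hX : is_flow b X.
Hypothesis no_closed : forall y (T : R) k, 0 < T -> b y <> 0 -> X T y <> y + zvec R k.
Variables lam M : (plane R -> R) -> R.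
Hypothesis lam_lin : linear_functional lam.
Hypothesis lam_inv : invariant_functional X lam.
Hypothesis M_lin : linear_functional M.
Hypothesis M_pos : positive_functional M.
Hypothesis M_inv : invariant_functional X M.
Hypothesis lam_le : forall f, C0_per f -> `|lam f| <= M (fun z => `|f z|).
Hypothesis flux1 : lam (fun z => (b z).1) = 0.
Hypothesis flux2 : lam (fun z => (b z).2) = 0.
Implicit Types (x y z : plane R) (s t e : R) (f g : plane R -> R).
Implicit Types (D d : R -> R).

Let m := M (fun=> 1).
Let m0 : 0 <= m. Proof. exact: (m_ge0 M_pos). Qed.
Let psi D d x := stream b lam D d x.
Let pb1 : C0_per (fun z => (b z).1). Proof. exact: (C0_per_b1 K0 b_lip b_per). Qed.
Let pb2 : C0_per (fun z => (b z).2). Proof. exact: (C0_per_b2 K0 b_lip b_per). Qed.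

Lemma mollifier_facts e D d d' : mollifier e D d d' ->
  [/\ continuous d, int_periodic d, forall t, 0 <= d t <= 16 / e,
     (forall s t, s <= t -> D s <= D t) & continuous D].
Proof.
move=> [dD dd _ per _]; split.
- by apply: is_derive_continuous => t; exact: (dd t).1.
- by move=> t k; have [] := per t k.
- by move=> t; exact: (dd t).2.
- move=> s t st; apply: (is_derive_nondecreasing st dD) => r _.
  by have [_ /andP[]] := dd r.
- exact: is_derive_continuous dD.
Qed.

Lemma mollifier_near e D d d' (r z1 : R) : mollifier e D d d' -> d (r - z1) != 0 ->
  pdist (z1 - r) <= e.
Proof.
move=> [_ _ _ _ dsup] dn; rewrite pdist_sym leNgt; apply/negP => er.
by move: dn; rewrite dsup ?eqxx// ltW.
Qed.

(** The witness [f] is the kernel divided by its bound [(16 / e)^2], which puts the estimate in the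
    form required by [ball_small]. *)
Lemma mollified_le e D d d' x g (G : R) : 0 < e -> mollifier e D d d' -> C0_per g -> 0 <= G ->
  (forall z, pdist (z.1 - x.1) <= e -> pdist (z.2 - x.2) <= e -> `|g z| <= G) ->
  exists f, [/\ C0_per f, forall z, 0 <= f z <= 1, small_support e x f &
    `|lam (fun z => d (x.1 - z.1) * d (x.2 - z.2) * g z)| <= (16 / e) ^+ 2 * G * M f].
Proof.
move=> e0 mol pg G0 gG; have [cd pd dle _ _] := mollifier_facts mol.
have q0 : 0 < 16 / e by rewrite divr_gt0.
pose f z := (16 / e) ^- 2 * (d (x.1 - z.1) * d (x.2 - z.2)).
have pdd : C0_per (fun z : plane R => d (x.1 - z.1) * d (x.2 - z.2)).
  by apply: C0_perM; [exact: C0_per_slice1|exact: C0_per_slice2].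
have dd0 z : 0 <= d (x.1 - z.1) * d (x.2 - z.2) <= (16 / e) ^+ 2.
  have /andP[h1 h2] := dle (x.1 - z.1); have /andP[h3 h4] := dle (x.2 - z.2).
  by rewrite mulr_ge0//= expr2; apply: ler_pM.
have pf : C0_per f by exact: C0_perZ.
exists f; split=> //.
- move=> z; have /andP[h1 h2] := dd0 z; rewrite /f mulr_ge0 ?invr_ge0 ?sqr_ge0//=.
  by rewrite mulrC ler_pdivrMr ?exprn_gt0// mul1r.
- move=> z; rewrite /f mulf_eq0 negb_or => /andP[_]; rewrite mulf_eq0 negb_or => /andP[h1 h2].
  by split; [exact: mollifier_near mol h1|exact: mollifier_near mol h2].
have [_ MZ] := M_lin; rewrite -MZ//; apply: (lam_le_M M_lin M_pos lam_le).
- exact: C0_perM.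
- exact: C0_perZ.
move=> z; have /andP[h1 h2] := dd0 z.
have -> : (16 / e) ^+ 2 * G * f z = d (x.1 - z.1) * d (x.2 - z.2) * G.
  by rewrite /f; field; rewrite gt_eqF.
rewrite normrM (ger0_norm h1).
have [->|dn] := eqVneq (d (x.1 - z.1) * d (x.2 - z.2)) 0; first by rewrite !mul0r.
apply: ler_wpM2l => //; move: dn; rewrite mulf_eq0 negb_or => /andP[n1 n2].
by apply: gG; [exact: mollifier_near mol n1|exact: mollifier_near mol n2].
Qed.

(** Along the orbit the derivative is a smoothed cross product of [b z] and [b (X s y)]. It vanishes
    at the centre, hence is [O(e)] on the support of the kernel; with a kernel of size [e^-2] and a
    mass [o(e)], the derivative is [o(1)]. *)
Lemma stream_flow (c eta L : R) : 0 < c -> 0 < eta -> 0 <= L ->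
  exists2 e0 : R, 0 < e0 & forall e D d d', 0 < e -> e < e0 -> mollifier e D d d' ->
    forall y T, c <= `|b y| -> 0 <= T <= L -> `|psi D d (X T y) - psi D d y| <= eta.
Proof.
move=> c0 eta0 L0.
have [c' c'0 Hc'] := speed_lower K0 b_lip B0 b_bnd b_per hX L c0.
have KB : 0 < K * B by rewrite mulr_gt0.
have q0 : 0 < 4 * 16 * 16 * (K * B) * (L + 1) by rewrite mulr_gt0 ?mulr_gt0// ltr_wpDl.
have [e0 e00 He0] := ball_small K0 b_lip B0 b_bnd b_per hX no_closed M_lin M_pos M_inv c'0
  (divr_gt0 eta0 q0).
exists e0 => // e D d d' e_gt0 ee0 mol y T cy /andP[T0 TL].
pose G s := lam (fun z => d ((X s y).1 - z.1) * d ((X s y).2 - z.2) *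
  ((b z).1 * (b (X s y)).2 - (b z).2 * (b (X s y)).1)).
have cbX := cts_compT (b_continuous K0 b_lip) (flow_cts_time K0 b_lip B0 b_bnd hX (x := y)).
have dG s : is_derive s 1 (fun r => psi D d ((X r y).1, (X r y).2)) (G s).
  apply: (stream_derive K0 b_lip B0 b_bnd b_per hX lam_lin lam_inv M_lin M_pos lam_le flux1 flux2 mol
    s (is_derive_flow1 hX y) (is_derive_flow2 hX y)).
    exact: cts_compT (@cts_fst R) cbX.
  exact: cts_compT (@cts_snd R) cbX.
have := @derive_bound R _ _ (eta / (L + 1)) 0 T T0 dG.
rewrite -!surjective_pairing (flow0 hX) subr0 => H.
apply: (@le_trans _ _ (eta / (L + 1) * T)); last first.
  by rewrite mulrAC ler_pdivrMr ?ltr_wpDl// ler_pM2l//; lra.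
apply: H => s /andP[s0 sT].
have pg : C0_per (fun z => (b z).1 * (b (X s y)).2 - (b z).2 * (b (X s y)).1).
  by apply: C0_perB; apply: C0_perM; try exact: C0_per_cst;
    [exact: pb1|exact: pb2].
have [|z p1 p2|f [pf f01 fsup]] := @mollified_le e D d d' (X s y) _ (4 * K * B * e) e_gt0 mol pg.
- by rewrite !mulr_ge0// ltW.
- have [k hk] := pdist_near p1 p2.
  have bb : `|b z - b (X s y)| <= K * (2 * e).
    by rewrite -(b_per k (X s y)); apply: le_trans (b_lip _ _) _; rewrite ler_pM2l.
  have -> : (b z).1 * (b (X s y)).2 - (b z).2 * (b (X s y)).1 =
     ((b z).1 - (b (X s y)).1) * (b (X s y)).2 - ((b z).2 - (b (X s y)).2) * (b (X s y)).1 by ring.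
  apply: le_trans (ler_normB _ _) _; rewrite !normrM.
  have h1 := ler_pM (normr_ge0 _) (normr_ge0 _) (le_trans (norm_fstB (b z) (b (X s y))) bb)
    (le_trans (norm_snd (b (X s y))) (b_bnd _)).
  have h2 := ler_pM (normr_ge0 _) (normr_ge0 _) (le_trans (norm_sndB (b z) (b (X s y))) bb)
    (le_trans (norm_fst (b (X s y))) (b_bnd _)).
  by lra.
move=> h; apply: le_trans h _.
have Mf : M f <= eta / (4 * 16 * 16 * (K * B) * (L + 1)) * e.
  by apply: (He0 _ (X s y)) => //; apply: Hc' => //; rewrite s0 (le_trans sT).
apply: le_trans (ler_wpM2l _ Mf) _; first by rewrite !mulr_ge0 ?invr_ge0 ?ltW.
rewrite le_eqVlt; apply/orP; left; apply/eqP; field.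
by rewrite !gt_eqF// ltr_wpDl.
Qed.

(** Here the integrand has no cancellation, but the length of the segment supplies the factor [e].
    The squares met along the segment all lie in the one of size [(1 + 4 C1) e] around [x0], so
    speed is needed at [x0] only. *)
Lemma stream_modulus (c eta C1 : R) : 0 < c -> 0 < eta -> 0 <= C1 ->
  exists2 e0 : R, 0 < e0 & forall e D d d', 0 < e -> e < e0 -> mollifier e D d d' ->
    forall x0 x, c <= `|b x0| -> `|x - x0| <= C1 * e -> `|psi D d x - psi D d x0| <= eta.
Proof.
move=> c0 eta0 C10.
have q0 : 0 < 2 * 16 * 16 * B * C1 * (1 + 4 * C1) + 1.
  by rewrite ltr_wpDl// !mulr_ge0 ?addr_ge0 ?mulr_ge0// ltW.
have C4 : 0 < 1 + 4 * C1 by rewrite ltr_pwDl// mulr_ge0.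
have [e0 e00 He0] := ball_small K0 b_lip B0 b_bnd b_per hX no_closed M_lin M_pos M_inv c0
  (divr_gt0 eta0 q0).
exists (e0 / (1 + 4 * C1)); first exact: divr_gt0.
move=> e D d d' e_gt0; rewrite ltr_pdivlMr// mulrC => ee0 mol x0 x cx0 xx0.
pose v := x - x0.
pose G s := lam (fun z => d (x0.1 + s * v.1 - z.1) * d (x0.2 + s * v.2 - z.2) *
  ((b z).1 * v.2 - (b z).2 * v.1)).
have dG s : is_derive s 1 (fun r => psi D d (x0.1 + r * v.1, x0.2 + r * v.2)) (G s).
  apply: (stream_derive K0 b_lip B0 b_bnd b_per hX lam_lin lam_inv M_lin M_pos lam_le flux1 flux2 mol
    s (fun t => deriveR_affine x0.1 v.1 t) (fun t => deriveR_affine x0.2 v.2 t)); exact: cts_cst.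
have := @derive_bound R _ _ eta 0 1 ler01 dG.
rewrite !mul0r !mul1r !addr0 subr0 mulr1 -surjective_pairing.
have -> : (x0.1 + v.1, x0.2 + v.2) = x.
  by rewrite /v; case: x x0 {xx0 v G dG cx0} => [x1 x2] [y1 y2] /=; congr pair; ring.
apply=> s /andP[s0 s1].
have pg : C0_per (fun z => (b z).1 * v.2 - (b z).2 * v.1).
  by apply: C0_perB; apply: C0_perM; try exact: C0_per_cst;
    [exact: pb1|exact: pb2].
have [|z p1 p2|f [pf f01 fsup]] := @mollified_le e D d d' (x0.1 + s * v.1, x0.2 + s * v.2) _
  (2 * B * (C1 * e)) e_gt0 mol pg.
- by rewrite !mulr_ge0// ltW.
- apply: le_trans (ler_normB _ _) _; rewrite !normrM.
  have h1 := ler_pM (normr_ge0 _) (normr_ge0 _) (le_trans (norm_fst (b z)) (b_bnd _))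
    (le_trans (norm_snd v) xx0).
  have h2 := ler_pM (normr_ge0 _) (normr_ge0 _) (le_trans (norm_snd (b z)) (b_bnd _))
    (le_trans (norm_fst v) xx0).
  by lra.
move=> h; apply: le_trans h _.
have sv (w : R) : `|w| <= C1 * e -> pdist (s * w) <= 4 * (C1 * e).
  move=> wC; apply: le_trans (pdist_le _) _; rewrite ler_pM2l// normrM (ger0_norm s0).
  by apply: le_trans wC; rewrite ler_piMl.
have Mf : M f <= eta / (2 * 16 * 16 * B * C1 * (1 + 4 * C1) + 1) * ((1 + 4 * C1) * e).
  apply: (He0 _ x0) => //; first exact: mulr_gt0.
  move=> z /fsup[/= p1 p2]; split.
    have -> : z.1 - x0.1 = (z.1 - (x0.1 + s * v.1)) + s * v.1 by ring.
    apply: le_trans (pdistD _ _) _.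
    have := sv v.1 (le_trans (norm_fst v) xx0); lra.
  have -> : z.2 - x0.2 = (z.2 - (x0.2 + s * v.2)) + s * v.2 by ring.
  apply: le_trans (pdistD _ _) _.
  have := sv v.2 (le_trans (norm_snd v) xx0); lra.
apply: le_trans (ler_wpM2l _ Mf) _.
  by rewrite !mulr_ge0 ?invr_ge0// ltW.
have gen (p : R) : (16 / e) ^+ 2 * (2 * B * (C1 * e)) * (eta * p * ((1 + 4 * C1) * e)) =
    eta * (2 * 16 * 16 * B * C1 * (1 + 4 * C1)) * p.
  by field; rewrite gt_eqF.
rewrite gen.
by rewrite ler_pdivrMr// ler_pM2l// lerDl.
Qed.

Lemma last_crossing (h : R -> R) (p q c : R) : continuous h -> p <= q -> h p <= c -> c <= h q ->
  exists2 r, p <= r <= q & h r = c /\ forall t, r <= t <= q -> c <= h t.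
Proof.
move=> ch pq hp hq.
pose A : set R := [set` `[p, q]] `&` h @^-1` [set y | y <= c].
have cA : compact A.
  apply: compact_closedI; first exact: segment_compact.
  by apply: closed_comp; [move=> r _; exact: ch|exact: closed_le].
have A0 : A !=set0 by exists p; split=> //=; rewrite in_itv/= lexx.
have cid : continuous (id : R -> R) by move=> r; exact: cvg_id.
have [r rA rmax] := compact_EVT_max A0 cA (continuous_subspaceT cid).
move: rA; rewrite inE => -[/=]; rewrite in_itv/= => /andP[pr rq] hr.
have above t : r < t -> t <= q -> c < h t.
  move=> rt tq; rewrite ltNge; apply/negP => ht.
  have : t \in A by rewrite inE; split=> //=; rewrite in_itv/= tq (le_trans pr (ltW rt)).
  by move=> /rmax; rewrite leNgt rt.
have hrc : h r = c.
  apply/eqP; rewrite eq_le hr /= leNgt; apply/negP => hrc.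
  have [] := @IVT R h r q c rq (continuous_subspaceT ch).
    rewrite ge_min le_max; apply/andP; split; apply/orP; [left|right] => //; exact: ltW.
  move=> t; rewrite in_itv/= => /andP[rt tq] htc.
  have [E|tr] := eqVneq t r; first by move: hrc; rewrite -E htc ltxx.
  have := above t; rewrite lt_neqAle eq_sym tr rt htc ltxx => /(_ isT tq).
  by [].
exists r; first by rewrite pr rq.
split=> // t /andP[rt tq]; have [->|tr] := eqVneq t r; first by rewrite hrc.
by apply: ltW; apply: above => //; rewrite lt_neqAle eq_sym tr.
Qed.

(* Subintervals on which [h] takes pairwise disjoint sets of values, carrying
   most of the increment of [h]. *)
Lemma disjoint_increments (h : R -> R) (v v' gap : R) (n : nat) : continuous h -> v <= v' ->
  0 < gap -> (0 < n)%N ->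
  exists al be : nat -> R, exists W : nat -> R, [/\
    forall i, (i < n)%N -> v + (v' - v) / n%:R * i%:R <= al i /\ al i <= be i /\
       be i <= v + (v' - v) / n%:R * i.+1%:R,
    forall i, (i < n)%N -> al i < be i -> forall r, al i <= r <= be i -> W i + gap <= h r <= W i.+1,
    forall i j, (i <= j)%N -> (j <= n)%N -> W i <= W j &
    h v' - h v - n%:R * gap <= \sum_(i < n) (h (be i) - h (al i))].
Proof.
move=> ch vv' gap0 n0.
have n0' : 0 < n%:R :> R by rewrite ltr0n.
pose p (i : nat) := v + (v' - v) / n%:R * i%:R.
have dp0 : 0 <= (v' - v) / n%:R by rewrite divr_ge0// ?subr_ge0// ltW.
have pm i j : (i <= j)%N -> p i <= p j.
  by move=> ij; rewrite /p lerD2l; apply: ler_wpM2l => //; rewrite ler_nat.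
have p00 : p 0%N = v by rewrite /p mulr0 addr0.
have pn : p n = v' by rewrite /p divfK ?gt_eqF// addrC subrK.
have vp i : v <= p i by rewrite -{1}p00; exact: pm.
(* [h (w i)] is the running maximum of [h] up to the subdivision point [p i]. *)
have /choice[w Hw] : forall i : nat, exists r, v <= r <= p i /\ forall t, v <= t <= p i -> h t <= h r.
  move=> i; have [r + rmax] := EVT_max (vp i) (continuous_subspaceT ch).
  rewrite in_itv/= => rp; exists r; split=> // t tp; apply: rmax; by rewrite in_itv.
have Wm i j : (i <= j)%N -> h (w i) <= h (w j).
  move=> ij; have [/andP[h1 h2] _] := Hw i; have [_] := Hw j; apply.
  by rewrite h1 (le_trans h2)// pm.
have /choice[ab Hab] : forall i : nat, exists ab : R * R,
    [/\ p i <= ab.1, ab.1 <= ab.2, ab.2 <= p i.+1,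
      ab.1 < ab.2 -> forall r, ab.1 <= r <= ab.2 -> h (w i) + gap <= h r <= h (w i.+1) &
      h (w i.+1) - h (w i) - gap <= h ab.2 - h ab.1].
  (* If the running maximum grows by at most [gap], the piece is reduced to a point, at a loss of at
     most [gap]. Otherwise it goes from the last crossing of the level [h (w i) + gap] to the new
     maximum point. *)
  move=> i; have [Wle|Wgt] := leP (h (w i.+1)) (h (w i) + gap).
    exists (p i, p i); split=> //=; [exact: pm|by rewrite ltxx|].
    by rewrite subrr; lra.
  have [/andP[vw wp] wmax] := Hw i.+1.
  have piw : p i <= w i.+1.
    rewrite leNgt; apply/negP => wpi; have [_ /(_ (w i.+1))] := Hw i.
    rewrite vw (ltW wpi) => /(_ isT); lra.
  have hpi : h (p i) <= h (w i) + gap.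
    have [_ /(_ (p i))] := Hw i; rewrite vp lexx => /(_ isT); lra.
  have [r /andP[pr rw] [hr above]] := last_crossing ch piw hpi (ltW Wgt).
  exists (r, w i.+1); split=> //=; last by rewrite hr; lra.
  move=> _ t /andP[rt tw]; rewrite above ?rt//=; apply: wmax.
  by rewrite (le_trans (vp i))// ?(le_trans pr)//= (le_trans tw).
exists (fun i => (ab i).1), (fun i => (ab i).2), (fun i => h (w i)); split.
- by move=> i _; have [h1 h2 h3 _ _] := Hab i.
- by move=> i _; have [_ _ _ h4 _] := Hab i.
- by move=> i j ij _; exact: Wm.
have sumle : \sum_(i < n) (h (w i.+1) - h (w i) - gap) <= \sum_(i < n) (h (ab i).2 - h (ab i).1).
  by apply: ler_sum => i _; have [] := Hab i.
apply: le_trans sumle; rewrite sumrB sumr_const card_ord mulr_natl lerD2r.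
rewrite -(big_mkord predT (fun i => h (w i.+1) - h (w i))) telescope_sumr//.
have hv : h (w 0%N) <= h v.
  have [/andP[h1 h2] _] := Hw 0%N; rewrite (_ : w 0%N = v)//.
  by apply/eqP; rewrite eq_le h1 andbT -[X in _ <= X]p00.
have hv' : h v' <= h (w n) by have [_] := Hw n; apply; rewrite vv' pn lexx.
lra.
Qed.

Let cts_plateau e D d d' (l : R) : mollifier e D d d' ->
  continuous (fun t => D (l + t) - D t) /\ int_periodic (fun t => D (l + t) - D t).
Proof.
move=> mol; have [_ _ _ _ cD] := mollifier_facts mol; split.
  apply: ctsB => //; apply: cts_comp cD _.
  by apply: ctsD; [exact: cts_cst|move=> t; exact: cvg_id].
case: mol => _ _ _ per _ t k; rewrite addrA.
by have [-> _ _] := per (l + t) k; have [-> _ _] := per t k; ring.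
Qed.

Let plateauE D (v v' t : R) : D (v' - t) - D (v - t) = D (v' - v + (v - t)) - D (v - t).
Proof. by rewrite addrA subrK. Qed.

Lemma C0_per_plateau e D d d' (v v' : R) : mollifier e D d d' ->
  C0_per (fun z => D (v' - z.2) - D (v - z.2)).
Proof.
move=> /(cts_plateau (v' - v))[ch ph]; under [X in C0_per X]eq_fun do rewrite plateauE.
exact: (C0_per_slice2 v ch ph).
Qed.

Lemma C0_per_plateau1 e D d d' (v v' : R) : mollifier e D d d' ->
  C0_per (fun z => D (v' - z.1) - D (v - z.1)).
Proof.
move=> /(cts_plateau (v' - v))[ch ph]; under [X in C0_per X]eq_fun do rewrite plateauE.
exact: (C0_per_slice1 v ch ph).
Qed.

Lemma plateau_near e D d d' (v v' t : R) : mollifier e D d d' -> v <= v' ->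
  D (v' - t) - D (v - t) != 0 -> v < v' /\ exists2 r, v <= r <= v' & pdist (t - r) <= e.
Proof.
move=> mol vv' Dn; have [dD _ _ _ _] := mol.
have vt : v - t <= v' - t by rewrite lerD2r.
have [c /andP[vc cv] E] := mean_value vt dD.
move: Dn; rewrite E mulf_eq0 negb_or => /andP[dn]; rewrite subr_eq0 => ne.
split; first by rewrite lt_neqAle vv' andbT; apply: contraNneq ne => ->.
exists (c + t); first by apply/andP; split; lra.
by rewrite -(addrK t c) in dn; exact: mollifier_near mol dn.
Qed.

Lemma dist_in_le (al be r r' l : R) : al <= r <= be -> al <= r' <= be -> be - al <= l ->
  `|r' - r| <= l.
Proof.
by move=> /andP[? ?] /andP[? ?] ?; rewrite ler_norml; apply/andP; split; lra.
Qed.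

Lemma return_too_small (kap Q e p1 p2 l : R) : p1 <= 4 * (Q * e) ->
  p2 <= 4 * (Q * e) + 4 * l -> e * (16 * Q) < kap -> 4 * l < kap / 2 -> p1 + p2 < kap.
Proof. lra. Qed.

Lemma gap_contradiction (h h' g w w'' : R) : `|h - h'| < g -> w + g <= h' -> h <= w'' ->
  w'' <= w -> False.
Proof. by rewrite ltr_norml => /andP[? _] ? ? ?; lra. Qed.

(** The order of choices is essential: [L] from [eta], then [kap] from [L], the number [n] of
    subarcs from [kap], [gap] from [n], and [e] last. Selecting subarcs with separated values loses
    [n gap = eta / 2] of the increment, while the flux through them is less than [eta / 2] by the
    choice of [L]. *)
Lemma stream_osc (c eta : R) : 0 < c -> 0 < eta ->
  exists2 e0 : R, 0 < e0 & forall e D d d', 0 < e -> e < e0 -> mollifier e D d d' ->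
    forall a v v', v <= v' -> v' <= v + 1 ->
      (forall r, v <= r <= v' -> c <= `|(b (a, r)).1|) ->
      `|psi D d (a, v') - psi D d (a, v)| <= eta.
Proof.
move=> c0 eta0.
have c2 : 0 < c / 2 by rewrite divr_gt0.
have [tau tau0 Hpass] := pass_flow K0 b_lip B0 b_bnd hX c2.
pose L := 2 * 16 * 16 * B * (m + 1) / (c * eta) + 1.
have L0 : 0 < L.
  by rewrite ltr_wpDl// divr_ge0 ?mulr_ge0 ?addr_ge0// ltW.
have [kap kap0 Hret] := no_return K0 b_lip B0 b_bnd b_per hX no_closed L c0 tau0.
pose n := (Num.truncn (8 / kap)).+1.
have n0 : (0 < n)%N by [].
have nR : 0 < n%:R :> R by rewrite ltr0n.
have nkap : 8 < kap * n%:R by rewrite mulrC -ltr_pdivrMr//; exact: truncnS_gt.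
pose gap := eta / (2 * n%:R).
have gap0 : 0 < gap by rewrite divr_gt0// mulr_gt0.
pose Q := 4 * expR (2 * K * L) + 2.
have Q0 : 0 < Q by rewrite ltr_wpDl// mulr_ge0// expR_ge0.
have gap4 : 0 < gap / 4 by rewrite divr_gt0.
have [e1 e10 He1] := stream_flow c0 gap4 (ltW L0).
have [e2 e20 He2] := stream_modulus c0 gap4 (ltW Q0).
exists (Num.min (Num.min e1 e2) (Num.min (c / (4 * K)) (kap / (16 * Q)))).
  by rewrite !lt_min e10 e20 !divr_gt0// mulr_gt0.
move=> e D d d' e0; rewrite !lt_min => /andP[/andP[ee1 ee2] /andP[]].
rewrite ltr_pdivlMr ?mulr_gt0// => ec; rewrite ltr_pdivlMr ?mulr_gt0// => ekap mol a v v' vv' v'1 bc.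
have [cd pd dle Dm cD] := mollifier_facts mol.
(* The sign reduces both inequalities to the exclusion of a large positive increment, the only kind
   that the running maximum captures. *)
suff one_sided sg : `|sg| = 1 -> sg * psi D d (a, v') - sg * psi D d (a, v) <= eta.
  rewrite ler_norml; apply/andP; split.
    by have := one_sided (-1); rewrite normrN normr1 => /(_ erefl); lra.
  by have := one_sided 1; rewrite normr1 => /(_ erefl); lra.
move=> sg1; rewrite leNgt; apply/negP => big.
pose h (r : R) := sg * psi D d (a, r).
have vert r r' : h r' - h r = sg * lam (fun z => (b z).1 * (d (a - z.1) * (D (r' - z.2) - D (r - z.2)))).
  rewrite /h -mulrBr; congr (_ * _).
  exact: (stream_vertical K0 b_lip B0 b_bnd b_per hX lam_lin lam_inv M_lin M_pos lam_le flux1 mol).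
have ch : continuous h.
  have dh (s : R) : exists l : R, is_derive s 1 (fun r => psi D d (a, r)) l.
    eexists; apply: (stream_derive K0 b_lip B0 b_bnd b_per hX lam_lin lam_inv M_lin M_pos lam_le
      flux1 flux2 mol s (c1 := fun=> a) (c2 := id) (c1' := fun=> 0) (c2' := fun=> 1)).
    - exact: cts_cst.
    - exact: cts_cst.
  have [l hl] := choice dh.
  by apply: ctsM; [exact: cts_cst|exact: is_derive_continuous hl].
have [al [be [W [Hp Hval Wm Hsum]]]] := disjoint_increments ch vv' gap0 n0.
have dp0 : 0 <= (v' - v) / n%:R by rewrite divr_ge0// ?subr_ge0// ltW.
have in_vv' i r : (i < n)%N -> al i <= r <= be i -> v <= r <= v'.
  move=> iin /andP[h1 h2]; have [h3 [h4 h5]] := Hp i iin; apply/andP; split.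
    apply: le_trans h1; apply: le_trans h3; rewrite lerDl mulr_ge0//.
  apply: le_trans h2 _; apply: le_trans h5 _.
  have E : v + (v' - v) / n%:R * n%:R = v' by rewrite divfK ?gt_eqF// addrC subrK.
  by rewrite -[X in _ <= X]E lerD2l; apply: ler_wpM2l => //; rewrite ler_nat.
pose Psi i z := d (a - z.1) * (D (be i - z.2) - D (al i - z.2)).
pose Ps z := \sum_(i < n) Psi i z.
have pPsi i : C0_per (Psi i).
  apply: C0_perM; first exact: C0_per_slice1.
  exact: C0_per_plateau mol.
have pPs : C0_per Ps by exact: C0_per_sum.
have Psi0 i z : (i < n)%N -> 0 <= Psi i z.
  move=> iin; have [_ [h4 _]] := Hp i iin; have /andP[d0 _] := dle (a - z.1).
  by rewrite mulr_ge0// subr_ge0 Dm// lerD2r.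
(* The plateaux add up to at most the increment of [D] over [[v, v']], which is at most 1 because
   [v' <= v + 1]. The bound therefore does not grow with [n]. *)
have Ps_bound z : 0 <= Ps z <= 16 / e.
  rewrite sumr_ge0/=; last by move=> i _; exact: Psi0.
  rewrite /Ps -mulr_sumr.
  have /andP[d0 d1] := dle (a - z.1).
  apply: (@le_trans _ _ (16 / e * 1)); last by rewrite mulr1.
  apply: ler_pM => //.
    by apply: sumr_ge0 => i _; have [_ [h4 _]] := Hp i (ltn_ord i); rewrite subr_ge0 Dm// lerD2r.
  pose q (i : nat) := v + (v' - v) / n%:R * i%:R.
  apply: (@le_trans _ _ (\sum_(i < n) (D (q i.+1 - z.2) - D (q i - z.2)))).
    apply: ler_sum => i _; have [h3 [h4 h5]] := Hp i (ltn_ord i).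
    by apply: lerB; apply: Dm; rewrite lerD2r.
  rewrite -(big_mkord predT (fun i => D (q i.+1 - z.2) - D (q i - z.2))) telescope_sumr//.
  rewrite /q mulr0 addr0 divfK ?gt_eqF// (addrC v) subrK.
  have : D (v' - z.2) <= D (v - z.2 + 1%:~R) by apply: Dm; lra.
  by case: mol => _ _ _ /(_ (v - z.2) 1)[-> _ _] _; lra.
have support i z : (i < n)%N -> Psi i z != 0 -> exists2 r, al i <= r <= be i &
    [/\ al i < be i, pdist (z.1 - a) <= e & pdist (z.2 - r) <= e].
  move=> iin; rewrite mulf_eq0 negb_or => /andP[dn Dn].
  have [_ [h4 _]] := Hp i iin.
  have [lt_ab [r rr pr]] := plateau_near mol h4 Dn.
  by exists r => //; split=> //; exact: mollifier_near mol dn.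
have some_i z : Ps z != 0 -> exists2 i, (i < n)%N & Psi i z != 0.
  move=> Pn; apply: contrapT => H; move/eqP: Pn; apply.
  rewrite /Ps big1// => i _; apply/eqP/negPn/negP => Pi.
  by apply: H; exists i => //; exact: ltn_ord.
have once z s s' : 0 <= s -> s <= s' -> s' <= L -> Ps (X s z) != 0 -> Ps (X s' z) != 0 ->
    s' - s <= 16 * e / c.
  move=> s0 ss' sL /some_i[i iin /(support _ _ iin)[r rr [ab p1 p2]]].
  move=> /some_i[j jn /(support _ _ jn)[r' rr' [ab' q1 q2]]].
  have br := bc r (in_vv' i r iin rr); have br' := bc r' (in_vv' j r' jn rr').
  have [st|st] := leP (s' - s) tau.
    have [k hk] := @pdist_near R (a, r) (X s z) e p1 p2.
    have bb : `|b (X s z) - b (a, r)| <= c / 2.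
      rewrite -(b_per k (a, r)); apply: le_trans (b_lip _ _) _.
      apply: (@le_trans _ _ (K * (2 * e))); first by rewrite ler_pM2l.
      by move: ec; lra.
    have H1 : `|(b (a, r)).1| - `|(b (X s z)).1| <= c / 2.
      rewrite distrC in bb; apply: le_trans (lerB_dist _ _) _; apply: le_trans bb.
      exact: norm_fstB.
    have -> : 16 * e / c = 8 * e / (c / 2) by field; rewrite gt_eqF.
    by have [h1 _] := Hpass z s s' a e ss' st; apply: h1 => //; move: H1 br; lra.
  exfalso.
  (* Late return: the orbit issued from [(a, r)] itself comes close to a translate of [(a, r')], so
     the stream function takes nearly the same value at both points. *)
  have [k hk] := visit_dist K0 b_lip b_per hX (x := (a, r)) (x' := (a, r')) s0 ss' sL p1 p2 q1 q2.
  have cbr : c <= `|b (a, r)| by apply: le_trans br _; exact: norm_fst.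
  have cbr' : c <= `|b ((a, r') + zvec R k)|.
    by rewrite b_per; apply: le_trans br' _; exact: norm_fst.
  have sL' : 0 <= s' - s <= L.
    by rewrite subr_ge0 ss' lerBlDr (le_trans sL)// lerDl.
  have F1 := He1 e D d d' e0 ee1 mol (a, r) (s' - s) cbr sL'.
  have F2 := He2 e D d d' e0 ee2 mol _ _ cbr' hk.
  have hh : `|h r - h r'| < gap.
    rewrite /h -mulrBr normrM sg1 mul1r.
    have E : psi D d ((a, r') + zvec R k) = psi D d (a, r').
      exact: (stream_periodic b lam mol).
    rewrite -/(psi D d _) -/(psi D d _) in F1 F2.
    rewrite -/(psi D d _) E in F2.
    have -> : psi D d (a, r) - psi D d (a, r') = (psi D d (X (s' - s) (a, r)) - psi D d (a, r'))
      - (psi D d (X (s' - s) (a, r)) - psi D d (a, r)) by ring.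
    apply: le_lt_trans (ler_normB _ _) _; apply: le_lt_trans (lerD F2 F1) _; move: gap0; lra.
  have [ij|ji|E] := ltngtP i j.
  - have /andP[_ h1] := Hval i iin ab r rr; have /andP[h2 _] := Hval j jn ab' r' rr'.
    have h3 := Wm i.+1 j ij (ltnW jn).
    by apply: gap_contradiction hh h2 h1 h3.
  - have /andP[h2 _] := Hval i iin ab r rr; have /andP[_ h1] := Hval j jn ab' r' rr'.
    have h3 := Wm j.+1 i ji (ltnW iin).
    by rewrite distrC in hh; apply: gap_contradiction hh h2 h1 h3.
  rewrite -E in rr'; have [h3 [h4 h5]] := Hp i iin.
  have rr1 : `|r' - r| <= n%:R^-1.
    have : be i - al i <= n%:R^-1.
      have : (v' - v) / n%:R <= n%:R^-1.
        by rewrite ler_pdivrMr// mulVf ?gt_eqF//; move: v'1; lra.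
      move: h5 h3; rewrite -natr1 mulrDr mulr1; lra.
    by move=> h6; exact: dist_in_le rr rr' h6.
  have n4 : 4 * n%:R^-1 < kap / 2.
    by rewrite ltr_pdivrMr//; move: nkap; lra.
  have := Hret (a, r) (s' - s) cbr; rewrite (ltW st) => /(_ _)/wrap[]; first by move: s0 sL; lra.
  have P1 : pdist ((X (s' - s) (a, r)).1 - a) <= 4 * (Q * e).
    rewrite -(pdistDz _ (- k.1)) intrN; apply: le_trans (pdist_le _) _.
    rewrite ler_pM2l//; apply: le_trans hk.
    have := norm_fst (X (s' - s) (a, r) - ((a, r') + zvec R k)).
    by rewrite /= opprD addrA.
  have P2 : pdist ((X (s' - s) (a, r)).2 - r') <= 4 * (Q * e).
    rewrite -(pdistDz _ (- k.2)) intrN; apply: le_trans (pdist_le _) _.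
    rewrite ler_pM2l//; apply: le_trans hk.
    have := norm_snd (X (s' - s) (a, r) - ((a, r') + zvec R k)).
    by rewrite /= opprD addrA.
  have P3 : pdist ((X (s' - s) (a, r)).2 - r) <= 4 * (Q * e) + 4 * n%:R^-1.
    have -> : (X (s' - s) (a, r)).2 - r = ((X (s' - s) (a, r)).2 - r') + (r' - r) by ring.
    apply: le_trans (pdistD _ _) _; apply: lerD => //.
    by apply: le_trans (pdist_le _) _; rewrite ler_pM2l.
  by rewrite leNgt => /negP; apply; exact: return_too_small P1 P3 ekap n4.
have e16 : 0 <= 16 * e / c by rewrite divr_ge0 ?mulr_ge0 ?ltW.
have MPs := average_bound K0 b_lip b_per hX M_lin M_pos M_inv pPs Ps_bound L0 e16 once.
have total : \sum_(i < n) (h (be i) - h (al i)) <= B * (16 / e * (16 * e / c / L) * m).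
  rewrite (eq_bigr (fun i : 'I_n => sg * lam (fun z => (b z).1 * Psi i z))); last by move=> i _; exact: vert.
  rewrite -mulr_sumr -(functional_sum (index_enum 'I_n) lam_lin (F := fun (i : 'I_n) z => (b z).1 * Psi i z)); last first.
    by move=> i; exact: C0_perM.
  apply: le_trans (ler_norm _) _; rewrite normrM sg1 mul1r.
  apply: (@le_trans _ _ (B * M Ps)); last by rewrite ler_pM2l.
  have [_ MZ] := M_lin; rewrite -MZ//; apply: (lam_le_M M_lin M_pos lam_le).
  - by apply: C0_per_sum => i; exact: C0_perM.
  - exact: C0_perZ.
  move=> z; rewrite -mulr_sumr normrM -/(Ps z).
  have /andP[Ps0 _] := Ps_bound z; rewrite (ger0_norm Ps0).
  by apply: ler_wpM2r => //; apply: le_trans (norm_fst _) (b_bnd _).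
have : B * (16 / e * (16 * e / c / L) * m) < eta / 2.
  have -> : B * (16 / e * (16 * e / c / L) * m) = B * 16 * 16 * m / c / L.
    by field; rewrite !gt_eqF.
  rewrite ltr_pdivrMr// /L [X in _ < X]mulrDr [X in _ < _ + X]mulr1.
  have -> : eta / 2 * (2 * 16 * 16 * B * (m + 1) / (c * eta)) = B * 16 * 16 * m / c + B * 16 * 16 / c.
    by field; rewrite !gt_eqF.
  rewrite -addrA ltrDl addr_gt0 ?divr_gt0// mulr_gt0// mulr_gt0//.
have ngap : n%:R * gap = eta / 2 by rewrite /gap; field; rewrite gt_eqF.
move: Hsum; rewrite ngap => Hsum; have := le_trans Hsum total.
move: big; rewrite /h; lra.
Qed.

(** The flux over the rectangle is the integral in [r] of the fluxes through vertical segments at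
    abscissa [r], that is, of increments of the stream function. *)
Lemma rectangle_le e D d d' (a a' v v' eta : R) : mollifier e D d d' -> a <= a' ->
  (forall r, a <= r <= a' -> `|psi D d (r, v') - psi D d (r, v)| <= eta) ->
  `|lam (fun z => (b z).1 * ((D (a' - z.1) - D (a - z.1)) * (D (v' - z.2) - D (v - z.2))))|
    <= eta * (a' - a).
Proof.
move=> mol aa' Heta; have [cd pd dle Dm cD] := mollifier_facts mol; have [dD _ _ _ _] := mol.
pose P z := D (v' - z.2) - D (v - z.2).
have pP : C0_per P by exact: (C0_per_plateau v v' mol).
pose Th r := lam (fun z => (b z).1 * ((D (r - z.1) - D (a - z.1)) * P z)).
have dTh (r : R) : is_derive r 1 Th (psi D d (r, v') - psi D d (r, v)).
  rewrite (stream_vertical K0 b_lip B0 b_bnd b_per hX lam_lin lam_inv M_lin M_pos lam_le flux1 mol).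
  apply: (lam_derive lam_lin M_lin M_pos lam_le
    (g := fun r z => (b z).1 * ((D (r - z.1) - D (a - z.1)) * P z))
    (g' := fun r z => (b z).1 * (d (r - z.1) * P z))).
  - move=> s z; apply: deriveR_scale.
    have H : is_derive s 1 (fun r => D (r - z.1) - D (a - z.1)) (d (s - z.1)).
      apply: deriveR_eq (deriveR_sub (is_derive_shift_arg (f' := d) (dD (s - z.1)))
        (deriveR_cst (D (a - z.1)) s)) _.
      by rewrite subr0.
    apply: deriveR_eq (deriveR_mul H (deriveR_cst (P z) s)) _.
    by rewrite mulr0 addr0.
  - move=> s; apply: C0_perM => //; apply: C0_perM => //.
    exact: (C0_per_plateau1 a s mol).
  - have csnd (q : plane R -> R) : continuous q -> continuous (fun p : R * plane R => q p.2).
      by move=> cq; apply: cts_compT cq _ => p; exact: cvg_snd.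
    apply: ctsM; first by have [cb1 _] := pb1; exact: (csnd _ cb1).
    apply: ctsM; last by have [cP _] := pP; exact: (csnd _ cP).
    apply: cts_comp cd _; apply: ctsB; first by move=> p; exact: cvg_fst.
    exact: (csnd _ (@cts_fst R)).
  - move=> s; suff [] : C0_per (fun z => (b z).1 * (d (s - z.1) * P z)) by [].
    by apply: C0_perM => //; apply: C0_perM => //; exact: C0_per_slice1.
have := derive_bound aa' dTh Heta.
have -> : Th a = 0.
  rewrite /Th (_ : (fun z => _) = fun=> 0); first exact: functional0.
  by apply/funext => z; rewrite subrr mul0r mulr0.
by rewrite subr0.
Qed.

(** On a fine grid [f] is replaced by its corner values. A square with a nonzero corner value has
    [|b.1| >= c / 2] throughout, so [stream_osc] and [rectangle_le] make its contribution
    arbitrarily small. The grid is fixed before [e], hence the number of squares is harmless. *)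
Lemma lam_b1_zero (c : R) f : 0 < c -> C0_per f -> (forall z, `|(b z).1| <= c -> f z = 0) ->
  lam (fun z => (b z).1 * f z) = 0.
Proof.
move=> c0 pf fc; apply/eqP; rewrite -normr_le0.
apply/ler_addgt0Pl => eta eta0; rewrite addr0.
have [F F0 fF] := periodic_bounded pf.
pose eta1 := eta / (B * m + 1).
have Bm : 0 < B * m + 1 by rewrite ltr_wpDl// mulr_ge0// ltW.
have eta10 : 0 < eta1 by rewrite divr_gt0.
have [del del0 Hdel] := periodic_uniform pf eta10.
(* The first term makes [f] vary by at most [eta1] near a grid square, the second makes [b] vary by
   less than [c / 2] on it. *)
pose N := (Num.truncn (Num.max (16 / del) (2 * K / c))).+1.
have N0 : (0 < N)%N by [].
have NR : 0 < N%:R :> R by rewrite ltr0n.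
have Nmax : Num.max (16 / del) (2 * K / c) < N%:R by exact: truncnS_gt.
move: Nmax; rewrite gt_max => /andP[]; rewrite ltr_pdivrMr// => N1; rewrite ltr_pdivrMr// => N2.
have iN1 : 16 / N%:R < del by rewrite ltr_pdivrMr// mulrC.
have iN2 : K / N%:R < c / 2 by rewrite ltr_pdivrMr//; lra.
pose eta2 := eta1 / (N%:R * N%:R * F).
have eta20 : 0 < eta2 by rewrite divr_gt0// !mulr_gt0.
have c2 : 0 < c / 2 by rewrite divr_gt0.
have [e1 e10 He1] := stream_osc c2 eta20.
pose e := Num.min 1 (Num.min (e1 / 2) (del / 8)).
have e_gt0 : 0 < e by rewrite !lt_min ltr01 !divr_gt0.
have e_le1 : e <= 1 by rewrite ge_min lexx.
have e_e1 : e < e1.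
  apply: (@le_lt_trans _ _ (e1 / 2)); first by rewrite !ge_min lexx orbT.
  by rewrite ltr_pdivrMr//; lra.
have e_del : e <= del / 8 by rewrite !ge_min lexx !orbT.
have [D [d [d' mol]]] := mollifier_exists e_gt0 e_le1.
have [cd pd dle Dm cD] := mollifier_facts mol.
pose q (i : nat) : R := i%:R / N%:R.
have qS i : q i.+1 = q i + N%:R^-1 by rewrite /q -natr1 mulrDl mul1r.
have iN0 : 0 < N%:R^-1 :> R by rewrite invr_gt0.
have qle i : q i <= q i.+1 by rewrite qS lerDl ltW.
(* The products [u i * v j] are smoothed indicators of the grid squares. They form a partition of
   unity, since [D] telescopes over one period. *)
pose u i z := D (q i.+1 - z.1) - D (q i - z.1).
pose v i z := D (q i.+1 - z.2) - D (q i - z.2).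
have pu i : C0_per (u i) by exact: (C0_per_plateau1 _ _ mol).
have pv i : C0_per (v i) by exact: (C0_per_plateau _ _ mol).
have u0 i z : 0 <= u i z by rewrite subr_ge0 Dm// lerD2r.
have v0 i z : 0 <= v i z by rewrite subr_ge0 Dm// lerD2r.
have D1 t : D (q N - t) - D (q 0%N - t) = 1.
  have -> : q N - t = q 0%N - t + 1%:~R by rewrite /q mul0r divff ?gt_eqF//; ring.
  by case: mol => _ _ _ /(_ (q 0%N - t) 1)[-> _ _] _; rewrite addrC addKr.
have su z : \sum_(i < N) u i z = 1.
  rewrite -(big_mkord predT (fun i => u i z)) /u telescope_sumr//.
have sv z : \sum_(i < N) v i z = 1.
  rewrite -(big_mkord predT (fun i => v i z)) /v telescope_sumr//.
have suv z : \sum_(p : 'I_N * 'I_N) u p.1 z * v p.2 z = 1.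
  rewrite -(pair_bigA _ (fun i j : 'I_N => u i z * v j z))/=.
  by rewrite -big_distrlr/= su sv mulr1.
pose fq (p : 'I_N * 'I_N) := f (q p.1, q p.2).
pose g1 z := \sum_(p : 'I_N * 'I_N) (f z - fq p) * (u p.1 z * v p.2 z).
pose g2 z := \sum_(p : 'I_N * 'I_N) fq p * ((b z).1 * (u p.1 z * v p.2 z)).
have E z : (b z).1 * f z = (b z).1 * g1 z + g2 z.
  rewrite /g1 /g2 mulr_sumr -big_split/= -[LHS]mulr1 -(suv z) mulr_sumr.
  by apply: eq_bigr => p _; ring.
have puv (p : 'I_N * 'I_N) : C0_per (fun z => u p.1 z * v p.2 z) by exact: C0_perM.
have pg1 : C0_per g1.
  apply: C0_per_sum => p; apply: C0_perM => //.
  by apply: C0_perB => //; exact: C0_per_cst.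
have pg2 : C0_per g2.
  by apply: C0_per_sum => p; apply: C0_perZ; exact: C0_perM.
have -> : (fun z => (b z).1 * f z) = fun z => (b z).1 * g1 z + g2 z by apply/funext.
have [LD LZ] := lam_lin; rewrite LD//; last exact: C0_perM.
apply: le_trans (ler_normD _ _) _.
have near_uv (p : 'I_N * 'I_N) z : u p.1 z * v p.2 z != 0 -> `|f z - fq p| <= eta1.
  rewrite mulf_eq0 negb_or => /andP[un vn].
  have [_ [r1 /andP[r1a r1b] pr1]] := plateau_near mol (qle p.1) un.
  have [_ [r2 /andP[r2a r2b] pr2]] := plateau_near mol (qle p.2) vn.
  have h (r : R) i : q i <= r -> r <= q i.+1 -> pdist (r - q i) <= 4 * N%:R^-1.
    move=> qr rq; apply: le_trans (pdist_le _) _; rewrite ler_pM2l// ger0_norm ?subr_ge0//.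
    by move: rq; rewrite qS; lra.
  have e4 : e + 4 * N%:R^-1 <= del / 2 by lra.
  have P1 : pdist (z.1 - q p.1) <= e + 4 * N%:R^-1.
    have -> : z.1 - q p.1 = (z.1 - r1) + (r1 - q p.1) by ring.
    by apply: le_trans (pdistD _ _) _; apply: lerD => //; exact: h.
  have P2 : pdist (z.2 - q p.2) <= e + 4 * N%:R^-1.
    have -> : z.2 - q p.2 = (z.2 - r2) + (r2 - q p.2) by ring.
    by apply: le_trans (pdistD _ _) _; apply: lerD => //; exact: h.
  have [k hk] := @pdist_near R (q p.1, q p.2) z _ P1 P2.
  have [_ pf'] := pf; rewrite /fq -(pf' k (q p.1, q p.2)); apply: Hdel.
  by apply: le_trans hk _; lra.
have part1 : `|lam (fun z => (b z).1 * g1 z)| <= B * eta1 * m.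
  rewrite -(M_cst M_lin); apply: (lam_le_M M_lin M_pos lam_le).
  - exact: C0_perM.
  - exact: C0_per_cst.
  move=> z; rewrite normrM; apply: ler_pM => //.
    by apply: le_trans (norm_fst _) (b_bnd _).
  rewrite -[eta1]mulr1 -(suv z) mulr_sumr; apply: le_trans (ler_norm_sum _ _ _) _.
  apply: ler_sum => p _; rewrite normrM (ger0_norm (mulr_ge0 (u0 _ _) (v0 _ _))).
  have [->|uvn] := eqVneq (u p.1 z * v p.2 z) 0; first by rewrite !mulr0.
  by apply: ler_wpM2r; [rewrite mulr_ge0|exact: near_uv].
have part2 : `|lam g2| <= eta1.
  rewrite /g2 (functional_sum (index_enum ('I_N * 'I_N)%type) lam_lin
    (F := fun (p : 'I_N * 'I_N) z => fq p * ((b z).1 * (u p.1 z * v p.2 z)))); last first.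
    by move=> p; apply: C0_perZ; exact: C0_perM.
  apply: le_trans (ler_norm_sum _ _ _) _.
  apply: (@le_trans _ _ (\sum_(p : 'I_N * 'I_N) F * eta2)).
    apply: ler_sum => p _; rewrite LZ; last exact: C0_perM.
    rewrite normrM; have [->|fn] := eqVneq (fq p) 0.
      by rewrite normr0 mul0r mulr_ge0// ltW.
    apply: ler_pM => //; first exact: fF.
    have bq : c < `|(b (q p.1, q p.2)).1|.
      by rewrite ltNge; apply/negP => /fc fE; move/eqP: fn; apply.
    apply: (@le_trans _ _ (eta2 * (q p.1.+1 - q p.1))); last first.
      rewrite qS addrAC subrr add0r ler_piMr ?(ltW eta20)//.
      by rewrite invf_le1// ler1n.
    apply: (rectangle_le mol (qle _)) => r /andP[r1 r2].
    apply: (He1 e D d d' e_gt0 e_e1 mol) => //; first by rewrite qS lerD2l invf_le1// ler1n.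
    move=> s /andP[s1 s2].
    have : `|(b (q p.1, q p.2)).1 - (b (r, s)).1| <= K * N%:R^-1.
      apply: le_trans (norm_fstB _ _) _; apply: le_trans (b_lip _ _) _; rewrite ler_pM2l//.
      move: r2 s2; rewrite !qS => r2 s2.
      apply: norm_plane_le => /=; rewrite ler_norml; apply/andP; split; lra.
    have := lerB_dist (b (q p.1, q p.2)).1 (b (r, s)).1; lra.
  rewrite sumr_const card_prod !card_ord -mulr_natl natrM /eta2.
  rewrite le_eqVlt; apply/orP; left; apply/eqP; field.
  by rewrite !gt_eqF.
apply: le_trans (lerD part1 part2) _.
have -> : B * eta1 * m + eta1 = eta1 * (B * m + 1) by ring.
by rewrite /eta1 divfK// gt_eqF.
Qed.

End Oscillation.

(** * Exchange of the coordinates; approximate indicator of the non-zeros *)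

Section SwapPlane.
Variable R : realType.

Definition swap (x : plane R) : plane R := (x.2, x.1).

Lemma swapK : involutive swap. Proof. by case. Qed.

Lemma norm_swap x : `|swap x| = `|x|.
Proof. by rewrite !plane_norm maxC. Qed.

Lemma swapB x y : swap (x - y) = swap x - swap y.
Proof. by []. Qed.

Lemma cts_swap : continuous swap.
Proof. by apply: cts_pair; [exact: cts_snd|exact: cts_fst]. Qed.

Lemma swapDz x (k : int * int) : swap (x + zvec R k) = swap x + zvec R (k.2, k.1).
Proof. by []. Qed.

Lemma C0_per_swap (f : plane R -> R) : C0_per f -> C0_per (f \o swap).
Proof.
move=> [cf pf]; split; first exact: cts_compT cf cts_swap.
by move=> k x; rewrite /= swapDz pf.
Qed.

End SwapPlane.

Section Swap.
Variables (R : realType) (b : plane R -> plane R) (K B : R).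
Hypothesis K0 : 0 < K.
Hypothesis b_lip : forall x y, `|b x - b y| <= K * `|x - y|.
Hypothesis B0 : 0 < B.
Hypothesis b_bnd : forall x, `|b x| <= B.
Hypothesis b_per : Defs.periodic b.
Variable X : R -> plane R -> plane R.
Hypothesis hX : is_flow b X.
Hypothesis no_closed : forall y (T : R) k, 0 < T -> b y <> 0 -> X T y <> y + zvec R k.
Variables lam M : (plane R -> R) -> R.
Hypothesis lam_lin : linear_functional lam.
Hypothesis lam_inv : invariant_functional X lam.
Hypothesis M_lin : linear_functional M.
Hypothesis M_pos : positive_functional M.
Hypothesis M_inv : invariant_functional X M.
Hypothesis lam_le : forall f, C0_per f -> `|lam f| <= M (fun z => `|f z|).
Hypothesis flux1 : lam (fun z => (b z).1) = 0.
Hypothesis flux2 : lam (fun z => (b z).2) = 0.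
Implicit Types (x y z : plane R) (s t e : R) (f g : plane R -> R).
Implicit Types (D d : R -> R).

Let bs x := swap (b (swap x)).
Let Xs t x := swap (X t (swap x)).
Let lams (f : plane R -> R) := lam (f \o @swap R).
Let Ms (f : plane R -> R) := M (f \o @swap R).

(* Exchanging the two coordinates gives the same statement for the second one. *)
Lemma lam_b2_zero (c : R) f : 0 < c -> C0_per f -> (forall z, `|(b z).2| <= c -> f z = 0) ->
  lam (fun z => (b z).2 * f z) = 0.
Proof.
move=> c0 pf fc.
have bs_lip x y : `|bs x - bs y| <= K * `|x - y|.
  by rewrite /bs -swapB norm_swap; apply: le_trans (b_lip _ _) _; rewrite -swapB norm_swap.
have bs_bnd x : `|bs x| <= B by rewrite norm_swap.
have bs_per : Defs.periodic bs by move=> k x; rewrite /bs swapDz b_per.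
have hXs : is_flow bs Xs.
  move=> x; split; first by rewrite /Xs (flow0 hX) swapK.
  move=> t; apply: is_derive_plane.
    rewrite /bs /Xs swapK; exact: (is_derive_flow2 hX (swap x) t).
  rewrite /bs /Xs swapK; exact: (is_derive_flow1 hX (swap x) t).
have no_closed_s y (T : R) k : 0 < T -> bs y <> 0 -> Xs T y <> y + zvec R k.
  move=> T0 by0 E; apply: (@no_closed (swap y) T (k.2, k.1) T0).
    by move=> b0; apply: by0; rewrite /bs b0.
  by rewrite -[LHS]swapK -/(Xs T y) E.
have lin A : linear_functional A -> linear_functional (fun f : plane R -> R => A (f \o @swap R)).
  move=> [AD AZ]; split=> [g h pg ph|a g pg].
    exact: (AD _ _ (C0_per_swap pg) (C0_per_swap ph)).
  exact: (AZ a _ (C0_per_swap pg)).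
have inv A : invariant_functional X A ->
    invariant_functional Xs (fun f : plane R -> R => A (f \o @swap R)).
  move=> Ai t g pg; rewrite -(Ai t _ (C0_per_swap pg)); congr A.
  by apply/funext => z; rewrite /= /Xs swapK.
have pos : positive_functional Ms.
  by move=> g pg g0; apply: M_pos; [exact: C0_per_swap|move=> z; exact: g0].
have le g : C0_per g -> `|lams g| <= Ms (fun z => `|g z|).
  by move=> pg; exact: (lam_le (C0_per_swap pg)).
have f1 : lams (fun z => (bs z).1) = 0.
  rewrite -flux2; congr lam; apply/funext => z; by rewrite /= /bs swapK.
have f2 : lams (fun z => (bs z).2) = 0.
  rewrite -flux1; congr lam; apply/funext => z; by rewrite /= /bs swapK.
have fc' z : `|(bs z).1| <= c -> (f \o @swap R) z = 0 by move=> h; exact: fc.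
have := lam_b1_zero K0 bs_lip B0 bs_bnd bs_per hXs no_closed_s (lin _ lam_lin) (inv _ lam_inv)
  (lin _ M_lin) pos (inv _ M_inv) le f1 f2 c0 (C0_per_swap pf) fc'.
rewrite /lams => <-; congr lam; apply/funext => z.
by rewrite /= /bs !swapK.
Qed.

(** Soft thresholding: [t] minus its projection on [[- c, c]], a continuous substitute for cutting
    off small values that keeps the sign. *)
Definition threshold (c t : R) := t - Num.max (- c) (Num.min c t).

Lemma cts_threshold (c : R) : continuous (threshold c).
Proof.
have cid : continuous (id : R -> R) by move=> t; exact: cvg_id.
apply: ctsB => //; apply: cts_max; first exact: cts_cst.
by apply: cts_min => //; exact: cts_cst.
Qed.

Lemma threshold_eq0 (c t : R) : `|t| <= c -> threshold c t = 0.
Proof.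
by rewrite ler_norml /threshold => /andP[h1 h2]; rewrite min_r// max_r// subrr.
Qed.

Lemma threshold_sign (c t : R) : 0 < c -> 0 <= t * threshold c t.
Proof.
move=> c0; rewrite /threshold /Num.min; case: ifPn => [ct|]; last rewrite -leNgt => tc.
  rewrite max_r; last by lra.
  by rewrite mulr_ge0; lra.
rewrite /Num.max; case: ifPn => h; first by rewrite subrr mulr0.
by rewrite -leNgt in h; rewrite mulr_le0; lra.
Qed.

Definition speed_gauge (c : R) z :=
  (b z).1 * threshold c (b z).1 + (b z).2 * threshold c (b z).2.

Lemma speed_gauge_ge0 (c : R) z : 0 < c -> 0 <= speed_gauge c z.
Proof. by move=> c0; rewrite addr_ge0// threshold_sign. Qed.

(* Converges boundedly to the indicator of the set of non-zeros of [b]. *)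
Definition moving (c : R) z := speed_gauge c z / (speed_gauge c z + c).

Lemma C0_per_speed_gauge (c : R) : C0_per (speed_gauge c).
Proof.
have p1 := C0_per_b1 K0 b_lip b_per; have p2 := C0_per_b2 K0 b_lip b_per.
have th := fun g => @C0_per_comp R _ g (@cts_threshold c).
by apply: C0_perD; apply: C0_perM => //; exact: th.
Qed.

Lemma C0_per_gauge_inv (c : R) : 0 < c -> C0_per (fun z => (speed_gauge c z + c)^-1).
Proof.
move=> c0; have [cG pG] := C0_per_speed_gauge c; split.
  apply: cts_inv => [z|]; last by apply: ctsD => //; exact: cts_cst.
  by rewrite gt_eqF// ltr_wpDl// speed_gauge_ge0.
by move=> k z; rewrite pG.
Qed.

(** The gauge is built so that [moving c] has the form [b.1 * f1 + b.2 * f2], with each factor [f1],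
    [f2] zero where its own component of [b] is small. Both components of [b lam] then contribute
    nothing. *)
Lemma lam_moving (c : R) : 0 < c -> lam (moving c) = 0.
Proof.
move=> c0; have p1 := C0_per_b1 K0 b_lip b_per; have p2 := C0_per_b2 K0 b_lip b_per.
pose f1 z := threshold c (b z).1 / (speed_gauge c z + c).
pose f2 z := threshold c (b z).2 / (speed_gauge c z + c).
have th := fun g => @C0_per_comp R _ g (@cts_threshold c).
have pi := C0_per_gauge_inv c0.
have pf1 : C0_per f1 by apply: C0_perM => //; exact: th.
have pf2 : C0_per f2 by apply: C0_perM => //; exact: th.
have -> : moving c = fun z => (b z).1 * f1 z + (b z).2 * f2 z.
  by apply/funext => z; rewrite /moving /f1 /f2 {1}/speed_gauge; ring.
have [LD _] := lam_lin; rewrite LD; [|exact: C0_perM|exact: C0_perM].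
rewrite (lam_b1_zero K0 b_lip B0 b_bnd b_per hX no_closed lam_lin lam_inv
  M_lin M_pos M_inv lam_le flux1 flux2 c0 pf1); last first.
  by move=> z /threshold_eq0; rewrite /f1 => ->; rewrite mul0r.
rewrite (lam_b2_zero c0 pf2) ?addr0//.
by move=> z /threshold_eq0; rewrite /f2 => ->; rewrite mul0r.
Qed.

End Swap.

(** * A nonvanishing planar field has no closed orbit *)
Section Angles.
Variable R : realType.
Implicit Types (x y z v w : plane R) (s t a : R).

Definition has_angle v a := exists2 r : R, 0 < r & v = (r * cos a, r * sin a).

Definition cross v w := v.1 * w.2 - v.2 * w.1.

Lemma has_angle_scale v a (c : R) : 0 < c -> has_angle v a -> has_angle (c *: v) a.
Proof.
move=> c0 [r r0 ->]; exists (c * r); first exact: mulr_gt0.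
by rewrite -!mulrA.
Qed.

Lemma has_angleN v a : has_angle v a -> has_angle (- v) (a + pi).
Proof.
move=> [r r0 ->]; exists r => //; rewrite cosDpi sinDpi !mulrN.
by [].
Qed.

(** Angles of one vector agree modulo [2 pi]; the equation [cos = 1] records this without naming the
    integer. *)
Lemma has_angle_diff v a a' : has_angle v a -> has_angle v a' -> cos (a - a') = 1.
Proof.
move=> [r r0 ->] [r' r'0 [E1 E2]].
have e1 := cos2Dsin2 a; have e2 := cos2Dsin2 a'.
have E : r ^+ 2 = r' ^+ 2.
  have : (r * cos a) ^+ 2 + (r * sin a) ^+ 2 = (r' * cos a') ^+ 2 + (r' * sin a') ^+ 2 by rewrite E1 E2.
  by rewrite !exprMn -!mulrDr e1 e2 !mulr1.
have {}E : r = r' by apply/eqP; rewrite -(eqrXn2 (n := 2)) ?E// ltW.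
have rn : r != 0 by rewrite gt_eqF.
move: E1 E2; rewrite -E => /(mulfI rn) Ec /(mulfI rn) Es.
by rewrite cosB Ec Es -!expr2.
Qed.

(** [cross v w / dot v w] is the tangent of the angle from [v] to [w], and a positive [dot] keeps
    that angle in the range of [atan]. *)
Lemma has_angle_step v w a : has_angle v a -> 0 < dot v w ->
  has_angle w (a + atan (cross v w / dot v w)).
Proof.
move=> [r r0 vE] D0; set p := atan _.
have [p1 p2] : - (pi / 2) < p < pi / 2 /\ tan p = cross v w / dot v w := atan_def _.
have c0 : 0 < cos p by apply: cos_gt0_pihalf.
have sE : sin p = cos p * (cross v w / dot v w) by rewrite -p2 /tan mulrCA divff ?gt_eqF// mulr1.
exists (dot v w / (cos p * r)); first by rewrite divr_gt0// mulr_gt0.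
rewrite cosD sinD sE [w]surjective_pairing.
have e := cos2Dsin2 a.
have d0 : dot v w != 0 by rewrite gt_eqF.
have cn : cos p != 0 by rewrite gt_eqF.
have rn : r != 0 by rewrite gt_eqF.
have -> : dot v w / (cos p * r) * (cos a * cos p - sin a * (cos p * (cross v w / dot v w))) =
    (dot v w * cos a - sin a * cross v w) / r by field; rewrite cn rn d0.
have -> : dot v w / (cos p * r) * (sin a * cos p + cos a * (cos p * (cross v w / dot v w))) =
    (dot v w * sin a + cos a * cross v w) / r by field; rewrite cn rn d0.
congr pair.
  by transitivity (w.1 * (cos a ^+ 2 + sin a ^+ 2)); [rewrite e mulr1|rewrite /dot /cross vE/=; field].
by transitivity (w.2 * (cos a ^+ 2 + sin a ^+ 2)); [rewrite e mulr1|rewrite /dot /cross vE/=; field].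
Qed.

Lemma polar v : v <> 0 -> exists a, has_angle v a.
Proof.
move=> v0.
have H0 : has_angle (1, 0) 0 by exists 1 => //; rewrite cos0 sin0 !mul1r.
have Hpi : has_angle (-1, 0) pi by exists 1 => //; rewrite cospi sinpi !mul1r.
have H2 : has_angle (0, 1) (pi / 2) by exists 1 => //; rewrite cos_pihalf sin_pihalf !mul1r.
have H3 : has_angle (0, -1) (- (pi / 2)).
  by exists 1 => //; rewrite cosN sinN cos_pihalf sin_pihalf !mul1r.
have [p|p|p] := ltgtP 0 v.1.
- by eexists; apply: has_angle_step H0 _; rewrite /dot/= mul1r mul0r addr0.
- by eexists; apply: has_angle_step Hpi _; rewrite /dot/= mulN1r mul0r addr0 oppr_gt0.
have [q|q|q] := ltgtP 0 v.2.
- by eexists; apply: has_angle_step H2 _; rewrite /dot/= mul1r mul0r add0r.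
- by eexists; apply: has_angle_step H3 _; rewrite /dot/= mulN1r mul0r add0r oppr_gt0.
by exfalso; apply: v0; rewrite [v]surjective_pairing -p -q.
Qed.

Lemma dot_self_gt0 v : v <> 0 -> 0 < dot v v.
Proof.
move=> v0; rewrite /dot -!expr2 lt_neqAle addr_ge0 ?sqr_ge0// andbT eq_sym.
rewrite paddr_eq0 ?sqr_ge0// !sqrf_eq0; apply/negP => /andP[/eqP p /eqP q].
by apply: v0; rewrite [v]surjective_pairing p q.
Qed.

(** If the end values differed, [h] would reach a value at distance [q] from [h 0]. The truncation
    at 1 keeps [q] inside [[0, pi]], where [cos] is strictly decreasing, so [cos q = 1] is
    impossible. *)
Lemma cos_eq1_constant (h : R -> R) (T : R) : 0 <= T -> continuous h ->
  (forall t, 0 <= t <= T -> cos (h t) = 1) -> h T = h 0.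
Proof.
move=> T0 ch h1; apply/eqP/negPn/negP => ne.
have sin0 t : 0 <= t <= T -> sin (h t) = 0.
  by move=> /h1 E; apply: cos1sin0; rewrite E normr1.
pose q := Num.min 1 `|h T - h 0|.
have q0 : 0 < q by rewrite lt_min ltr01 normr_gt0 subr_eq0.
have qh : q <= `|h T - h 0| by rewrite ge_min lexx orbT.
pose c := if h 0 < h T then h 0 + q else h 0 - q.
have [t tT tc] : exists2 t, t \in `[0, T] & h t = c.
  apply: (IVT T0 (continuous_subspaceT ch)).
  rewrite ge_min le_max /c; case: ifPn => [lt|].
    rewrite (ger0_norm (_ : 0 <= h T - h 0)) in qh; last by rewrite subr_ge0 ltW.
    by apply/andP; split; apply/orP; [left|right]; lra.
  rewrite -leNgt => le; rewrite (ler0_norm (_ : h T - h 0 <= 0)) in qh; last by rewrite subr_le0.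
  by apply/andP; split; apply/orP; [right|left]; lra.
rewrite in_itv/= in tT.
have H0T : 0 <= (0 : R) <= T by rewrite lexx.
have cq : cos (h t - h 0) = 1 by rewrite cosB (h1 _ tT) (h1 _ H0T) (sin0 _ tT) mul0r addr0 mulr1.
have {cq}cq : cos q = 1.
  move: cq; rewrite tc /c; case: ifPn => _; first by rewrite addrAC subrr add0r.
  by rewrite addrAC subrr add0r cosN.
have pi1 := @pi_ge2 R.
have q1 : q <= 1 by rewrite ge_min lexx.
have := @ltr_cos R 0 q; rewrite !in_itv/= lexx pi_ge0 (ltW q0) => /(_ isT)/(_ _)/wrap[].
  by lra.
by rewrite cos0 cq ltxx q0.
Qed.

Definition clamp (l r t : R) := Num.max l (Num.min r t).

Lemma cts_clamp l r : continuous (clamp l r).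
Proof.
apply: cts_max; first exact: cts_cst.
by apply: cts_min; [exact: cts_cst|move=> t; exact: cvg_id].
Qed.

Lemma clamp_in l r t : l <= r -> l <= clamp l r t <= r.
Proof. by move=> lr; rewrite le_max lexx/= ge_max lr ge_min lexx. Qed.

Lemma clamp_id l r t : l <= t <= r -> clamp l r t = t.
Proof. by move=> /andP[lt tr]; rewrite /clamp min_r// max_r. Qed.

Lemma cts_atan : continuous (@atan R).
Proof. exact: continuous_atan. Qed.

Lemma uniform_direction (f : plane R -> plane R) (A : R) : continuous f ->
  (forall x, f x <> 0) -> exists2 d : R, 0 < d &
  forall x y, `|x.1| <= A -> `|x.2| <= A -> `|x - y| <= d -> 0 < dot (f x) (f y).
Proof.
move=> cf f0; pose Kq : set (plane R) := [set` `[- A, A]] `*` [set` `[- A, A]].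
have cK : compact Kq by apply: compact_setX; exact: segment_compact.
pose g (p : plane R * plane R) := dot (f p.1) (f p.2).
have cg : continuous g.
  have c1 : continuous (fun p : plane R * plane R => f p.1).
    by apply: cts_compT cf _ => p; exact: cvg_fst.
  have c2 : continuous (fun p : plane R * plane R => f p.2).
    by apply: cts_compT cf _ => p; exact: cvg_snd.
  apply: ctsD; apply: ctsM.
  - exact: cts_compT (@cts_fst R) c1.
  - exact: cts_compT (@cts_fst R) c2.
  - exact: cts_compT (@cts_snd R) c1.
  - exact: cts_compT (@cts_snd R) c2.
have H : \forall d \near 0^'+, Kq `<=` (fun x => forall y, `|x - y| <= d -> 0 < dot (f x) (f y)).
  have /compact_near_coveringP/(_ R (0^'+) (fun d x => forall y, `|x - y| <= d -> 0 < dot (f x) (f y)) _) := cK.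
  apply=> x _; have := cg (x, x) => /cvgrPdist_lt/(_ _ (dot_self_gt0 (f0 x))).
  rewrite -nbhs_ballE => -[/= r r0 Hr].
  exists (ball x (r / 2), [set d | d < r / 2]) => /=.
    split; first by apply: nbhsx_ballx; rewrite divr_gt0.
    by apply: nbhs_right_lt; rewrite divr_gt0.
  move=> [x' d] /= [xx' dr] y x'y.
  have : `|dot (f x) (f x) - g (x', y)| < dot (f x) (f x).
    apply: Hr; split => /=; first by apply: le_ball xx'; rewrite ler_pdivrMr//; lra.
    rewrite -ball_normE/= in xx' *.
    have -> : x - y = (x - x') + (x' - y) by rewrite addrA subrK.
    apply: le_lt_trans (ler_normD _ _) _.
    by apply: (@lt_le_trans _ _ (r / 2 + r / 2)); [apply: ltrD => //; exact: le_lt_trans dr|lra].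
  by rewrite ltr_norml => /andP[_]; rewrite /g/=; lra.
near (0 : R)^'+ => d; exists d; first by [].
have Hd : Kq `<=` (fun x => forall y, `|x - y| <= d -> 0 < dot (f x) (f y)) by near: d.
move=> x y x1 x2; apply: Hd.
by split; rewrite /= in_itv/= -ler_norml.
Unshelve. all: by end_near. Qed.

(** The angle is transported from the origin to [x] along a segment, in steps so short that
    consecutive directions have a positive dot product. Clamping the coordinates makes [th]
    continuous on the whole plane, although it is an angle of [f] only on the square. *)
Lemma angle_lift (f : plane R -> plane R) (A : R) : 0 < A -> continuous f ->
  (forall x, f x <> 0) -> exists th : plane R -> R, continuous th /\
  forall x, `|x.1| <= A -> `|x.2| <= A -> has_angle (f x) (th x).
Proof.
move=> A0 cf f0; have [d d0 Hd] := uniform_direction A cf f0.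
have [a0 Ha0] := polar (f0 0).
pose n := (Num.truncn (A / d)).+1.
have nR : 0 < n%:R :> R by rewrite ltr0n.
have nd : A / n%:R <= d.
  rewrite ler_pdivrMr// mulrC -ler_pdivrMr//; apply: ltW; exact: truncnS_gt.
pose pt x (j : nat) : plane R := (clamp (- A) A x.1 * (j%:R / n%:R), clamp (- A) A x.2 * (j%:R / n%:R)).
have cpt j : continuous (pt ^~ j).
  by apply: cts_pair; apply: ctsM; try exact: cts_cst; apply: cts_comp; try exact: cts_clamp;
    [exact: cts_fst|exact: cts_snd].
have NA : - A <= A by rewrite lerNl (le_trans _ (ltW A0))// oppr_le0 ltW.
have ptA x j : (j <= n)%N -> `|(pt x j).1| <= A /\ `|(pt x j).2| <= A.
  move=> jn; have jn1 : `|j%:R / n%:R| <= 1 :> R.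
    by rewrite ger0_norm ?divr_ge0// ler_pdivrMr// mul1r ler_nat.
  have h (t : R) : `|clamp (- A) A t * (j%:R / n%:R)| <= A.
    rewrite normrM -[X in _ <= X]mulr1; apply: ler_pM => //.
    by rewrite ler_norml clamp_in.
  by split; exact: h.
have ptd x j : `|pt x j - pt x j.+1| <= d.
  have h (t : R) : `|clamp (- A) A t * (j%:R / n%:R) - clamp (- A) A t * (j.+1%:R / n%:R)| <= d.
    rewrite -mulrBr -mulrBl -natr1 opprD addrA subrr add0r mulN1r mulrN normrN normrM.
    apply: le_trans nd; rewrite (ger0_norm (_ : 0 <= n%:R^-1)) ?invr_ge0//.
    by apply: ler_wpM2r; rewrite ?invr_ge0// ler_norml clamp_in.
  by apply: norm_plane_le; exact: h.
pose D x j := dot (f (pt x j)) (f (pt x j.+1)).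
have Dpos x j : (j < n)%N -> 0 < D x j.
  by move=> jn; have [h1 h2] := ptA x j (ltnW jn); apply: Hd.
pose E x j := cross (f (pt x j)) (f (pt x j.+1)).
exists (fun x => a0 + \sum_(j < n) atan (E x j / D x j)); split.
  have cfpt j : continuous (fun x => f (pt x j)) by exact: cts_compT cf (cpt j).
  apply: ctsD; first exact: cts_cst.
  apply: cts_sum => j; apply: cts_comp cts_atan _; apply: ctsM.
    by apply: ctsB; apply: ctsM; solve [exact: cts_compT (@cts_fst R) (cfpt _)
      |exact: cts_compT (@cts_snd R) (cfpt _)].
  apply: cts_inv => [x|]; first by rewrite gt_eqF// Dpos.
  by apply: ctsD; apply: ctsM; solve [exact: cts_compT (@cts_fst R) (cfpt _)
    |exact: cts_compT (@cts_snd R) (cfpt _)].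
move=> x x1 x2.
have step j : (j <= n)%N -> has_angle (f (pt x j)) (a0 + \sum_(i < j) atan (E x i / D x i)).
  elim: j => [_|j IH jn].
    by rewrite big_ord0 addr0 /pt mul0r !mulr0.
  rewrite big_ord_recr/= addrA; apply: has_angle_step; first exact: IH (ltnW jn).
  exact: Dpos.
have := step n (leqnn n); rewrite {1}/pt divff ?gt_eqF// !mulr1.
rewrite !clamp_id -?ler_norml//.
by rewrite -surjective_pairing.
Qed.

(** The chord slope, completed by the derivative at [p.2 = 0]: a homotopy from tangents to
    chords. *)
Definition slope (c c' : R -> R) (p : plane R) : R :=
  if p.2 == 0 then c' p.1 else (c (p.1 + p.2) - c p.1) / p.2.

Lemma cts_slope (c c' : R -> R) (kap : R) : 0 < kap ->
  (forall s : R, is_derive s 1 c (c' s)) ->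
  (forall r t, `|c' r - c' t| <= kap * `|r - t|) -> continuous (slope c c').
Proof.
move=> kap0 dc c'lip; have cc := is_derive_continuous dc.
have bound (p : plane R) t : `|slope c c' p - c' t| <= kap * (`|p.1 - t| + `|p.2|).
  rewrite /slope; case: eqP => [->|/eqP p2]; first by rewrite normr0 addr0.
  have [r rb E] := mean_value_near p.1 (p.1 + p.2) dc.
  rewrite E addrAC subrr add0r mulfK//.
  apply: le_trans (c'lip _ _) _; rewrite ler_pM2l// [X in _ <= X]addrC.
  have -> : r - t = (r - p.1) + (p.1 - t) by ring.
  apply: le_trans (ler_normD _ _) _; rewrite lerD2r.
  by move: rb; rewrite addrAC subrr add0r.
move=> [s l]; have [->|l0] := eqVneq l 0.
  have E0 : slope c c' (s, 0) = c' s by rewrite /slope eqxx.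
  rewrite /continuous_at E0; apply/cvgrPdist_le => e e0.
  near=> p; rewrite distrC; apply: le_trans (bound p s) _.
  rewrite mulrC -ler_pdivlMr// (splitr (e / kap)); apply: lerD.
    rewrite distrC; near: p.
    apply: (@cvgr_dist_le _ _ _ _ _ (fun p : R * R => p.1) s); first exact: cvg_fst.
    by rewrite !divr_gt0.
  rewrite -normrN -sub0r; near: p.
  apply: (@cvgr_dist_le _ _ _ _ _ (fun p : R * R => p.2) (0 : R)); first exact: cvg_snd.
  by rewrite !divr_gt0.
have El : slope c c' (s, l) = (c (s + l) - c s) / l by rewrite /slope/= (negbTE l0).
have ne : \forall p \near ((s, l) : plane R), (c (p.1 + p.2) - c p.1) / p.2 = slope c c' p.
  have : \forall p \near ((s, l) : plane R), p.2 != 0.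
    have ol : nbhs (l : R) [set r : R | r != 0] 
      by apply: open_nbhs_nbhs; split; [exact: open_neq|exact: l0].
    exact: (@cts_snd R (s, l) _ ol).
  by apply: filterS => p p2; rewrite /slope (negbTE p2).
rewrite /continuous_at El; apply: (cvg_trans (near_eq_cvg ne)).
apply: cvgM; last by apply: cvgV => //; exact: (@cts_snd R (s, l)).
apply: cvgB.
  have h : continuous (fun p : plane R => c (p.1 + p.2)).
    by apply: cts_comp cc _; exact: (ctsD (@cts_fst R) (@cts_snd R)).
  exact: (h (s, l)).
have h : continuous (fun p : plane R => c p.1) by exact: cts_comp cc (@cts_fst R).
exact: (h (s, l)).
Unshelve. all: by end_near. Qed.

End Angles.

Section ClosedOrbit.
Variables (R : realType) (b : plane R -> plane R) (K B : R).
Hypothesis K0 : 0 < K.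
Hypothesis b_lip : forall x y, `|b x - b y| <= K * `|x - y|.
Hypothesis B0 : 0 < B.
Hypothesis b_bnd : forall x, `|b x| <= B.
Variable X : R -> plane R -> plane R.
Hypothesis hX : is_flow b X.
Variables (Phi : plane R -> plane R) (rho : plane R -> R).
Hypothesis bE : forall x, b x = rho x *: Phi x.
Hypothesis rho_ge0 : forall x, 0 <= rho x.
Hypothesis cPhi : continuous Phi.
Hypothesis Phi_neq0 : forall x, Phi x <> 0.
Implicit Types (x y z : plane R) (s t : R).

Let cX y : continuous (fun t => X t y) := flow_cts_time K0 b_lip B0 b_bnd hX (x := y).

Lemma rho_gt0 x : b x <> 0 -> 0 < rho x.
Proof.
move=> bx; rewrite lt_neqAle rho_ge0 andbT; apply/eqP => r0.
by apply: bx; rewrite bE -r0 scale0r.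
Qed.

(** By [pass_flow] with [e = 0], no return occurs up to the time [tau]. The return times in
    [[tau, T]] form a nonempty compact set, and the period is its least element. *)
Lemma minimal_period y T : 0 < T -> b y <> 0 -> X T y = y -> exists2 P, 0 < P &
  X P y = y /\ forall t, 0 < t -> t < P -> X t y <> y.
Proof.
move=> T0 by0 XT.
have c0 : 0 < `|b y| by rewrite normr_gt0; apply/eqP.
have [tau tau0 Hpass] := pass_flow K0 b_lip B0 b_bnd hX c0.
have small t : 0 < t -> t <= tau -> X t y <> y.
  move=> t0 tt E; have := Hpass y 0 t; rewrite subr0 => H.
  have [H1 _] := H y.1 0 (ltW t0) tt; have [_ H2] := H y.2 0 (ltW t0) tt.
  have h : `|b y| <= `|(b y).1| \/ `|b y| <= `|(b y).2|.
    by rewrite plane_norm; apply/orP; rewrite -le_max.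
  rewrite (flow0 hX) E !subrr pdist0 mulr0 mul0r lexx in H1 H2.
  by move: t0; rewrite ltNge => /negP; apply; case: h => h; [exact: H1|exact: H2].
pose A : set R := [set` `[tau, T]] `&` (fun t => `|X t y - y|) @^-1` [set r | r <= 0].
have cA : compact A.
  apply: compact_closedI; first exact: segment_compact.
  apply: closed_comp; last exact: closed_le.
  move=> t _; apply: (@cts_compT _ _ _ (fun x : plane R => `|x|) (fun t => X t y - y)).
    by move=> x; exact: norm_continuous.
  move=> s; apply: cvgB; [exact: cX|exact: cvg_cst].
have tauT : tau <= T.
  by rewrite leNgt; apply/negP => Ttau; exact: small T0 (ltW Ttau) XT.
have A0 : A !=set0.
  by exists T; split => /=; rewrite ?in_itv/= ?lexx ?tauT// XT subrr normr0.
have cid : continuous (id : R -> R) by move=> r; exact: cvg_id.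
have [P + Pmin] := compact_EVT_min A0 cA (continuous_subspaceT cid).
rewrite inE => -[/=]; rewrite in_itv/= => /andP[tauP PT].
rewrite normr_le0 subr_eq0 => /eqP XP.
exists P; first exact: lt_le_trans tauP.
split=> // t t0 tP Xt.
have [tt|tt] := leP t tau; first exact: small t0 tt Xt.
have : t \in A.
  rewrite inE; split => /=; last by rewrite Xt subrr normr0.
  by rewrite in_itv/= (ltW tt) (le_trans (ltW tP)).
by move=> /Pmin; rewrite leNgt tP.
Qed.

(* The tangent direction turns by an odd multiple of [2 pi] along a simple
   closed curve: the tangent is homotopic, through chords, to the chord
   joining points half a period apart, and the latter is reversed after half
   a period. But the direction of [Phi] lifts to the whole plane. *)
Lemma no_contractible_orbit y T : 0 < T -> b y <> 0 -> X T y <> y.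
Proof.
move=> T0 by0 XT; have [P P0 [XP Pmin]] := minimal_period T0 by0 XT.
pose H := P / 2; have H0 : 0 < H by rewrite divr_gt0.
have HP : H + H = P by rewrite /H -splitr.
pose g t := X t y.
have gP t : g (t + P) = g t by rewrite /g (flow_add K0 b_lip hX) XP.
have gP0 : g P = g 0 by rewrite -[in LHS](add0r P) gP.
have bg t : b (g t) <> 0 by move=> /(flow_root K0 b_lip hX).
have g_inj s l : 0 < l -> l < P -> g (s + l) <> g s.
  move=> l0 lP; rewrite /g (flow_add K0 b_lip hX) => E.
  by apply: (Pmin l l0 lP); rewrite -(flowK K0 b_lip hX s (X l y)) E (flowK K0 b_lip hX).
have KB : 0 < K * B by rewrite mulr_gt0.
have blip r t : `|b (g r) - b (g t)| <= K * B * `|r - t|.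
  apply: le_trans (b_lip _ _) _; rewrite -mulrA ler_pM2l//.
  exact: (flow_time_lip b_bnd hX).
pose sl1 := slope (fun t => (g t).1) (fun t => (b (g t)).1).
pose sl2 := slope (fun t => (g t).2) (fun t => (b (g t)).2).
have c1 : continuous sl1.
  apply: (cts_slope KB (is_derive_flow1 hX y)) => r t.
  by apply: le_trans (norm_fstB _ _) (blip r t).
have c2 : continuous sl2.
  apply: (cts_slope KB (is_derive_flow2 hX y)) => r t.
  by apply: le_trans (norm_sndB _ _) (blip r t).
pose cl (p : plane R) : plane R := (clamp 0 P p.1, clamp 0 H p.2).
have ccl : continuous cl.
  by apply: cts_pair; apply: cts_comp; try exact: cts_clamp; [exact: cts_fst|exact: cts_snd].
pose f p : plane R := (sl1 (cl p), sl2 (cl p)).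
have cf : continuous f.
  by apply: cts_pair; [exact: cts_compT c1 ccl|exact: cts_compT c2 ccl].
have sl0 s : (sl1 (s, 0), sl2 (s, 0)) = b (g s).
  by rewrite /sl1 /sl2 /slope/= eqxx -surjective_pairing.
have sln s l : l != 0 -> (sl1 (s, l), sl2 (s, l)) = l^-1 *: (g (s + l) - g s).
  move=> l0; rewrite /sl1 /sl2 /slope/= (negbTE l0).
  by congr pair; rewrite mulrC.
have f0 p : f p <> 0.
  rewrite /f; have /andP[q1 q2] := clamp_in p.2 (ltW H0).
  have [E|ne] := eqVneq (clamp 0 H p.2) 0.
    by rewrite /cl E sl0; exact: bg.
  rewrite /cl sln// => /eqP; rewrite scaler_eq0 invr_eq0 (negbTE ne)/= subr_eq0 => /eqP.
  apply: g_inj; first by rewrite lt_neqAle eq_sym ne.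
  by apply: le_lt_trans q2 _; rewrite -HP ltrDl.
have [th [cth Hth]] := angle_lift P0 cf f0.
have Hf s l : 0 <= s <= P -> 0 <= l <= H -> has_angle (sl1 (s, l), sl2 (s, l)) (th (s, l)).
  move=> sP lH; have -> : (sl1 (s, l), sl2 (s, l)) = f (s, l) by rewrite /f /cl/= !clamp_id.
  move/andP: sP lH => [s0 sP] /andP[l0 lH].
  apply: Hth => /=; rewrite ger0_norm//; apply: le_trans lH _.
  by rewrite -HP lerDl ltW.
have A1 : 0 < `|y| + B * P + 1 by rewrite ltr_wpDl// addr_ge0// mulr_ge0// ltW.
have [tp [ctp Htp]] := angle_lift A1 cPhi Phi_neq0.
have gA t : 0 <= t <= P -> `|g t| <= `|y| + B * P + 1.
  move=> /andP[t0 tP]; have -> : g t = y + (g t - y) by rewrite addrC subrK.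
  apply: le_trans (ler_normD _ _) _; rewrite -addrA lerD2l.
  have := flow_time_lip b_bnd hX t 0 y; rewrite (flow0 hX) subr0 (ger0_norm t0) => h.
  apply: le_trans h _; have := ler_wpM2l (ltW B0) tP; lra.
have Hb t : 0 <= t <= P -> has_angle (b (g t)) (tp (g t)).
  move=> tP; rewrite bE; apply: has_angle_scale; first by apply: rho_gt0; exact: bg.
  by apply: Htp; apply: le_trans (gA _ tP); [exact: norm_fst|exact: norm_snd].
have cline1 (l : R) : continuous (fun s => th (s, l)).
  by apply: (cts_compT cth); apply: cts_pair => s; [exact: cvg_id|exact: cvg_cst].
have cline2 (s : R) : continuous (fun l => th (s, l)).
  by apply: (cts_compT cth); apply: cts_pair => l; [exact: cvg_cst|exact: cvg_id].
have H00 : 0 <= (0 : R) <= H by rewrite lexx ltW.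
have P00 : 0 <= (0 : R) <= P by rewrite lexx ltW.
have PP : 0 <= P <= P by rewrite lexx ltW.
(* The tangent has the direction of [Phi (g s)], whose angle [tp (g s)] depends only on the point
   and so takes its initial value again after a period. *)
have bottom : th (P, 0) = th (0, 0).
  have := @cos_eq1_constant R (fun s => th (s, 0) - tp (g s)) P (ltW P0) _ _.
  rewrite /= gP0 => E; suff : th (P, 0) - tp (g 0) = th (0, 0) - tp (g 0) by lra.
  apply: E; first by apply: ctsB; [exact: cline1|exact: cts_compT ctp (@cX y)].
  move=> s sP; apply: has_angle_diff (Hb s sP); rewrite -sl0; exact: Hf.
(* The difference [th (P, l) - th (0, l)] stays a multiple of [2 pi] and is zero at [l = 0]. *)
have top : th (P, H) = th (0, H).
  have := @cos_eq1_constant R (fun l => th (P, l) - th (0, l)) H (ltW H0) _ _.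
  rewrite /= bottom subrr => E; suff : th (P, H) - th (0, H) = 0 by lra.
  apply: E; first by apply: ctsB; exact: cline2.
  move=> l lH; apply: (has_angle_diff (Hf P l PP lH)).
  have -> : (sl1 (P, l), sl2 (P, l)) = (sl1 (0, l), sl2 (0, l)).
    have [->|l0] := eqVneq l 0; first by rewrite !sl0 gP0.
    by rewrite !sln// (addrC P) gP add0r gP0.
  exact: Hf.
have HH : 0 <= H <= H by rewrite lexx ltW.
have HinP : 0 <= H <= P by rewrite ltW//= -HP lerDl ltW.
have turn s : 0 <= s <= H -> cos (th (s + H, H) - (th (s, H) + pi)) = 1.
  move=> /andP[s0 sH].
  have sP : 0 <= s <= P by rewrite s0 (le_trans sH)//; case/andP: HinP.
  have sHP : 0 <= s + H <= P by rewrite addr_ge0 ?(ltW H0)//= -HP lerD2r.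
  apply: (has_angle_diff (Hf _ _ sHP HH)).
  have -> : (sl1 (s + H, H), sl2 (s + H, H)) = - (sl1 (s, H), sl2 (s, H)).
    by rewrite !sln ?gt_eqF// -addrA HP gP -scalerN opprB.
  by apply: has_angleN; exact: Hf.
(* The two half turns, from 0 to [H] and from [H] to [P], are equal; by [top] they cancel, so
   [th (H, H) = th (0, H)]. But the chord is reversed between 0 and [H]. *)
have := @cos_eq1_constant R (fun s => th (s + H, H) - (th (s, H) + pi)) H (ltW H0) _ turn.
rewrite /= HP top add0r => /(_ _)/wrap[].
  apply: ctsB; last by apply: ctsD; [exact: cline1|exact: cts_cst].
  apply: (@cts_comp _ _ (fun s => th (s, H)) (fun s => s + H)); first exact: cline1.
  by apply: ctsD; [move=> s; exact: cvg_id|exact: cts_cst].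
move=> E; have {}E : th (H, H) = th (0, H) by lra.
have := turn 0 H00; rewrite add0r E opprD addrA subrr add0r cosN cospi.
lra.
Qed.

End ClosedOrbit.

(** * Integration of continuous periodic functions *)
Section Measurability.
Variable R : realType.

(** The sigma-algebra of [mplane] is a product; an open set belongs to it as a countable union of
    squares with rational data. *)
Lemma open_plane_measurable (U : set (plane R)) : open U -> measurable (U : set (mplane R)).
Proof.
move=> oU.
pose S (q1 q2 r : rat) : set (mplane R) := ball (ratr q1 : R) (ratr r) `*` ball (ratr q2 : R) (ratr r).
pose S' q1 q2 r : set (mplane R) := if `[< S q1 q2 r `<=` U >] then S q1 q2 r else set0.
have -> : (U : set (mplane R)) = \bigcup_(q1 : rat) \bigcup_(q2 : rat) \bigcup_(r : rat) S' q1 q2 r.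
  apply/seteqP; split; last first.
    move=> x [q1 _ [q2 _ [r _]]]; rewrite /S'; case: asboolP => // SU; exact: SU.
  move=> [x1 x2] Ux; have := open_nbhs_nbhs (conj oU Ux); rewrite -nbhs_ballE => -[/= e e0 He].
  have e2 : 0 < e / 2 by rewrite divr_gt0.
  have [r] := rat_in_itvoo e2; rewrite in_itv/= => /andP[r0 re].
  have near (t : R) : exists q : rat, `|ratr q - t| < ratr r.
    have h : t - ratr r < t + ratr r by lra.
    by have [q] := rat_in_itvoo h; rewrite in_itv/= => qt; exists q; rewrite ltr_distl.
  have [q1 h1] := near x1; have [q2 h2] := near x2.
  exists q1 => //; exists q2 => //; exists r => //.
  rewrite /S'; case: asboolP => [_|[]]; first by split; rewrite -ball_normE.
  move=> [y1 y2] [/=]; rewrite -!ball_normE/= => k1 k2; apply: He.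
  have tri (a c d : R) : `|c - a| < ratr r -> `|c - d| < ratr r -> `|a - d| < e.
    move=> ac cd; have -> : a - d = (c - d) - (c - a) by lra.
    apply: le_lt_trans (ler_normB _ _) _; lra.
  by split; rewrite -ball_normE/=; [exact: tri h1 k1|exact: tri h2 k2].
apply: bigcupT_measurable_rat => q1; apply: bigcupT_measurable_rat => q2.
apply: bigcupT_measurable_rat => r; rewrite /S'; case: asboolP => _; last exact: measurable0.
by apply: measurableX; exact: measurable_ball.
Qed.

Lemma continuous_plane_measurable (f : plane R -> R) (D : set (mplane R)) : continuous f ->
  measurable_fun D (f : mplane R -> R).
Proof.
move=> cf; apply: (@measurable_funS _ _ _ _ setT) => //.
move=> mD; apply: (measurability _ (RGenOpens.measurableE R)) => //.
move=> _ [_ [a [c ->] <-]]; rewrite setTI; apply: open_plane_measurable.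
by apply: open_comp => [x _|]; [exact: cf|exact: interval_open].
Qed.

Lemma measurable_Y2 : measurable (Y2 : set (mplane R)).
Proof. by apply: measurableX; exact: measurable_itv. Qed.

Lemma set_cons_plane (x : plane R) (s : seq (plane R)) :
  [set` x :: s] = ([set x.1] `*` [set x.2]) `|` [set` s].
Proof.
apply/seteqP; split => y /=; rewrite inE.
  by move=> /orP[/eqP ->|ys]; [left|right].
by move=> [[y1 y2]|->]; rewrite ?orbT// [y]surjective_pairing y1 y2 -surjective_pairing eqxx.
Qed.

Lemma finite_plane_measurable (A : set (plane R)) : finite_set A -> measurable (A : set (mplane R)).
Proof.
move=> /finite_seqP[s ->]; elim: s => [|x s IH]; first by rewrite set_nil; exact: measurable0.
rewrite set_cons_plane; apply: measurableU => //.
by apply: measurableX; exact: measurable_set1.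
Qed.

End Measurability.

Section MeasureFunctional.
Variables (R : realType) (mu : {measure set (mplane R) -> \bar R}) (D : set (mplane R)).
Hypothesis mD : measurable D.
Hypothesis muD : (mu D < +oo)%E.
Implicit Types (f g : plane R -> R).

Lemma integrable_per f : C0_per f -> mu.-integrable D (EFin \o (f : mplane R -> R)).
Proof.
move=> pf; have [C C0 fC] := periodic_bounded pf.
apply: measurable_bounded_integrable => //; first exact: continuous_plane_measurable pf.1.
by exists C; split; [exact: num_real|move=> r Cr z _; exact: le_trans (fC z) (ltW Cr)].
Qed.

Lemma Rintegral_linear : linear_functional (fun f => \int[mu]_(y in D) f y).
Proof.
split=> [f g pf pg|c f pf]; first by rewrite RintegralD//; exact: integrable_per.
by rewrite RintegralZl//; exact: integrable_per.
Qed.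

Lemma Rintegral_positive : positive_functional (fun f => \int[mu]_(y in D) f y).
Proof. by move=> f pf f0; apply: Rintegral_ge0 => x _; exact: f0. Qed.

Lemma Rintegral_norm f : C0_per f -> `|\int[mu]_(y in D) f y| <= \int[mu]_(y in D) `|f y|.
Proof. by move=> pf; apply: le_normr_Rintegral => //; exact: integrable_per. Qed.

Variables (b : plane R -> plane R) (K : R).
Hypothesis K0 : 0 < K.
Hypothesis b_lip : forall x y, `|b x - b y| <= K * `|x - y|.
Hypothesis b_per : Defs.periodic b.

Lemma speed_gauge_lower c z : 0 < c -> c <= `|b z| -> `|b z| * (`|b z| - c) <= speed_gauge b c z.
Proof.
move=> c0; have th (t : R) : c <= `|t| -> `|t| * (`|t| - c) = t * threshold c t.
  rewrite /threshold; have [t0 ct|t0 ct] := ger0P t.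
    by rewrite min_l// max_r//; lra.
  rewrite min_r; last by lra.
  by rewrite max_l; [ring|lra].
rewrite plane_norm /speed_gauge; have := threshold_sign (b z).1 c0; have := threshold_sign (b z).2 c0.
by rewrite /Num.max; case: ifP => _ h1 h2 /th ->; rewrite ?lerDl ?lerDr.
Qed.

Lemma cvg_moving z : b z <> 0 -> moving b n.+1%:R^-1 z @[n --> \oo] --> (1 : R).
Proof.
move=> /eqP bz; have m0 : 0 < `|b z| by rewrite normr_gt0.
pose m := `|b z|; apply/cvgrPdist_le => e e0.
near=> n.
have cm : n.+1%:R^-1 <= m / 2.
  by near: n; apply: (cvgr_le (0 : R)); [exact: cvg_harmonic|rewrite divr_gt0].
have ce : n.+1%:R^-1 <= e * (m * (m / 2)).
  by near: n; apply: (cvgr_le (0 : R)); [exact: cvg_harmonic|rewrite !mulr_gt0// divr_gt0].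
have c0 : 0 < n.+1%:R^-1 :> R by rewrite invr_gt0.
move: (n.+1%:R^-1 : R) cm ce c0 => c cm ce c0.
have G0 : m * (m / 2) <= speed_gauge b c z.
  apply: le_trans (speed_gauge_lower c0 _); first by rewrite ler_pM2l// -/m; lra.
  by rewrite -/m; apply: le_trans cm _; rewrite ler_pdivrMr// ler_peMr ?ler1n// ltW.
have mm : 0 < m * (m / 2) by rewrite mulr_gt0// divr_gt0.
have Gc : 0 < speed_gauge b c z + c by lra.
rewrite /moving (_ : 1 - _ = c / (speed_gauge b c z + c)); last by field; rewrite gt_eqF.
rewrite ger0_norm; last by rewrite divr_ge0// ltW.
rewrite ler_pdivrMr//; apply: le_trans ce _.
by rewrite ler_pM2l//; apply: ltW; lra.
Unshelve. all: by end_near. Qed.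

Lemma cvg_Rintegral_moving : (forall z, D z -> b z <> 0) ->
  \int[mu]_(z in D) moving b n.+1%:R^-1 z @[n --> \oo] --> fine (mu D).
Proof.
move=> Db.
have [|||||_ _ H] := @dominated_convergence _ _ R mu D mD (fun n z => (moving b n.+1%:R^-1 z)%:E)
    (fun=> 1%E) (fun=> 1%E).
- move=> n; apply/measurable_EFinP; apply: continuous_plane_measurable.
  have c0 : 0 < (n.+1%:R^-1 : R) by rewrite invr_gt0.
  by apply: ctsM; [have [] := C0_per_speed_gauge K0 b_lip b_per n.+1%:R^-1|
    have [] := C0_per_gauge_inv K0 b_lip b_per c0].
- exact: measurable_cst.
- by apply: nearW => z Dz; apply: cvg_EFin; [exact: nearW|exact: cvg_moving (Db _ Dz)].
- exact: (integrable_per (C0_per_cst 1)).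
- apply: nearW => z n _; have c0 : 0 < (n.+1%:R^-1 : R) by rewrite invr_gt0.
  have G0 := speed_gauge_ge0 b z c0.
  have Gc : 0 < speed_gauge b n.+1%:R^-1 z + n.+1%:R^-1 by rewrite ltr_wpDl.
  by rewrite lee_fin /moving ger0_norm ?divr_ge0 ?(ltW Gc)// ler_pdivrMr// mul1r lerDl ltW.
have E : (\int[mu]_(z in D) 1 = mu D)%E by rewrite integral_cst// mul1e.
have fin : mu D \is a fin_num by rewrite ge0_fin_numE.
apply: fine_cvg; rewrite fineK// -E; exact: H.
Qed.

End MeasureFunctional.

(** * The first integral and its increments under integer translations *)

Section FirstIntegral.
Variable R : realType.
Implicit Types (f u : plane R -> R).

Let leb_unit : lebesgue_measure (`[0%R, 1%R[ : set R) = 1%E.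
Proof. by rewrite lebesgue_measure_itv/= lte_fin ltr01 -EFinB subr0. Qed.

Lemma leb2_Y2 : leb2 (Y2 : set (mplane R)) = 1%E.
Proof.
transitivity (lebesgue_measure (`[0%R, 1%R[ : set R) * lebesgue_measure (`[0%R, 1%R[ : set R))%E.
  by apply: product_measure1E; exact: measurable_itv.
by rewrite !leb_unit mul1e.
Qed.

Lemma integral_unit_primitive (g g' : R -> R) : continuous g' ->
  (forall t : R, is_derive t 1 g (g' t)) ->
  (\int[lebesgue_measure]_(t in `[0%R, 1%R[) (g' t)%:E = (g 1 - g 0)%:E)%E.
Proof.
move=> cg' dg; have cg := is_derive_continuous dg.
rewrite integral_itv_bndo_bndc; last first.
  by apply/measurable_EFinP; apply: measurable_funTS; exact: continuous_measurable_fun.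
rewrite (@continuous_FTC2 R g' g 0 1 ltr01) ?EFinB//.
- exact: continuous_subspaceT.
- split=> [t _||]; first by have [] := dg t.
  + by apply: cvg_at_right_filter; exact: cg.
  + by apply: cvg_at_left_filter; exact: cg.
- by move=> t _; rewrite derive1E; have [_ ->] := dg t.
Qed.

Let patch_row (h : plane R -> \bar R) (a : R) :
  (forall y : R, \int[lebesgue_measure]_(x in `[0%R, 1%R[) h (x, y) = a%:E)%E ->
  (\int[lebesgue_measure]_y (\int[lebesgue_measure]_x ((h \_ Y2) (x, y))) = a%:E)%E.
Proof.
move=> ha; transitivity (\int[lebesgue_measure]_(y in `[0%R, 1%R[) a%:E)%E.
  rewrite [RHS]integral_mkcond; apply: eq_integral => y _; rewrite /patch.
  case: ifPn => yI.
    rewrite -(ha y) [RHS]integral_mkcond; apply: eq_integral => x _; rewrite /patch.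
    congr (if _ then _ else _); apply/idP/idP; rewrite !inE; first by case.
    by move=> xI; split; [|rewrite inE in yI].
  under eq_integral => x _.
    rewrite (_ : _ \in Y2 = false); last first.
      by apply/negP; rewrite inE => -[_ yI']; move/negP: yI; apply; rewrite inE.
    over.
  by rewrite integral0.
rewrite integral_cst; last exact: measurable_itv.
transitivity (a%:E * 1)%E; last by rewrite mule1.
by congr (_ * _)%E; exact: leb_unit.
Qed.

Let patch_col (h : plane R -> \bar R) (a : R) :
  (forall x : R, \int[lebesgue_measure]_(y in `[0%R, 1%R[) h (x, y) = a%:E)%E ->
  (\int[lebesgue_measure]_x (\int[lebesgue_measure]_y ((h \_ Y2) (x, y))) = a%:E)%E.
Proof.
move=> ha; rewrite -(patch_row (h := fun z => h (z.2, z.1)) ha).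
apply: eq_integral => x _; apply: eq_integral => y _; rewrite /patch.
by congr (if _ then _ else _); apply/idP/idP; rewrite !inE => -[].
Qed.

Let integrable_patch f : C0_per f ->
  leb2.-integrable setT (((EFin \o f) : mplane R -> \bar R) \_ Y2).
Proof.
move=> pf; apply: (proj1 (integrable_mkcond _ (@measurable_Y2 R))).
by apply: integrable_per => //; [exact: measurable_Y2|rewrite leb2_Y2 ltry].
Qed.

Lemma Rintegral_rows f (a : R) : C0_per f ->
  (forall y : R, \int[lebesgue_measure]_(x in `[0%R, 1%R[) (f (x, y))%:E = a%:E)%E ->
  \int[leb2]_(z in Y2) f z = a.
Proof.
move=> pf fa; rewrite /Rintegral integral_mkcond /leb2.
by rewrite -(integral21_prod_meas1 (integrable_patch pf)) /fubini_G (patch_row (h := EFin \o f) fa).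
Qed.

Lemma Rintegral_cols f (a : R) : C0_per f ->
  (forall x : R, \int[lebesgue_measure]_(y in `[0%R, 1%R[) (f (x, y))%:E = a%:E)%E ->
  \int[leb2]_(z in Y2) f z = a.
Proof.
move=> pf fa; rewrite /Rintegral integral_mkcond /leb2.
by rewrite -(integral12_prod_meas1 (integrable_patch pf)) /fubini_F (patch_col (h := EFin \o f) fa).
Qed.

Variable u : plane R -> R.
Hypothesis u_diff : forall x, differentiable u x.
Hypothesis u_grad : C0_per (grad u).

(** The gradient of the increment vanishes, so it is constant along the segment from [w] to [x]. *)
Lemma increment_constant (v w : plane R) x : (forall y, grad u (y + v) = grad u y) ->
  u (x + v) - u x = u (w + v) - u w.
Proof.
move=> gv; pose g (r : R) := u (w.1 + v.1 + r * (x - w).1, w.2 + v.2 + r * (x - w).2)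
  - u (w.1 + r * (x - w).1, w.2 + r * (x - w).2).
have dg (s : R) : is_derive s 1 g 0.
  have := deriveR_sub (line_chain_rule (w.1 + v.1, w.2 + v.2) (x - w) s u_diff)
    (line_chain_rule w (x - w) s u_diff).
  move=> /deriveR_eq; apply => /=; rewrite -[X in _ - dot _ X]gv.
  rewrite (_ : _ + v = (w.1 + v.1 + s * (x - w).1, w.2 + v.2 + s * (x - w).2)) ?subrr//.
  by rewrite [v in LHS]surjective_pairing; congr pair => /=; rewrite addrAC.
have [c _] := mean_value_near 0 1 dg; rewrite mul0r /g !mul0r !addr0 !mul1r.
rewrite -[(_, _)]/((w + v : plane R) + (x - w)) -[(w.1, w.2)]surjective_pairing.
rewrite -[(w.1 + (x - w).1, _)]/(w + (x - w)) -[(w.1 + v.1, _)]/(w + v).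
rewrite (_ : w + v + (x - w) = x + v); last by rewrite addrAC [w + (x - w)]addrC subrK.
rewrite [w + (x - w)]addrC subrK => E; lra.
Qed.

Let xi := int_Y2 leb2 (grad u).

(** On each row the first partial derivative integrates over a period to the increment of [u] under
    [(1, 0)], which is constant and therefore equal to [xi.1]; likewise for columns. Integer
    multiples of the two increments then add up. *)
Lemma u_shift k x : u (x + zvec R k) = u x + dot (zvec R k) xi.
Proof.
have [cg pg] := u_grad.
have g1 : C0_per (fun x => (grad u x).1).
  by split; [exact: cts_compT (@cts_fst R) cg|move=> l y; rewrite pg].
have g2 : C0_per (fun x => (grad u x).2).
  by split; [exact: cts_compT (@cts_snd R) cg|move=> l y; rewrite pg].
have E1 : zvec R (1, 0) = (1, 0) by rewrite /zvec/= mulr1z.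
have E2 : zvec R (0, 1) = (0, 1) by rewrite /zvec/= mulr1z.
have s1 y : u (y + (1, 0)) - u y = xi.1.
  have d (t s : R) : is_derive s 1 (fun s => u (s, t)) (grad u (s, t)).1.
    have := chain_rule (u_diff (s, t)) (is_derive_pair (deriveR_id s) (deriveR_cst t s)).
    by move=> /deriveR_eq; apply; rewrite /dot/= mul1r mul0r addr0.
  have c (t : R) : continuous (fun s => (grad u (s, t)).1).
    apply: (@cts_compT _ _ _ _ (fun s : R => (s, t)) g1.1).
    by apply: cts_pair => s; [exact: cvg_id|exact: cvg_cst].
  rewrite /xi /int_Y2 /= (@Rintegral_rows _ (u (y + (1, 0)) - u y) g1)// => t.
  transitivity (u (1, t) - u (0, t))%:E; first exact: integral_unit_primitive (c t) (d t).
  congr EFin; rewrite (increment_constant (0, t) y); last by move=> z; rewrite -E1 pg.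
  by rewrite -[(0, t) + (1, 0)]/((0 + 1, t + 0) : plane R) add0r addr0.
have s2 y : u (y + (0, 1)) - u y = xi.2.
  have d (t s : R) : is_derive s 1 (fun s => u (t, s)) (grad u (t, s)).2.
    have := chain_rule (u_diff (t, s)) (is_derive_pair (deriveR_cst t s) (deriveR_id s)).
    by move=> /deriveR_eq; apply; rewrite /dot/= mul1r mul0r add0r.
  have c (t : R) : continuous (fun s => (grad u (t, s)).2).
    apply: (@cts_compT _ _ _ _ (fun s : R => (t, s)) g2.1).
    by apply: cts_pair => s; [exact: cvg_cst|exact: cvg_id].
  rewrite /xi /int_Y2 /= (@Rintegral_cols _ (u (y + (0, 1)) - u y) g2)// => t.
  transitivity (u (t, 1) - u (t, 0))%:E; first exact: integral_unit_primitive (c t) (d t).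
  congr EFin; rewrite (increment_constant (t, 0) y); last by move=> z; rewrite -E2 pg.
  by rewrite -[(t, 0) + (0, 1)]/((t + 0, 0 + 1) : plane R) add0r addr0.
have mult (v : plane R) (c : R) : (forall y, u (y + v) - u y = c) ->
    forall (m : int) y, u (y + m%:~R *: v) = u y + m%:~R * c.
  move=> vc; have pos (n : nat) y : u (y + n%:R *: v) = u y + n%:R * c.
    elim: n y => [|n IH] y; first by rewrite scale0r addr0 mul0r addr0.
    rewrite -natr1 scalerDl scale1r addrA mulrDl mul1r addrA -IH.
    by have := vc (y + n%:R *: v); lra.
  case=> n y; first exact: pos.
  rewrite NegzE mulrNz scaleNr mulNr; have := pos n.+1 (y - n.+1%:R *: v).
  by rewrite subrK => ->; rewrite addrK.
have -> : x + zvec R k = (x + k.1%:~R *: ((1, 0) : plane R)) + k.2%:~R *: ((0, 1) : plane R).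
  rewrite -addrA; congr (_ + _); rewrite /zvec.
  transitivity ((k.1%:~R * 1 + k.2%:~R * 0, k.1%:~R * 0 + k.2%:~R * 1) : plane R); last by [].
  by rewrite !mulr1 !mulr0 addr0 add0r.
by rewrite (mult _ _ s2) (mult _ _ s1) /dot/= addrA.
Qed.

Variables (b : plane R -> plane R) (K B : R).
Hypothesis K0 : 0 < K.
Hypothesis b_lip : forall x y, `|b x - b y| <= K * `|x - y|.
Hypothesis B0 : 0 < B.
Hypothesis b_bnd : forall x, `|b x| <= B.
Hypothesis b_per : Defs.periodic b.
Variable X : R -> plane R -> plane R.
Hypothesis hX : is_flow b X.
Hypothesis dotu : forall x, dot (b x) (grad u x) = 0.

Lemma u_flow t y : u (X t y) = u y.
Proof.
have d (s : R) : is_derive s 1 (fun r => u (X r y)) 0.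
  by apply: deriveR_eq (chain_rule (u_diff _) (is_derive_flow hX y s)) (dotu _).
have [c _] := mean_value_near 0 t d; rewrite mul0r (flow0 hX) => /eqP.
by rewrite subr_eq0 => /eqP.
Qed.

Hypothesis xi_inc : incommensurable xi.

(** Such an orbit would change [u] by [dot (zvec R k) xi], which is nonzero, while [u] is constant
    along orbits. *)
Lemma no_homotopic_orbit k y t : k <> (0, 0) -> X t y <> y + zvec R k.
Proof.
move=> k0 E; have := u_flow t y; rewrite E u_shift => h.
by apply: (xi_inc k0); lra.
Qed.

Lemma flux_orthogonal (A : (plane R -> R) -> R) : linear_functional A -> positive_functional A ->
  invariant_functional X A -> (forall f, C0_per f -> `|A f| <= A (fun z => `|f z|)) ->
  A (fun z => (b z).1) * xi.1 + A (fun z => (b z).2) * xi.2 = 0.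
Proof.
move=> Alin Apos Ainv Ale.
have [w us] : exists w, w = xi by exists xi.
rewrite -us; have {}us k x : u (x + zvec R k) = u x + dot (zvec R k) w by rewrite us; exact: u_shift.
have p1 := C0_per_b1 K0 b_lip b_per; have p2 := C0_per_b2 K0 b_lip b_per.
pose f x := u x - dot x w.
have dotD (x y z : plane R) : dot (x + y) z = dot x z + dot y z.
  by rewrite /dot /= !mulrDl addrACA.
pose f' z := (b z).1 * - w.1 + (b z).2 * - w.2.
have pf : C0_per f.
  split; last first.
    move=> k x; rewrite /f us dotD; set p := dot x w; set q := dot _ w; set r := u x.
    by rewrite opprD addrA addrAC addrK.
  apply: ctsB; first by move=> x; apply: differentiable_continuous.
  by apply: ctsD; apply: ctsM; try exact: cts_cst; [exact: cts_fst|exact: cts_snd].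
have pf' : C0_per f' by apply: C0_perD; apply: C0_perM => //; exact: C0_per_cst.
have df' (s : R) z : is_derive s 1 (fun r => f (X r z)) (f' (X s z)).
  rewrite (_ : (fun r => f (X r z)) = fun r => u z - ((X r z).1 * w.1 + (X r z).2 * w.2)); last first.
    by apply/funext => r; rewrite /f u_flow.
  have d1 := deriveR_mul (is_derive_flow1 hX z s) (deriveR_cst w.1 s).
  have d2 := deriveR_mul (is_derive_flow2 hX z s) (deriveR_cst w.2 s).
  apply: deriveR_eq (deriveR_sub (deriveR_cst (u z) s) (deriveR_add d1 d2)) _.
  by rewrite /f' !mulr0 !addr0 sub0r opprD !mulrN.
have := lam_flow_derivative K0 b_lip B0 b_bnd b_per hX Alin Ainv Alin Apos Ale pf pf' df'.
rewrite /f'; have [AD AZ] := Alin.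
rewrite (_ : (fun z => _) = fun z => - w.1 * (b z).1 + - w.2 * (b z).2); last first.
  by apply/funext => z; rewrite [X in X + _]mulrC [X in _ + X]mulrC.
rewrite (AD _ _ (C0_perZ (- w.1) p1) (C0_perZ (- w.2) p2)) (AZ _ _ p1) (AZ _ _ p2).
by rewrite !mulNr -opprD => /eqP; rewrite oppr_eq0 => /eqP; rewrite [X in X + _]mulrC [X in _ + X]mulrC.
Qed.

End FirstIntegral.

(** * Invariant probability measures *)
Section InvariantMeasures.
Variables (R : realType) (b : plane R -> plane R) (K B : R).
Hypothesis K0 : 0 < K.
Hypothesis b_lip : forall x y, `|b x - b y| <= K * `|x - y|.
Hypothesis B0 : 0 < B.
Hypothesis b_bnd : forall x, `|b x| <= B.
Hypothesis b_per : Defs.periodic b.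
Variable X : R -> plane R -> plane R.
Hypothesis hX : is_flow b X.
Hypothesis roots_fin : finite_set [set x | Y2 x /\ b x = 0].
Implicit Types (mu : probability (mplane R) R) (f : plane R -> R).

Let Z : set (mplane R) := [set x | Y2 x /\ b x = 0].
Let Y' : set (mplane R) := Y2 `\` Z.

Let mZ : measurable Z. Proof. exact: finite_plane_measurable roots_fin. Qed.

Let mY' : measurable Y'.
Proof. by apply: measurableD => //; exact: measurable_Y2. Qed.

Let Y2E : (Y2 : set (mplane R)) = Y' `|` Z.
Proof. by rewrite setUC setDUK// => x []. Qed.

Let disjY'Z : [disjoint Y' & Z].
Proof. by apply/disj_setPS => x [[_ nZ] Zx]; exact: nZ. Qed.

Let fin mu A : measurable A -> (mu A < +oo)%E.
Proof. by move=> mA; rewrite (le_lt_trans (probability_le1 mu mA)) ?ltry. Qed.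

Definition moving_mass mu : R := fine (mu Y').

Definition moving_mean mu f : R := \int[mu]_(y in Y') f y.

Let massE mu : mu Y' = (moving_mass mu)%:E.
Proof. by rewrite fineK// ge0_fin_numE// fin. Qed.

Lemma moving_mass_bounds mu : 0 <= moving_mass mu <= 1.
Proof.
by rewrite fine_ge0//= -lee_fin -massE probability_le1.
Qed.

Lemma moving_mean_linear mu : linear_functional (moving_mean mu).
Proof. exact: Rintegral_linear mY' (fin mu mY'). Qed.

Lemma moving_mean_positive mu : positive_functional (moving_mean mu).
Proof. exact: Rintegral_positive. Qed.

Lemma moving_mean_norm mu f : C0_per f -> `|moving_mean mu f| <= moving_mean mu (fun z => `|f z|).
Proof. by move=> pf; exact: (Rintegral_norm mY' (fin mu mY') pf). Qed.

Lemma integral_split mu f : C0_per f ->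
  \int[mu]_(y in Y2) f y = moving_mean mu f + \int[mu]_(y in Z) f y.
Proof.
move=> pf; rewrite Y2E Rintegral_setU// -Y2E.
by apply: integrable_per => //; [exact: measurable_Y2|apply: fin; exact: measurable_Y2].
Qed.

Lemma integral_roots_eq0 mu f : (forall z, b z = 0 -> f z = 0) -> \int[mu]_(y in Z) f y = 0.
Proof.
move=> f0; rewrite (@eq_Rintegral _ _ _ mu Z (fun=> 0)); last first.
  by move=> z; rewrite inE => -[_ /f0].
by rewrite Rintegral_cst// mul0r.
Qed.

Lemma int_Y2_moving mu :
  int_Y2 mu b = (moving_mean mu (fun z => (b z).1), moving_mean mu (fun z => (b z).2)).
Proof.
rewrite /int_Y2 (integral_split mu (C0_per_b1 K0 b_lip b_per)) (integral_split mu (C0_per_b2 K0 b_lip b_per)).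
by rewrite !integral_roots_eq0 ?addr0// => z ->.
Qed.

Lemma inv_prob_invariant mu : inv_prob b mu -> Defs.invariant X mu.
Proof.
move=> [_ [X' [hX' inv]]] t psi ppsi; rewrite -(inv t psi ppsi).
apply: eq_Rintegral => y _; congr psi.
have [y0 dy] := hX' y.
by have := flow_unique K0 b_lip hX dy t; rewrite /= y0 => ->.
Qed.

(** The roots are fixed by the flow, so their contribution is the same on both sides of the
    invariance of [mu] and cancels. *)
Lemma moving_mean_invariant mu : Defs.invariant X mu -> invariant_functional X (moving_mean mu).
Proof.
move=> inv t f pf; have := inv t f pf.
rewrite (integral_split mu (C0_per_flow K0 b_lip b_per hX t pf)) (integral_split mu pf).
rewrite (@eq_Rintegral _ _ _ mu Z f); first by move=> /addIr.
by move=> z; rewrite inE => -[_ bz]; rewrite (flow_fixed K0 b_lip hX bz).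
Qed.

Lemma moving_mass_limit mu (c := fun n : nat => n.+1%:R^-1 : R) :
  moving_mean mu (moving b (c n)) @[n --> \oo] --> moving_mass mu.
Proof.
by apply: (cvg_Rintegral_moving mY' (fin mu mY') K0 b_lip b_per) => z [Yz nZ] bz; apply: nZ.
Qed.

Hypothesis no_closed : forall y (T : R) k, 0 < T -> b y <> 0 -> X T y <> y + zvec R k.

(* [lam = c A1 - A2] has zero flux, hence vanishes on the approximations [moving]
   of the indicator of the non-zeros. *)
Lemma moving_mass_proportional mu1 mu2 (c : R) : Defs.invariant X mu1 -> Defs.invariant X mu2 ->
  (forall i : bool, let bi z := if i then (b z).1 else (b z).2 in
    moving_mean mu2 bi = c * moving_mean mu1 bi) ->
  moving_mass mu2 = c * moving_mass mu1.
Proof.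
move=> /moving_mean_invariant inv1 /moving_mean_invariant inv2 flux.
pose A1 := moving_mean mu1; pose A2 := moving_mean mu2.
have [D1 Z1] := moving_mean_linear mu1; have [D2 Z2] := moving_mean_linear mu2.
have pos1 := @moving_mean_positive mu1; have pos2 := @moving_mean_positive mu2.
have le1 := moving_mean_norm mu1; have le2 := moving_mean_norm mu2.
rewrite -/A1 -/A2 in flux inv1 inv2 D1 Z1 D2 Z2 pos1 pos2 le1 le2.
(* The constant [c] may be negative, hence the absolute value in the dominating functional. *)
pose lam f := c * A1 f - A2 f; pose M f := `|c| * A1 f + A2 f.
have lam_lin : linear_functional lam.
  split=> [f g pf pg|a f pf]; rewrite /lam; first by rewrite D1// D2//; ring.
  by rewrite Z1// Z2//; ring.
have M_lin : linear_functional M.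
  split=> [f g pf pg|a f pf]; rewrite /M; first by rewrite D1// D2//; ring.
  by rewrite Z1// Z2//; ring.
have lam_inv : invariant_functional X lam by move=> t f pf; rewrite /lam inv1// inv2.
have M_inv : invariant_functional X M by move=> t f pf; rewrite /M inv1// inv2.
have M_pos : positive_functional M.
  by move=> f pf f0; rewrite addr_ge0// ?mulr_ge0//; [exact: pos1|exact: pos2].
have lam_le f : C0_per f -> `|lam f| <= M (fun z => `|f z|).
  move=> pf; apply: le_trans (ler_normB _ _) _; rewrite normrM lerD ?le2//.
  by rewrite ler_wpM2l ?le1.
have f1 : lam (fun z => (b z).1) = 0 by rewrite /lam (flux true) subrr.
have f2 : lam (fun z => (b z).2) = 0 by rewrite /lam (flux false) subrr.
have E n : A2 (moving b n.+1%:R^-1) = c * A1 (moving b n.+1%:R^-1).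
  have n0 : 0 < (n.+1%:R^-1 : R) by rewrite invr_gt0.
  have := lam_moving K0 b_lip B0 b_bnd b_per hX no_closed lam_lin lam_inv M_lin M_pos
    M_inv lam_le f1 f2 n0.
  by rewrite /lam => /eqP; rewrite subr_eq0 => /eqP.
have l1 : c * A1 (moving b n.+1%:R^-1) @[n --> \oo] --> c * moving_mass mu1.
  by apply: cvgMr; exact: moving_mass_limit.
have l2 : c * A1 (moving b n.+1%:R^-1) @[n --> \oo] --> moving_mass mu2.
  by under eq_fun do rewrite -E; exact: moving_mass_limit.
exact: (cvg_unique _ l2 l1).
Qed.

Lemma moving_mean_eq0 mu f : C0_per f -> moving_mass mu = 0 -> moving_mean mu f = 0.
Proof.
move=> pf mu0; rewrite /moving_mean /Rintegral null_set_integral//.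
  by apply/measurable_EFinP; exact: continuous_plane_measurable pf.1.
by apply: (etrans (massE mu)); rewrite mu0.
Qed.

(** Normalising a measure of mass 1 leaves it unchanged and supplies the probability structure; the
    Dirac mass is the fallback of [mnormalize], not reached here. *)
Lemma probability_of_measure (m : {measure set (mplane R) -> \bar R}) : m setT = 1%E ->
  exists mu, forall A, mu A = m A.
Proof.
move=> m1; exists (mnormalize m (dirac (0 : mplane R))) => A.
by rewrite /= /mnormalize m1 /= onee_eq0/= invr1 mule1.
Qed.

Variable z0 : plane R.
Hypothesis Yz0 : Y2 z0.
Hypothesis bz0 : b z0 = 0.

(* Rescaling the restriction of an invariant measure to the non-zeros, and
   completing it by a Dirac mass at a zero. *)
Lemma mixture mu (k l : R) : Defs.invariant X mu -> 0 <= k -> 0 <= l ->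
  k * moving_mass mu + l = 1 ->
  exists2 nu, inv_prob b nu & int_Y2 nu b = k *: int_Y2 mu b.
Proof.
move=> inv k0 l0 kl.
pose kn := NngNum k0; pose ln := NngNum l0.
pose m1 : {measure set (mplane R) -> \bar R} := mscale kn (mrestr mu mY').
pose m2 : {measure set (mplane R) -> \bar R} := mscale ln (dirac (z0 : mplane R)).
pose m : {measure set (mplane R) -> \bar R} := measure_add m1 m2.
have mY2 := @measurable_Y2 R.
have mE A : Y' `<=` A -> A z0 -> m A = 1%E.
  move=> YA Az; transitivity (m1 A + m2 A)%E; first exact: measure_addE.
  rewrite /m1 /m2 /= /mscale/= /mrestr (setIidr YA).
  by rewrite diracE mem_set// mule1 massE -EFinM -EFinD kl.
have [nu nuE] := probability_of_measure (mE setT (@subsetT _ _) I).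
have nuY2 : nu Y2 = 1%E by rewrite nuE mE// => z [].
(* Non-negative functions come first, where integrals against sums and multiples of measures split
   without integrability conditions; adding a constant then gives the general case. *)
have E0 f : C0_per f -> (forall z, 0 <= f z) ->
    \int[nu]_(z in Y2) f z = k * moving_mean mu f + l * f z0.
  move=> pf f0.
  have mf (D : set (mplane R)) : measurable_fun D (EFin \o (f : mplane R -> R)).
    by apply/measurable_EFinP; exact: continuous_plane_measurable pf.1.
  have f0' (D : set (mplane R)) : forall z, D z -> (0 <= (f z)%:E)%E by move=> z _; rewrite lee_fin.
  rewrite /Rintegral (@eq_measure_integral _ _ _ _ m); last by move=> A _ _; exact: nuE.
  rewrite (ge0_integral_measure_add m1 m2 mY2 (f0' Y2) (mf Y2)).
  rewrite /m1 /m2 !ge0_integral_mscale ?integral_dirac//; try exact: f0'; try exact: mf.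
  rewrite diracE mem_set// mul1e.
  have Z0 : mrestr mu mY' Z = 0%E.
    by rewrite /mrestr -(measure0 mu); congr (mu _); apply/seteqP; split => // z [Zz [_]].
  rewrite Y2E ge0_integral_setU//; try exact: f0'; try exact: mf.
  rewrite (null_set_integral mZ (mf Z) Z0).
  rewrite adde0 (@eq_measure_integral _ _ _ Y' mu); last first.
    by move=> A _ AY; rewrite /= /mrestr; congr (mu _); exact: setIidl.
  rewrite /= /moving_mean /Rintegral -(fineK (x := \int[mu]_(z in Y') _)%E) ?integrable_fin_num//.
  exact: (integrable_per mY' (fin mu mY') pf).
have E f : C0_per f -> \int[nu]_(z in Y2) f z = k * moving_mean mu f + l * f z0.
  move=> pf; have [C C0 fC] := periodic_bounded pf.
  have pC := C0_per_cst (R := R) C; have pfC := C0_perD pf pC.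
  have [ND NZ] := Rintegral_linear mY2 (fin nu mY2).
  have [MD MZ] := moving_mean_linear mu.
  have := E0 _ pfC _; rewrite ND// MD// (E0 _ pC); last by move=> z; exact: ltW.
  move=> /(_ _)/wrap[]; last by lra.
  by move=> z; have := fC z; rewrite ler_norml => /andP[h _]; lra.
exists nu; last first.
  rewrite (int_Y2_moving mu) /int_Y2 (E _ (C0_per_b1 K0 b_lip b_per)) (E _ (C0_per_b2 K0 b_lip b_per)).
  by rewrite bz0/= !mulr0 !addr0.
split=> //; exists X; split=> // t f pf.
rewrite (E _ pf) (E _ (C0_per_flow K0 b_lip b_per hX t pf)).
by rewrite (moving_mean_invariant inv t pf) (flow_fixed K0 b_lip hX bz0).
Qed.

Lemma inv_prob_dirac : exists mu, inv_prob b mu.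
Proof.
exists (dirac (z0 : mplane R)); split; first by rewrite /= diracE mem_set.
exists X; split=> // t f pf.
have mf (g : plane R -> R) : C0_per g -> measurable_fun Y2 (EFin \o (g : mplane R -> R)).
  by move=> pg; apply/measurable_EFinP; exact: continuous_plane_measurable pg.1.
rewrite /Rintegral !integral_dirac; [|exact: measurable_Y2|exact: mf
  |exact: measurable_Y2|exact: mf (C0_per_flow K0 b_lip b_per hX t pf)].
by rewrite (flow_fixed K0 b_lip hX bz0).
Qed.

End InvariantMeasures.

(** * Measures with a density *)

Section Density.
Variables (R : realType) (mu : probability (mplane R) R) (s : plane R -> R).
Hypothesis sL1 : L1_per s.
Hypothesis mu_s : has_density mu s.
Implicit Types (A : set (mplane R)) (f : plane R -> R).

Let mY2 := @measurable_Y2 R.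

Let ms A : measurable_fun A (EFin \o (s : mplane R -> R)).
Proof. by case: sL1 => [m _ _]; apply: measurable_funTS; exact/measurable_EFinP. Qed.

Lemma density_null A : measurable A -> A `<=` Y2 -> leb2 A = 0%E -> mu A = 0%E.
Proof. by move=> mA AY A0; rewrite mu_s// null_set_integral//; exact: ms. Qed.

Lemma leb2_finite A : finite_set A -> leb2 A = 0%E.
Proof.
move=> /finite_seqP[r ->]; elim: r => [|x r IH]; first by rewrite set_nil measure0.
have mx : measurable ([set x.1] `*` [set x.2]).
  by apply: measurableX; exact: measurable_set1.
have x0 : leb2 ([set x.1] `*` [set x.2]) = 0%E.
  transitivity (lebesgue_measure [set x.1] * lebesgue_measure [set x.2])%E.
    by apply: product_measure1E; exact: measurable_set1.
  by rewrite !lebesgue_measure_set1 mule0.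
have mr : measurable ([set` r] : set (mplane R)) by exact: finite_plane_measurable (finite_seq r).
by rewrite set_cons_plane null_set_setU.
Qed.

(** [has_density] speaks of sets only. The Radon-Nikodym derivative has the same integrals over
    sets, so it equals [s] almost everywhere, and the change of variables formula holds for it. Both
    measures are first restricted to [Y2]: they become finite, and absolute continuity is known only
    for subsets of [Y2]. *)
Lemma density_integral f : C0_per f ->
  \int[mu]_(y in Y2) f y = \int[leb2]_(y in Y2) (s y * f y).
Proof.
move=> pf; have Yoo : (leb2 (Y2 : set (mplane R)) < +oo)%E by rewrite leb2_Y2 ltry.
have muoo : (mu Y2 < +oo)%E by rewrite (le_lt_trans (probability_le1 mu mY2))// ltry.
pose m : {finite_measure set (mplane R) -> \bar R} := mfrestr mY2 Yoo.
pose nu : {finite_measure set (mplane R) -> \bar R} := mfrestr mY2 muoo.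
have mE A g : A `<=` Y2 -> (\int[m]_(x in A) g x = \int[leb2]_(x in A) g x)%E.
  move=> AY; apply: eq_measure_integral => C mC CA.
  by rewrite /= /mfrestr /mrestr setIidl//; exact: subset_trans CA AY.
have nuA A : A `<=` Y2 -> nu A = mu A by move=> AY; rewrite /= /mfrestr /mrestr setIidl.
have nuE g : (\int[nu]_(x in Y2) g x = \int[mu]_(x in Y2) g x)%E.
  by apply: eq_measure_integral => C mC CA; exact: nuA.
have num : nu `<< m.
  apply/null_content_dominatesP => A mA; rewrite /= /mfrestr /mrestr => A0.
  by apply: density_null => //; exact: measurableI.
pose r := Radon_Nikodym (charge_of_finite_measure nu) m.
have r_int : m.-integrable Y2 r.
  by apply: (integrableS measurableT) => //; exact: Radon_Nikodym_integrable.
have rs : ae_eq m Y2 r (EFin \o (s : mplane R -> R)).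
  apply: (integral_ae_eq mY2 r_int (@ms Y2)) => E EY mE'.
  rewrite -(@Radon_Nikodym_integral _ _ _ (charge_of_finite_measure nu) m E num mE') mE//.
  by rewrite -mu_s//; exact: nuA.
have mf : measurable_fun (Y2 : set (mplane R)) (EFin \o (f : mplane R -> R)).
  by apply/measurable_EFinP; exact: continuous_plane_measurable pf.1.
have f_int : nu.-integrable Y2 (EFin \o (f : mplane R -> R)).
  have nuoo : (nu Y2 < +oo)%E by rewrite nuA.
  exact: (integrable_per mY2 nuoo pf).
rewrite /Rintegral -nuE -(Radon_Nikodym_change_of_variables num mY2 f_int) -mE//.
congr fine; apply: ae_eq_integral => //.
- by apply: emeasurable_funM => //; exact: measurable_int r_int.
- by under eq_fun do rewrite EFinM; apply: emeasurable_funM => //; exact: ms.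
- by apply: filterS rs => x rx Yx; rewrite -/r rx// EFinM muleC.
Qed.

End Density.

(** * Collinearity of the mean velocities and the final statement *)

Lemma orthogonal_collinear (R : realType) (v w xi : plane R) : xi.1 != 0 -> v != 0 ->
  v.1 * xi.1 + v.2 * xi.2 = 0 -> w.1 * xi.1 + w.2 * xi.2 = 0 -> exists c, w = c *: v.
Proof.
move=> x0 v0 hv hw.
have E (z : plane R) : z.1 * xi.1 + z.2 * xi.2 = 0 -> z.1 = - (z.2 * xi.2) / xi.1.
  by move=> /eqP; rewrite addr_eq0 => /eqP <-; rewrite mulfK.
have v2 : v.2 != 0.
  apply: contraNneq v0 => v2; rewrite [v]surjective_pairing (E _ hv) v2.
  by rewrite mul0r oppr0 mul0r.
exists (w.2 / v.2); rewrite [w in LHS]surjective_pairing [v in RHS]surjective_pairing.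
rewrite (E _ hw) (E _ hv); congr pair; rewrite /=; last by rewrite /GRing.scale/= divfK.
by rewrite /GRing.scale/=; field; rewrite x0 v2.
Qed.

Theorem proposition4p4 (R : realType)
    (b Phi : plane R -> plane R) (rho : plane R -> R)
    (hb : C1_per b)
    (hbE : forall x, b x = rho x *: Phi x)
    (hrho : C1_per rho)
    (hrho_ge0 : forall x, 0 <= rho x)
    (hroots_fin : finite_set [set x | Y2 x /\ rho x = 0])
    (hroots_ex : [set x | Y2 x /\ rho x = 0] !=set0)
    (hPhi : C1_per Phi)
    (hPhi_neq0 : forall x, Phi x <> 0)
    (hu : exists u : plane R -> R,
        [/\ C1 u,
            C0_per (grad u),
            incommensurable (int_Y2 leb2 (grad u)) &
            forall y, Y2 y -> dot (Phi y) (grad u y) = 0]) :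
  exists zeta : plane R,
    C_set b = segment 0 zeta /\ (D_set b = set0 \/ D_set b = [set zeta]).
Proof.
have [u [[u_diff _] u_grad xi_inc Phi_u]] := hu.
have [K K0 b_lip] := C1_per_lipschitz hb.
have [B B0 b_bnd] := C0_per_bounded_plane (C1_per_C0_per hb).
have b_per : Defs.periodic b by case: hb.
have [X hX] := flow_exists K0 b_lip B0 b_bnd.
have rootE x : b x = 0 <-> rho x = 0.
  split=> [/eqP|r0]; last by rewrite hbE r0 scale0r.
  by rewrite hbE scaler_eq0 => /orP[/eqP|/eqP /hPhi_neq0].
have roots_fin : finite_set [set x | Y2 x /\ b x = 0].
  by apply: sub_finite_set hroots_fin => x [Yx /rootE].
have [z0 [Yz0 /rootE bz0]] := hroots_ex.
have dotu x : dot (b x) (grad u x) = 0.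
  have [k Yk] := reduce_Y2 x; have := Phi_u _ Yk; rewrite u_grad.2 (proj2 hPhi) hbE.
  by rewrite /dot/= -!mulrA -mulrDr => ->; rewrite mulr0.
have no_closed y (T : R) k : 0 < T -> b y <> 0 -> X T y <> y + zvec R k.
  move=> T0 by0; have [->|/eqP k0] := eqVneq k (0, 0).
    rewrite (_ : y + _ = y); last by rewrite /zvec/= mulr0z addr0.
    exact: (no_contractible_orbit K0 b_lip B0 b_bnd hX hbE hrho_ge0
      (C1_per_C0_per hPhi).1 hPhi_neq0 T0 by0).
  exact: (no_homotopic_orbit u_diff u_grad hX dotu xi_inc k0).
have [xi xiE] : exists xi, xi = int_Y2 leb2 (grad u) by eexists.
have xi1 : xi.1 != 0.
  apply/eqP => h; apply: (xi_inc (1, 0)); first by [].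
  by rewrite -xiE /dot/= h mulr0 mulr0z mul0r addr0.
have orth mu : inv_prob b mu -> (int_Y2 mu b).1 * xi.1 + (int_Y2 mu b).2 * xi.2 = 0.
  move=> /(inv_prob_invariant K0 b_lip hX) inv; rewrite (int_Y2_moving K0 b_lip b_per roots_fin) xiE.
  apply: (flux_orthogonal u_diff u_grad K0 b_lip B0 b_bnd b_per hX dotu).
  - exact: moving_mean_linear.
  - exact: moving_mean_positive.
  - exact: (moving_mean_invariant K0 b_lip b_per hX roots_fin inv).
  - by move=> f; exact: moving_mean_norm.
have D_dens v : D_set b v -> exists2 mu, inv_prob b mu & v = int_Y2 mu b /\ moving_mass b mu = 1.
  move=> [s [sL1 [mu [mu_s inv]] vE]]; exists mu => //; split.
    rewrite vE /int_Y2 (density_integral sL1 mu_s (C0_per_b1 K0 b_lip b_per)).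
    by rewrite (density_integral sL1 mu_s (C0_per_b2 K0 b_lip b_per)).
  have mZ := finite_plane_measurable roots_fin.
  have Z0 : mu [set x | Y2 x /\ b x = 0] = 0%E.
    by apply: (density_null sL1 mu_s mZ); [move=> x []|exact: leb2_finite roots_fin].
  rewrite /moving_mass (_ : mu _ = 1%E)//.
  rewrite -(inv.1) -[in RHS](setDUK (_ : [set x | Y2 x /\ b x = 0] `<=` Y2)); last by move=> x [].
  by rewrite setUC measureU0//; apply: measurableD => //; exact: measurable_Y2.
(* An inclusion in a singleton suffices: whether some invariant probability has a density is left
   open, and this is the alternative in the conclusion. *)
have D_cases z : D_set b `<=` [set z] -> D_set b = set0 \/ D_set b = [set z].
  move=> Dz; have [->|/set0P[v Dv]] := eqVneq (D_set b) set0; [by left|right].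
  by apply/seteqP; split=> // w ->; have <- := Dz _ Dv.
have [mu0 inv0] := inv_prob_dirac K0 b_lip b_per hX Yz0 bz0.
(* In the degenerate case [zeta = 0]; the existence of one invariant probability is still needed for
   [C_set b] to contain 0. *)
have [all0|] := pselect (forall mu, inv_prob b mu -> int_Y2 mu b = 0).
  exists 0; split; last by apply: D_cases => v /D_dens[mu inv [-> _]]; exact: all0.
  apply/seteqP; split=> [v [mu [inv ->]]|v [t _ <-]].
    by exists 0; rewrite ?all0 ?scaler0 ?addr0//= in_itv/= lexx ler01.
  by exists mu0; split=> //; rewrite all0// !scaler0 addr0.
move=> /existsNP[mu1 /not_implyP[inv1 /eqP v1]].
have hI mu := inv_prob_invariant (mu := mu) K0 b_lip hX.
pose p1 := moving_mass b mu1; have /andP[p1_ge0 p1_le1] := moving_mass_bounds roots_fin mu1.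
have p1_neq0 : p1 != 0.
  apply: contraNneq v1 => p0; rewrite (int_Y2_moving K0 b_lip b_per roots_fin).
  by rewrite !(moving_mean_eq0 roots_fin _ p0)//; [exact: C0_per_b2 K0 b_lip b_per|exact: C0_per_b1 K0 b_lip b_per].
(* This is the mean velocity of [mu1] conditioned on the non-zeros of [b]; their mass [p1] is
   nonzero because the mean velocity of [mu1] is. *)
pose zeta := p1^-1 *: int_Y2 mu1 b.
have meanE mu : inv_prob b mu -> int_Y2 mu b = moving_mass b mu *: zeta.
  move=> inv; have [c Ec] := orthogonal_collinear xi1 v1 (orth _ inv1) (orth _ inv).
  rewrite (moving_mass_proportional K0 b_lip B0 b_bnd b_per hX roots_fin no_closed
    (c := c) (hI _ inv1) (hI _ inv)) => [|i].
    by rewrite /zeta -/p1 scalerA -mulrA divff// mulr1.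
  have := Ec; rewrite !(int_Y2_moving K0 b_lip b_per roots_fin) => -[e1 e2].
  by case: i; [exact: e1|exact: e2].
exists zeta; split; last first.
  by apply: D_cases => v /D_dens[mu inv [-> m1]]; rewrite /= meanE// m1 scale1r.
apply/seteqP; split=> [v [mu [inv ->]]|v [t /=]].
  exists (moving_mass b mu); last by rewrite scaler0 add0r meanE.
  by rewrite /= in_itv/= moving_mass_bounds.
rewrite in_itv/= => /andP[t0 t1] <-; rewrite scaler0 add0r.
(* Scaling by [t / p1] gives the non-zeros the mass [t], and the root [z0] receives the remaining
   [1 - t]. *)
have [|||nu inv E] := mixture K0 b_lip b_per hX roots_fin Yz0 bz0 (k := t / p1) (l := 1 - t) (hI _ inv1).
- by rewrite divr_ge0.
- by rewrite subr_ge0.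
- by rewrite -/p1 divfK// addrC subrK.
by exists nu; split=> //; rewrite E /zeta scalerA.
Qed.
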